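(* Let $(\pi:\mathcal X\to M,\ J,\ L)$ be a scale-invariant special K\''ahler (SK) geometry of rank $2$ over a connected complex manifold $M$ of dimension $2$ (the regular locus of a Coulomb branch). Suppose that the generic fiber has an enhanced automorphism group, i.e. for all $u$ in a dense open subset of $M$ the automorphism group $\mathrm{Aut}(X_u,J)$ of the polarized abelian variety $(X_u,J)$ is strictly larger than $\{\pm1\}\cong\mathbb Z_2$. Then the SK geometry is isotrivial.
   Context: A polarized abelian variety (p.a.v.) of rank $r$ is a pair $(X,J)$ where $X=V/\Lambda$ is an $r$-dimensional complex torus and $J$ is a polarization, i.e. a non-degenerate integral skew-symmetric form on $\Lambda=H_1(X,\mathbb Z)$ that is the imaginary part of a positive-definite hermitian form on $V$. There is a basis $\{\alpha_i,\beta^i\}$ of $\Lambda$ in which $J=\begin{pmatrix}0&\Delta\\-\Delta&0\end{pmatrix}$, $\Delta=\mathrm{diag}(d_1,\dots,d_r)$ with positive integers $d_i\mid d_{i+1}$ (a symplectic basis), and a basis $\{\theta^i\}$ of holomorphic $1$-forms with $\int_{\alpha_i}\theta^j=\Delta^j_i$; then $\tau^{ij}=\int_{\beta^i}\theta^j$ is symmetric with positive-definite imaginary part and is called the modulus. $\mathrm{Aut}(X,J)$ is the (finite) group of holomorphic group automorphisms of $X$ preserving $J$; it always contains $\pm1$. An SK geometry of rank $r$ over $M$ (with $\dim_{\mathbb C}M=r$) consists of a holomorphic family $\pi:\mathcal X\to M$ of $r$-dimensional complex tori $X_u=\pi^{-1}(u)$, a polarization $J$ on the fibers that is locally constant on the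 lattices $H_1(X_u,\mathbb Z)$, making each $(X_u,J)$ a p.a.v., and a closed non-degenerate holomorphic $(2,0)$-form $L$ on $\mathcal X$ whose restriction to each fiber vanishes. It is scale-invariant if there is a holomorphic local action $(\lambda,u)\mapsto\lambda\circ u$ of $\mathbb C^\times$ near the identity: every point of $M$ has a neighborhood $U$ and an $\epsilon>0$ such that $\lambda\circ u\in M$ is defined and holomorphic for $u\in U$, $\lambda\in B_\epsilon=\{|\lambda-1|<\epsilon\}$, with $1\circ u=u$, $\lambda\circ(\mu\circ u)=(\lambda\mu)\circ u$ whenever defined, and $\lambda\circ u\ne u$ for $\lambda\neq1$; and this action lifts to a holomorphic local action on $\mathcal X$ covering it that maps fibers $X_u\to X_{\lambda\circ u}$ by isomorphisms of p.a.v.s and satisfies $\lambda^*L=\lambda L$. The SK geometry is isotrivial if, on every contractible open subset $\mathcal C\subset M$, with respect to a locally constant symplectic basis of the fiber homology, the modulus $\tau^{ij}(u)$ is constant on $\mathcal C$ (equivalently, $\tau$ is locally constant on $M$). *)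

(* Defs.v *)
From HB Require Import structures.
From mathcomp Require Import all_boot all_order all_algebra.
From mathcomp Require Import all_classical all_reals all_analysis.
From mathcomp Require Import complex.

Set Implicit Arguments.
Unset Strict Implicit.
Unset Printing Implicit Defensive.

Import Order.TTheory GRing.Theory Num.Theory.
Import numFieldNormedType.Exports.

Local Open Scope classical_set_scope.
Local Open Scope ring_scope.

(* R[i] bundled as a numClosedFieldType: on this type (and not on R[i]) the
   normed topology of numFieldNormedType is inferred, so that [differentiable]
   and ['d] below mean complex (Frechet) differentiability and differential. *)
Definition Cplx (R : realType) : numClosedFieldType := R[i].

Record chart (R : realType) (M : topologicalType) (n : nat) := Chart {
  cdom : set M ;
  ccod : set 'rV[Cplx R]_n ;
  cfun : M -> 'rV[Cplx R]_n ;
  cinv : 'rV[Cplx R]_n -> M ;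
  open_cdom : open cdom ;
  open_ccod : open ccod ;
  cfun_cod : forall x, cdom x -> ccod (cfun x) ;
  cinv_dom : forall y, ccod y -> cdom (cinv y) ;
  cfunK : forall x, cdom x -> cinv (cfun x) = x ;
  cinvK : forall y, ccod y -> cfun (cinv y) = y ;
  cfun_continuous : forall x, cdom x -> {for x, continuous cfun} ;
  cinv_continuous : forall y, ccod y -> {for y, continuous cinv} }.

Record cmanifold (R : realType) (n : nat) := CManifold {
  mspace :> topologicalType ;
  atlas : set (chart R mspace n) ;
  atlas_cover : forall x, exists2 c, atlas c & cdom c x ;
  atlas_hol : forall c d, atlas c -> atlas d ->
    forall x, cdom c x -> cdom d x ->
      differentiable (cfun d \o cinv c) (cfun c x) ;
  mspace_hausdorff : hausdorff_space mspace ;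
  mspace_second_countable : @second_countable mspace }.

Definition chart_at (R : realType) (n : nat) (N : cmanifold R n) (x : N)
    (c : chart R N n) : Prop :=
  atlas c /\ cdom c x.

(* The predicates [diff_*] are complex differentiability at one point; a map
   is holomorphic on an open set when they hold at every point of it. *)

Definition diff_into (R : realType) (V : normedModType (Cplx R)) (n : nat)
    (N : cmanifold R n) (F : V -> N) (v : V) : Prop :=
  {for v, continuous F} /\
  forall d, chart_at (F v) d -> differentiable (cfun d \o F) v.

Definition diff_from (R : realType) (W : normedModType (Cplx R)) (n : nat)
    (N : cmanifold R n) (f : N -> W) (x : N) : Prop :=
  forall c, chart_at x c -> differentiable (f \o cinv c) (cfun c x).

Definition diff_map (R : realType) (m n : nat) (M : cmanifold R m)
    (N : cmanifold R n) (f : M -> N) (x : M) : Prop :=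
  forall c, chart_at x c -> diff_into (f \o cinv c) (cfun c x).

Definition diff_param (R : realType) (V : normedModType (Cplx R)) (m n : nat)
    (M : cmanifold R m) (N : cmanifold R n) (f : V -> M -> N) (v : V) (x : M)
    : Prop :=
  forall c, chart_at x c ->
    diff_into (fun p : V * 'rV[Cplx R]_m => f p.1 (cinv c p.2)) (v, cfun c x).

Definition bil (R : realType) (n : nat) (A : 'M[Cplx R]_n)
    (v w : 'rV[Cplx R]_n) : Cplx R :=
  (v *m A *m w^T) 0 0.

(* A (2,0)-form is given by its coefficient matrices in the charts:
   in the chart c it is \sum_(i, j) L c y i j / 2 dy^i /\ dy^j. *)
Record symplectic_form (R : realType) (n : nat) (N : cmanifold R n) :=
  SymplecticForm {
  form :> chart R N n -> 'rV[Cplx R]_n -> 'M[Cplx R]_n ;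
  form_skew : forall c, atlas c -> forall y, ccod c y ->
    (form c y)^T = - form c y ;
  form_hol : forall c, atlas c -> forall y, ccod c y ->
    differentiable (form c) y ;
  form_transition : forall x c d, chart_at x c -> chart_at x d ->
    let T := 'd (cfun d \o cinv c) (cfun c x) in
    forall v w, bil (form d (cfun d x)) (T v) (T w)
                = bil (form c (cfun c x)) v w ;
  form_closed : forall c, atlas c -> forall y, ccod c y ->
    forall i j k,
      'D_(delta_mx 0 i) (fun z => form c z j k) y
      + 'D_(delta_mx 0 j) (fun z => form c z k i) y
      + 'D_(delta_mx 0 k) (fun z => form c z i j) y = 0 ;
  form_nondegenerate : forall c, atlas c -> forall y, ccod c y ->
    form c y \in unitmx }.

(* b is R-linearly independent and L is its Z-span. *)
Definition lattice_basis (R : realType) (V : vectType (Cplx R)) (n : nat)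
    (L : set V) (b : 'I_n -> V) : Prop :=
  (forall x : 'I_n -> R,
     \sum_i (real_complex R (x i) : Cplx R) *: b i = 0 -> forall i, x i = 0) /\
  L = [set v | exists k : 'I_n -> int, v = \sum_i b i *~ k i].

(* H is conjugate-linear in its first and linear in its second argument; this
   is the convention for which the modulus has positive imaginary part when
   J(alpha_i, beta^i) = d_i > 0. *)
Definition polarization (R : realType) (V : vectType (Cplx R)) (L : set V)
    (J : V -> V -> int) : Prop :=
  (forall x y, L x -> L y -> J y x = - J x y) /\
  (forall x, L x -> (forall y, L y -> J x y = 0) -> x = 0) /\
  exists H : V -> V -> Cplx R,
    (forall x (a : Cplx R) y z, H x (a *: y + z) = a * H x y + H x z) /\
    (forall x y, H y x = Num.conj (H x y)) /\
    (forall x, x != 0 -> 0 < H x x) /\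
    (forall x y, L x -> L y -> complex.Im (H x y) = (J x y)%:~R).

(* alpha_i = b (lshift r i) and beta^i = b (rshift r i). *)
Definition symplectic_basis (R : realType) (V : vectType (Cplx R)) (r : nat)
    (L : set V) (J : V -> V -> int) (d : 'I_r -> nat) (b : 'I_(r + r) -> V)
    : Prop :=
  lattice_basis L b /\
  (forall i, 0 < d i)%N /\
  (forall i j : 'I_r, (i <= j)%N -> (d i %| d j)%N) /\
  (forall i j : 'I_r,
     [/\ J (b (lshift r i)) (b (lshift r j)) = 0,
         J (b (rshift r i)) (b (rshift r j)) = 0,
         J (b (lshift r i)) (b (rshift r j)) = (if i == j then (d i)%:Z else 0)
       & J (b (rshift r i)) (b (lshift r j))
         = - (if i == j then (d i)%:Z else 0)]).

(* The holomorphic 1-forms on V / L are the C-linear functionals theta on V,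
   and the integral of theta over the 1-cycle v in L is theta v. *)
Definition is_modulus (R : realType) (V : vectType (Cplx R)) (r : nat)
    (d : 'I_r -> nat) (b : 'I_(r + r) -> V) (tau : 'M[Cplx R]_r) : Prop :=
  exists theta : 'I_r -> {linear V -> Cplx R},
    (forall i j, theta j (b (lshift r i)) = (if i == j then d i else 0%N)%:R) /\
    (forall i j, tau i j = theta j (b (rshift r i))).

(* The data of a family: the fiber X_u is the quotient of the complex vector
   space [cov u] by the lattice [lat u] = H_1(X_u, Z), via [texp u]; the
   group law of X_u is the one induced from [cov u]. *)
Record torus_data (R : realType) (r : nat) (M : cmanifold R r) := TorusData {
  total : cmanifold R (r + r) ;
  tproj : total -> M ;
  cov : M -> vectType (Cplx R) ;
  texp : forall u, cov u -> total }.

Definition fiber (R : realType) (r : nat) (M : cmanifold R r)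
    (F : torus_data M) (u : M) : set (total F) :=
  @tproj _ _ _ F @^-1` [set u].

Definition lat (R : realType) (r : nat) (M : cmanifold R r)
    (F : torus_data M) (u : M) : set (cov F u) :=
  [set v | texp v = texp (0 : cov F u)].

(* A local presentation of the family over U as the quotient of U x C^r by the
   lattices spanned by holomorphic period vectors, the rows of [per u]:
   (u, z) |-> texp (frame u z) is holomorphic, with local holomorphic
   inverses x |-> (tproj x, s x). *)
Record local_triv (R : realType) (r : nat) (M : cmanifold R r)
    (F : torus_data M) (U : set M)
    (frame : forall u, {linear 'rV[Cplx R]_r -> cov F u})
    (per : M -> 'M[Cplx R]_(r + r, r)) : Prop := LocalTriv {
  triv_open : open U ;
  triv_frame : forall u, U u -> bijective (frame u) ;
  triv_lattice : forall u, U u ->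
    lattice_basis (@lat _ _ _ F u) (fun a => frame u (row a (per u))) ;
  triv_per_hol : forall u, U u -> diff_from per u ;
  triv_hol : forall u z, U u -> diff_param (fun z u => texp (frame u z)) z u ;
  triv_inv : forall u z, U u -> exists s : total F -> 'rV[Cplx R]_r,
    (\forall x \near texp (frame u z),
       texp (frame (tproj x) (s x)) = x /\ diff_from s x) /\
    (\forall p \near (u, z), s (texp (frame p.1 p.2)) = p.2) }.

Record torus_family (R : realType) (r : nat) (M : cmanifold R r) :=
  TorusFamily {
  tdata :> torus_data M ;
  tproj_hol : forall x, diff_map (@tproj _ _ _ tdata) x ;
  cov_dim : forall u, \dim {: cov tdata u} = r ;
  texp_onto : forall u, range (@texp _ _ _ tdata u) = fiber u ;
  texp_eq : forall u (v w : cov tdata u),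
    texp v = texp w <-> lat (v - w) ;
  triv_cover : forall u, exists U frame per,
    @local_triv _ _ _ tdata U frame per /\ U u }.

(* A section b of the lattices over O is locally constant when its coordinates
   on the local period vectors are. *)
Definition locally_constant (R : realType) (r : nat) (M : cmanifold R r)
    (F : torus_data M) (O : set M) (b : forall u, cov F u) : Prop :=
  forall U frame per, @local_triv _ _ _ F U frame per ->
  forall u0, O u0 -> U u0 -> exists k : 'I_(r + r) -> int,
    \forall u \near u0, b u = \sum_a frame u (row a (per u)) *~ k a.

Record sk_geometry (R : realType) (r : nat) (M : cmanifold R r) :=
  SKGeometry {
  fam :> torus_family M ;
  pol : forall u, cov fam u -> cov fam u -> int ;
  pol_polarization : forall u, polarization (@lat _ _ _ fam u) (@pol u) ;
  pol_locally_constant : forall U frame per,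
    @local_triv _ _ _ fam U frame per ->
    forall u0 a b, U u0 ->
      \forall u \near u0,
        pol (frame u (row a (per u))) (frame u (row b (per u)))
        = pol (frame u0 (row a (per u0))) (frame u0 (row b (per u0))) ;
  sform : symplectic_form (total fam) ;
  sform_fiber : forall (x : total fam) c d,
    chart_at x c -> chart_at (tproj x) d ->
    let T := 'd (cfun d \o @tproj _ _ _ fam \o cinv c) (cfun c x) in
    forall v w, T v = 0 -> T w = 0 -> bil (sform c (cfun c x)) v w = 0 }.

(* f restricts to an isomorphism of polarized abelian varieties X_u -> X_v.
   The additive lift g expresses that f is a group morphism, and the action of
   f on H_1 is the restriction of g to [lat u]: the lift is unique, as an
   additive map from a complex vector space to a lattice is zero. *)
Definition pav_iso (R : realType) (r : nat) (M : cmanifold R r)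
    (G : sk_geometry M) (u v : M) (f : total G -> total G) : Prop :=
  set_bij (@fiber _ _ _ G u) (@fiber _ _ _ G v) f /\
  (forall phi : {linear 'rV[Cplx R]_r -> cov G u},
     forall z, diff_into (fun z => f (texp (phi z))) z) /\
  exists g : {additive cov G u -> cov G v},
    (forall x, f (texp x) = texp (g x)) /\
    (forall x y, lat x -> lat y -> pol (g x) (g y) = pol x y).

Definition enhanced_aut (R : realType) (r : nat) (M : cmanifold R r)
    (G : sk_geometry M) (u : M) : Prop :=
  exists f : total G -> total G, pav_iso u u f /\
    ~ (forall v : cov G u, f (texp v) = texp v) /\
    ~ (forall v : cov G u, f (texp v) = texp (- v)).

(* A holomorphic local action of C^* near the identity, with domain of
   definition D. *)
Record local_action (R : realType) (n : nat) (N : cmanifold R n)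
    (D : set (Cplx R * N)) (act : Cplx R -> N -> N) : Prop := LocalAction {
  act_open : open D ;
  act_neq0 : forall l x, D (l, x) -> l != 0 ;
  act_near1 : forall x : N, exists (U : set N) (e : R), nbhs x U /\ 0 < e /\
    forall (l : Cplx R) y,
      `|l - 1| < (real_complex R e : Cplx R) -> U y -> D (l, y) ;
  act_hol : forall l x, D (l, x) -> diff_param act l x ;
  act1 : forall x, act 1 x = x ;
  actM : forall l m x, D (m, x) -> D (l, act m x) -> D (l * m, x) ->
    act l (act m x) = act (l * m) x }.

Definition scale_invariant (R : realType) (r : nat) (M : cmanifold R r)
    (G : sk_geometry M) : Prop :=
  exists (D : set (Cplx R * M)) (act : Cplx R -> M -> M)
         (actX : Cplx R -> total G -> total G),
    let DX := [set p : Cplx R * total G | D (p.1, tproj p.2)] in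
    local_action D act /\
    (forall l u, D (l, u) -> act l u = u -> l = 1) /\
    local_action DX actX /\
    (forall l x, DX (l, x) -> tproj (actX l x) = act l (tproj x)) /\
    (forall l u, D (l, u) -> pav_iso u (act l u) (actX l)) /\
    (forall l x c d, DX (l, x) -> chart_at x c -> chart_at (actX l x) d ->
       let T := 'd (cfun d \o actX l \o cinv c) (cfun c x) in
       forall v w, bil (sform G d (cfun d (actX l x))) (T v) (T w)
                   = l * bil (sform G c (cfun c x)) v w).

(* A contractible subset of M: the homotopy takes place inside A. *)
Definition contractible (R : realType) (M : topologicalType) (A : set M)
    : Prop :=
  exists (x0 : M) (H : R * M -> M), A x0 /\
    {within `[0, 1]%classic `*` A, continuous H} /\
    (forall t x, `[0, 1]%classic t -> A x -> A (H (t, x))) /\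
    (forall x, A x -> H (0, x) = x) /\
    (forall x, A x -> H (1, x) = x0).

Definition isotrivial (R : realType) (r : nat) (M : cmanifold R r)
    (G : sk_geometry M) : Prop :=
  forall (A : set M) (d : 'I_r -> nat) (b : 'I_(r + r) -> forall u, cov G u),
    open A -> contractible R A ->
    (forall a, locally_constant A (b a)) ->
    (forall u, A u ->
       symplectic_basis (@lat _ _ _ G u) (@pol _ _ _ G u) d
         (fun a => b a u)) ->
    exists tau, forall u, A u -> is_modulus d (fun a => b a u) tau.

(* Main.v *)
(* Scale invariance makes L exact: contracting it with the vector field of the
   C^*-action gives a 1-form theta with d theta = L. In a chart of M, the
   components of theta along the fibers, and of L between base and fiber, are
   periodic on the covering C^r, hence constant by Liouville's theorem. If the
   rows of P(y) are the periods, this produces special coordinates: a vector a(y)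
   with d(P a) = P A for an invertible matrix A(y).

   Call y curved when k P(y) = 0 and k dP(y) <> 0 for some k. Where there is no
   curved point, the derivative of the modulus vanishes. An automorphism other
   than +-1 acts on H_1 by a non-scalar integer matrix N with N P = P D; near a
   generic curved point a single N works on an open set, by Baire's theorem. The
   rows k dP are annihilated by a and preserved by D, so that in rank 2 the vector
   a is an eigenvector of D, i.e. N (P a) = nu P a with nu locally constant.
   Differentiating gives N P = nu P. As N is real and [P | conj P] is invertible,
   either nu is real and N is scalar, or the columns of dP, which satisfy
   N dP = nu dP, lie in the column space of P, contradicting curvedness.

   Holomorphic functions are taken here to be complex differentiable ones. Goursat's
   theorem on rectangles, applied in logarithmic polar coordinates, gives the
   mean value property; the Cauchy estimates then follow from the maximum
   principle, without contour integrals or power series. *)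

From HB Require Import structures.
Require Import Defs.
From mathcomp Require Import all_boot all_order all_algebra.
From mathcomp Require Import all_classical all_reals all_analysis.
From mathcomp Require Import complex ring lra.

Set Implicit Arguments.
Unset Strict Implicit.
Unset Printing Implicit Defensive.

Import Order.TTheory GRing.Theory Num.Theory.
Import numFieldNormedType.Exports.

Local Open Scope classical_set_scope.
Local Open Scope ring_scope.

(** * Goursat's theorem on rectangles *)

Section Goursat.
Variable R : realType.
Implicit Types (P Q F G : R -> R -> R).

Definition diff2 P (x y px py : R) := forall e, 0 < e -> exists2 d, 0 < d &
  forall x' y', `|x' - x| <= d -> `|y' - y| <= d ->
  `|P x' y' - P x y - px * (x' - x) - py * (y' - y)| <= e * (`|x' - x| + `|y' - y|).

Lemma increment_le (f df : R -> R) (a b M : R) : a <= b ->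
  (forall x, a <= x <= b -> is_derive x 1 f (df x)) ->
  (forall x, a <= x <= b -> `|df x| <= M) -> `|f b - f a| <= M * (b - a).
Proof.
move=> ab fdf dfM.
have [c cab ->] : exists2 c, c \in `[a, b]%R & f b - f a = df c * (b - a).
  apply: MVT_segment => // [x|].
    by rewrite in_itv /= => /andP[ax xb]; apply: fdf; rewrite !ltW.
  apply: continuous_in_subspaceT => x; rewrite inE /= in_itv /= => xab.
  have := fdf x xab => -[+ _]; move=> /derivable1_diffP.
  exact: differentiable_continuous.
rewrite normrM (ger0_norm (_ : 0 <= b - a)) ?subr_ge0//.
by apply: ler_wpM2r; rewrite ?subr_ge0// dfM//; rewrite in_itv in cab.
Qed.

Definition circulation F G (x y w h : R) :=
  F (x + w) y - F x y + (G (x + w) (y + h) - G (x + w) y)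
  - (F (x + w) (y + h) - F x (y + h)) - (G x (y + h) - G x y).

Lemma circulation_split F G x y w h :
  circulation F G x y w h =
  circulation F G x y (w / 2) (h / 2) +
  circulation F G (x + w / 2) y (w / 2) (h / 2) +
  circulation F G x (y + h / 2) (w / 2) (h / 2) +
  circulation F G (x + w / 2) (y + h / 2) (w / 2) (h / 2).
Proof.
rewrite /circulation.
have half (u v : R) : u + v / 2 + v / 2 = u + v by field.
rewrite !half; ring.
Qed.

Lemma affine_primitive (F : R -> R) (f : R -> R) (x0 x1 a p q M : R) : x0 <= x1 ->
  (forall x, x0 <= x <= x1 -> is_derive x 1 F (f x)) ->
  (forall x, x0 <= x <= x1 -> `|f x - p - q * (x - a)| <= M) ->
  `|F x1 - F x0 - (p * (x1 - x0) + q / 2 * ((x1 - a) ^+ 2 - (x0 - a) ^+ 2))|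
    <= M * (x1 - x0).
Proof.
move=> x01 dF fM.
pose phi := fun x => F x - (p * x + q / 2 * (x - a) ^+ 2).
have -> : F x1 - F x0 - (p * (x1 - x0) + q / 2 * ((x1 - a) ^+ 2 - (x0 - a) ^+ 2))
  = phi x1 - phi x0 by rewrite /phi; ring.
apply: (@increment_le phi (fun x => f x - p - q * (x - a))) => // x xI.
have dFx := dF _ xI.
rewrite /phi.
apply: is_derive_eq.
by rewrite /GRing.scale /=; field.
Qed.

Lemma circulation_local P Q F G (a b px py qy e d x y w h : R) :
  0 <= w -> 0 <= h -> x <= a <= x + w -> y <= b <= y + h ->
  w <= d -> h <= d -> 0 <= e ->
  (forall x' y', `|x' - a| <= d -> `|y' - b| <= d ->
    `|P x' y' - P a b - px * (x' - a) - py * (y' - b)|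
      <= e * (`|x' - a| + `|y' - b|)) ->
  (forall x' y', `|x' - a| <= d -> `|y' - b| <= d ->
    `|Q x' y' - Q a b - py * (x' - a) - qy * (y' - b)|
      <= e * (`|x' - a| + `|y' - b|)) ->
  (forall x' y', x <= x' <= x + w -> y <= y' <= y + h ->
     is_derive x' 1 (F^~ y') (P x' y')) ->
  (forall x' y', x <= x' <= x + w -> y <= y' <= y + h ->
     is_derive y' 1 (G x') (Q x' y')) ->
  `|circulation F G x y w h| <= 2 * e * (w + h) ^+ 2.
Proof.
move=> w0 h0 xa yb wd hd e0 dP dQ dF dG.
have near1 x' : x <= x' <= x + w -> `|x' - a| <= w.
  by move=> xI; rewrite ler_norml; lra.
have near2 y' : y <= y' <= y + h -> `|y' - b| <= h.
  by move=> yI; rewrite ler_norml; lra.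
have xw : x <= x + w by lra.
have yh : y <= y + h by lra.
have hor y' : y <= y' <= y + h -> `|F (x + w) y' - F x y' -
   ((P a b + py * (y' - b)) * (x + w - x) + px / 2 * ((x + w - a) ^+ 2 - (x - a) ^+ 2))|
    <= e * (w + h) * (x + w - x).
  move=> y'I; apply: (@affine_primitive (F^~ y') (P^~ y')) => // x' x'I.
    exact: dF.
  have := dP x' y' (le_trans (near1 _ x'I) wd) (le_trans (near2 _ y'I) hd).
  have -> : P x' y' - P a b - px * (x' - a) - py * (y' - b) =
    P x' y' - (P a b + py * (y' - b)) - px * (x' - a) by ring.
  move=> /le_trans; apply; apply: ler_wpM2l => //.
  by apply: lerD; [exact: near1|exact: near2].
have ver x' : x <= x' <= x + w -> `|G x' (y + h) - G x' y -
   ((Q a b + py * (x' - a)) * (y + h - y) + qy / 2 * ((y + h - b) ^+ 2 - (y - b) ^+ 2))|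
    <= e * (w + h) * (y + h - y).
  move=> x'I; apply: (@affine_primitive (G x') (Q x')) => // y' y'I.
    exact: dG.
  have := dQ x' y' (le_trans (near1 _ x'I) wd) (le_trans (near2 _ y'I) hd).
  have -> : Q x' y' - Q a b - py * (x' - a) - qy * (y' - b) =
    Q x' y' - (Q a b + py * (x' - a)) - qy * (y' - b) by ring.
  move=> /le_trans; apply; apply: ler_wpM2l => //.
  by apply: lerD; [exact: near1|exact: near2].
have h1 : `|_| <= _ := hor y ltac:(lra).
have h2 : `|_| <= _ := hor (y + h) ltac:(lra).
have v1 : `|_| <= _ := ver x ltac:(lra).
have v2 : `|_| <= _ := ver (x + w) ltac:(lra).
move: h1 h2 v1 v2; set A1 := (X in `|X| <= _); move=> h1.
set A2 := (X in `|X| <= _); move=> h2.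
set A3 := (X in `|X| <= _); move=> v1.
set A4 := (X in `|X| <= _); move=> v2.
have -> : circulation F G x y w h = A1 - A2 + (A4 - A3).
  rewrite /circulation /A1 /A2 /A3 /A4; ring.
apply: (le_trans (ler_normD _ _)).
apply: (le_trans (lerD (ler_normB _ _) (ler_normB _ _))).
have -> : 2 * e * (w + h) ^+ 2 =
  e * (w + h) * (x + w - x) + e * (w + h) * (x + w - x)
  + (e * (w + h) * (y + h - y) + e * (w + h) * (y + h - y)) by ring.
by apply: lerD; apply: lerD.
Qed.

Lemma nested_point (x : nat -> R) (w : R) : 0 <= w ->
  (forall n, x n <= x n.+1 /\ x n.+1 + w / 2 ^+ n.+1 <= x n + w / 2 ^+ n) ->
  exists a, forall n, x n <= a <= x n + w / 2 ^+ n.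
Proof.
move=> w0 xS.
have wn n : 0 <= w / 2 ^+ n by apply: divr_ge0 => //; apply: exprn_ge0.
have incr m n : (m <= n)%N -> x m <= x n /\ x n + w / 2 ^+ n <= x m + w / 2 ^+ m.
  elim: n => [|n IH]; first by rewrite leqn0 => /eqP ->.
  rewrite leq_eqVlt => /predU1P[->//|]; rewrite ltnS => /IH.
  have := xS n; lra.
have xm m n : x n <= x m + w / 2 ^+ m.
  have := wn n; have := wn m.
  case: (leqP m n) => [/incr|/ltnW /incr]; lra.
exists (sup (range x)) => n; apply/andP; split.
  apply: ub_le_sup; last by exists n.
  by exists (x 0%N + w / 2 ^+ 0) => _ [k _ <-]; exact: xm.
by apply: ge_sup; [exists (x 0%N), 0%N|move=> _ [k _ <-]; exact: xm].
Qed.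

Lemma goursat_arith (w h t c j e : R) : j <= t * t * c ->
  c <= 2 * e * (w / t + h / t) ^+ 2 -> 0 < t -> 0 < e ->
  e * ((w + h) ^+ 2 + 1) = j / 4 -> 0 < j -> False.
Proof.
move=> jc + t0 e0 small j0.
have -> : 2 * e * (w / t + h / t) ^+ 2 = 2 * e * (w + h) ^+ 2 / (t * t).
  by field; rewrite gt_eqF.
rewrite ler_pdivlMr ?mulr_gt0// [X in X <= _ -> _]mulrC => ct.
have := le_trans jc ct; rewrite mulrDr mulr1 in small.
rewrite -mulrA; lra.
Qed.

Theorem goursat_rectangle P Q F G (x0 y0 w h : R) : 0 <= w -> 0 <= h ->
  (forall x y, x0 <= x <= x0 + w -> y0 <= y <= y0 + h ->
    exists px py qy, diff2 P x y px py /\ diff2 Q x y py qy) ->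
  (forall x y, x0 <= x <= x0 + w -> y0 <= y <= y0 + h ->
     is_derive x 1 (F^~ y) (P x y)) ->
  (forall x y, x0 <= x <= x0 + w -> y0 <= y <= y0 + h ->
     is_derive y 1 (G x) (Q x y)) ->
  circulation F G x0 y0 w h = 0.
Proof.
move=> w0 h0 dPQ dF dG; apply/eqP/negPn/negP => J0.
pose wn n := w / 2 ^+ n; pose hn n := h / 2 ^+ n.
have two n : (0 : R) < 2 ^+ n by rewrite exprn_gt0.
have wn0 n : 0 <= wn n by apply: divr_ge0 => //; apply: exprn_ge0.
have hn0 n : 0 <= hn n by apply: divr_ge0 => //; apply: exprn_ge0.
have wnS n : wn n.+1 = wn n / 2 by rewrite /wn exprS; field; rewrite gt_eqF.
have hnS n : hn n.+1 = hn n / 2 by rewrite /hn exprS; field; rewrite gt_eqF.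
pose J n (p : R * R) := circulation F G p.1 p.2 (wn n) (hn n).
have step n p : exists q, p.1 <= q.1 <= p.1 + wn n.+1 /\
    p.2 <= q.2 <= p.2 + hn n.+1 /\ `|J n p| <= 4 * `|J n.+1 q|.
  case: p => x y; rewrite /J /= circulation_split -wnS -hnS.
  have := wn0 n.+1; have := hn0 n.+1.
  set a := circulation _ _ x y _ _; set b := circulation _ _ _ y _ _.
  set c := circulation _ _ x _ _ _; set d := circulation _ _ _ _ _ _.
  move=> hp wp.
  case: (leP `|a + b + c + d| (4 * `|a|)) => [ha|ha].
    by exists (x, y); rewrite /= -/a; split; [lra|split=> //; lra].
  case: (leP `|a + b + c + d| (4 * `|b|)) => [hb|hb].
    by exists (x + wn n.+1, y); rewrite /= -/b; split; [lra|split=> //; lra].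
  case: (leP `|a + b + c + d| (4 * `|c|)) => [hc|hc].
    by exists (x, y + hn n.+1); rewrite /= -/c; split; [lra|split=> //; lra].
  exists (x + wn n.+1, y + hn n.+1); rewrite /= -/d.
  split; [lra|split; [lra|]].
  have := ler_normD (a + b + c) d; have := ler_normD (a + b) c.
  have := ler_normD a b; lra.
have {step} [s sP] := choice (fun np : nat * (R * R) => step np.1 np.2).
pose z := fix z n := if n is m.+1 then s (m, z m) else (x0, y0).
have zS n := sP (n, z n).
have [a aP] : exists a, forall n, (z n).1 <= a <= (z n).1 + wn n.
  apply: nested_point => // n; have /= := zS n; rewrite -/(wn n.+1) -/(wn n) wnS; lra.
have [b bP] : exists b, forall n, (z n).2 <= b <= (z n).2 + hn n.
  apply: nested_point => // n; have /= := zS n; rewrite -/(hn n.+1) -/(hn n) hnS; lra.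
have inR n : x0 <= (z n).1 /\ (z n).1 + wn n <= x0 + w /\
             y0 <= (z n).2 /\ (z n).2 + hn n <= y0 + h.
  elim: n => [|n IH]; first by rewrite /= /wn /hn expr0 !divr1; lra.
  by have := zS n; rewrite /= wnS hnS; lra.
have Jn n : `|J 0%N (z 0%N)| <= 4 ^+ n * `|J n (z n)|.
  elim: n => [|n IH]; first by rewrite expr0 mul1r.
  apply: (le_trans IH); rewrite exprSr -mulrA ler_pM2l ?exprn_gt0//.
  by have [_ [_]] := zS n.
have [px [py [qy [dP dQ]]]] : exists px py qy, diff2 P a b px py /\ diff2 Q a b py qy.
  apply: dPQ.
    by have := aP 0%N; rewrite /= /wn expr0 divr1.
  by have := bP 0%N; rewrite /= /hn expr0 divr1.
pose j := `|circulation F G x0 y0 w h|.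
have j0 : 0 < j by rewrite normr_gt0.
have wh : 0 < (w + h) ^+ 2 + 1 by apply: ltr_wpDl => //; rewrite sqr_ge0.
pose e := j / 4 / ((w + h) ^+ 2 + 1).
have e0 : 0 < e by rewrite !divr_gt0.
have [d1 d10 {}dP] := dP e e0; have [d2 d20 {}dQ] := dQ e e0.
pose d := Num.min d1 d2.
have d0 : 0 < d by rewrite lt_min d10.
have dd1 : d <= d1 by rewrite ge_min lexx.
have dd2 : d <= d2 by rewrite ge_min lexx orbT.
have [n nP] : exists n, w + h <= d * 2 ^+ n.
  have wd0 : 0 <= (w + h) / d by rewrite divr_ge0 ?addr_ge0// ltW.
  have := archi_boundP wd0; set n := Num.bound _.
  rewrite ltr_pdivrMr// mulrC => nP; exists n; apply: (le_trans (ltW nP)).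
  rewrite ler_pM2l// -natrX ler_nat; apply: ltnW; exact: ltn_expl.
have wd : wn n <= d.
  rewrite /wn ler_pdivrMr//; apply: le_trans nP; lra.
have hd : hn n <= d.
  rewrite /hn ler_pdivrMr//; apply: le_trans nP; lra.
have := inR n => inRn.
have : `|circulation F G (z n).1 (z n).2 (wn n) (hn n)| <= 2 * e * (wn n + hn n) ^+ 2.
  apply: (@circulation_local P Q F G a b px py qy e d) => //.
  - exact: ltW.
  - by move=> x' y' h1 h2; apply: dP; [apply: le_trans h1 _|apply: le_trans h2 _].
  - by move=> x' y' h1 h2; apply: dQ; [apply: le_trans h1 _|apply: le_trans h2 _].
  - by move=> x' y' h1 h2; apply: dF; clear -inRn h1 h2; lra.
  - by move=> x' y' h1 h2; apply: dG; clear -inRn h1 h2; lra.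
have four : (4 : R) ^+ n = 2 ^+ n * 2 ^+ n by rewrite -expr2 -exprM mulnC exprM expr2 -natrM.
have small : e * ((w + h) ^+ 2 + 1) = j / 4 by rewrite /e divfK ?gt_eqF.
have := Jn n; rewrite four /J /= /wn /hn expr0 !divr1.
by move=> /goursat_arith/[apply]; apply; rewrite ?small.
Qed.

End Goursat.

(** * Complex norms *)

Section Differentiability.
Variables (K : numFieldType) (V W : normedModType K).

Lemma differentiable_le (f : V -> W) x : differentiable f x ->
  forall e, 0 < e -> \forall h \near 0, `|f (h + x) - f x - 'd f x h| <= e * `|h|.
Proof.
move=> df e e0; have /eqaddoP /(_ _ e0) := diff_locally df.
by apply: filterS => h; rewrite !fctE opprD addrA.
Qed.

Lemma le_differentiable (f : V -> W) (df : {linear V -> W}) x : continuous df ->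
  (forall e, 0 < e -> \forall h \near 0, `|f (h + x) - f x - df h| <= e * `|h|) ->
  differentiable f x /\ ('d f x : V -> W) = df.
Proof.
move=> dfc H.
have E : f \o shift x = cst (f x) + df +o_ 0 id.
  apply/eqaddoP => e e0; have := H _ e0; apply: filterS => h /=.
  by rewrite !fctE /= opprD addrA.
have d := diff_unique dfc E.
by split=> //; apply/diff_locallyP; rewrite d.
Qed.

End Differentiability.

Lemma derive_le (R : realType) (f : R -> R) (x d : R) : is_derive x 1 f d ->
  forall e, 0 < e -> exists2 c : R, 0 < c & forall h, `|h| <= c ->
    `|f (x + h) - f x - d * h| <= e * `|h|.
Proof.
move=> [dfx dfv] e e0.
have /derivable1_diffP dff := dfx.
have := differentiable_le dff e0.
move=> /nbhs_ballP[c /= c0 cP]; exists (c / 2); first by rewrite divr_gt0.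
move=> h hc; have := cP h; rewrite /= -ball_normE /= sub0r normrN => /(_ ltac:(lra)).
by rewrite deriv1E// derive1E dfv /= /GRing.scale /= (addrC h) (mulrC h).
Qed.

Definition nm (R : realType) (V : normedZmodType (Cplx R)) (v : V) : R :=
  complex.Re `|v|.

Section Norm.
Variable R : realType.
Local Notation C := (Cplx R).
Local Notation re := (@complex.Re R).
Local Notation im := (@complex.Im R).
Local Notation "x %:C" := (real_complex R x : C) (format "x %:C") : ring_scope.

Lemma nmE (V : normedZmodType C) (v : V) : `|v| = (nm v)%:C.
Proof. by rewrite /nm [RHS](@RRe_real R)// ger0_real. Qed.

Lemma lecC (x y : R) : (x%:C <= y%:C) = (x <= y).
Proof. exact: (@lecR R). Qed.

Lemma ltcC (x y : R) : (x%:C < y%:C) = (x < y).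
Proof. exact: (@ltcR R). Qed.

Lemma nm_ge0 (V : normedZmodType C) (v : V) : 0 <= nm v.
Proof. by rewrite -lecC -nmE normr_ge0. Qed.

Lemma nmD (V : normedZmodType C) (v w : V) : nm (v + w) <= nm v + nm w.
Proof. by rewrite -lecC rmorphD /= -!nmE ler_normD. Qed.

Lemma nmN (V : normedZmodType C) (v : V) : nm (- v) = nm v.
Proof. by rewrite /nm normrN. Qed.

Lemma nmB (V : normedZmodType C) (v w : V) : nm (v - w) <= nm v + nm w.
Proof. by rewrite -(nmN w) nmD. Qed.

Lemma nm_distC (V : normedZmodType C) (v w : V) : nm (v - w) = nm (w - v).
Proof. by rewrite -nmN opprB. Qed.

Lemma nm_eq0 (V : normedZmodType C) (v : V) : (nm v == 0) = (v == 0).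
Proof. by rewrite -(normr_eq0 v) nmE; apply/eqP/eqP => [->//|/(@complexI R)]. Qed.

Lemma nm0 (V : normedZmodType C) : nm (0 : V) = 0.
Proof. by apply/eqP; rewrite nm_eq0. Qed.

Lemma nm_gt0 (V : normedZmodType C) (v : V) : (0 < nm v) = (v != 0).
Proof. by rewrite lt_def nm_ge0 nm_eq0 andbT. Qed.

Lemma nmZ (V : normedModType C) (a : C) (v : V) : nm (a *: v) = nm a * nm v.
Proof.
by apply: (@complexI R); rewrite rmorphM /= -!nmE normrZ.
Qed.

Lemma nmM (a b : C) : nm (a * b) = nm a * nm b.
Proof. by apply: (@complexI R); rewrite rmorphM /= -!nmE normrM. Qed.

Lemma nmV (a : C) : nm a^-1 = (nm a)^-1.
Proof. by apply: (@complexI R); rewrite fmorphV /= -!nmE normfV. Qed.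

Lemma nmC (x : R) : nm (x%:C) = `|x|.
Proof. by rewrite /nm normc_def /= expr0n /= addr0 sqrtr_sqr. Qed.

Lemma nm1 : nm (1 : C) = 1.
Proof. by rewrite (_ : 1 = 1%:C) // nmC normr1. Qed.

Lemma nm_def (z : C) : nm z = Num.sqrt (re z ^+ 2 + im z ^+ 2).
Proof. by rewrite /nm normc_def. Qed.

Lemma re_le_nm (z : C) : `|re z| <= nm z.
Proof.
by rewrite nm_def -sqrtr_sqr ler_wsqrtr// lerDl sqr_ge0.
Qed.

Lemma im_le_nm (z : C) : `|im z| <= nm z.
Proof.
by rewrite nm_def -sqrtr_sqr ler_wsqrtr// lerDr sqr_ge0.
Qed.

Lemma nm_le_reim (z : C) : nm z <= `|re z| + `|im z|.
Proof.
rewrite nm_def -[leRHS]ger0_norm ?addr_ge0// -sqrtr_sqr ler_wsqrtr//.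
rewrite sqrrD !real_normK ?num_real// lerD2r lerDl.
by rewrite mulrn_wge0// mulr_ge0.
Qed.

Lemma reD (z w : C) : re (z + w) = re z + re w.
Proof. by case: z w => [? ?] [? ?]. Qed.
Lemma imD (z w : C) : im (z + w) = im z + im w.
Proof. by case: z w => [? ?] [? ?]. Qed.
Lemma reN (z : C) : re (- z) = - re z.
Proof. by case: z. Qed.
Lemma imN (z : C) : im (- z) = - im z.
Proof. by case: z. Qed.
Lemma reM (z w : C) : re (z * w) = re z * re w - im z * im w.
Proof. by case: z w => [? ?] [? ?]. Qed.
Lemma imM (z w : C) : im (z * w) = re z * im w + im z * re w.
Proof. by case: z w => [? ?] [? ?]. Qed.

Lemma Cplx_eq (z w : C) : re z = re w -> im z = im w -> z = w.
Proof. by case: z w => [? ?] [? ?] /= -> ->. Qed.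

End Norm.

(** * The mean value property *)

Lemma exists_primitive (R : realType) (a : R) (f : R -> R) : continuous f ->
  exists F : R -> R, forall x, a < x -> is_derive x 1 F (f x).
Proof.
move=> cf; exists (fun x => (\int[lebesgue_measure]_(t in [set` `[a, x]]) f t)%R) => x ax.
have [] := @continuous_FTC1_closed R f a x (x + 1) _ _ ax (cf x).
- by rewrite ltrDl.
- apply: continuous_compact_integrable; first exact: segment_compact.
  by apply: continuous_in_subspaceT => z _; exact: cf.
- by rewrite derive1E => d <-; exact: derivableP.
Qed.

Section MeanValue.
Variable R : realType.
Local Notation C := (Cplx R).
Local Notation re := (@complex.Re R).
Local Notation im := (@complex.Im R).
Implicit Types (f : C -> C) (z w p d : C).

Definition cdiff f z d := forall e : R, 0 < e -> exists2 c : R, 0 < c &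
  forall w, nm (w - z) <= c -> nm (f w - f z - d * (w - z)) <= e * nm (w - z).

Definition ccont f z := forall e : R, 0 < e -> exists2 c : R, 0 < c &
  forall w, nm (w - z) <= c -> nm (f w - f z) <= e.

Lemma cdiff_cont f z d : cdiff f z d -> ccont f z.
Proof.
move=> fd e e0; have [c c0 cP] := fd 1 ltr01.
have K0 : 0 < 1 + nm d by rewrite ltr_pwDl// nm_ge0.
exists (Num.min c (e / (1 + nm d))); first by rewrite lt_min c0 divr_gt0.
move=> w; rewrite le_min => /andP[/cP wc]; rewrite ler_pdivlMr// => we.
rewrite -(subrK (d * (w - z)) (f w - f z)) (le_trans (nmD _ _))//.
rewrite nmM; apply: le_trans we; rewrite [leRHS]mulrDr mulr1 (mulrC (nm d)) lerD2r.
by rewrite mul1r in wc.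
Qed.

Definition cis (x y : R) : C := Complex (expR x * cos y) (expR x * sin y).

Lemma nm_cis x y : nm (cis x y) = expR x.
Proof.
rewrite nm_def /= !exprMn -mulrDr cos2Dsin2 mulr1 sqrtr_sqr gtr0_norm//.
exact: expR_gt0.
Qed.

Lemma cisD x y h k : cis (x + h) (y + k) = cis x y * cis h k.
Proof.
by apply: Cplx_eq; rewrite ?reM ?imM /= expRD ?cosD ?sinD; ring.
Qed.

Lemma cis_local (e : R) : 0 < e -> exists2 c : R, 0 < c & forall h k : R,
  `|h| <= c -> `|k| <= c ->
  nm (cis h k - 1 - Complex h k : C) <= e * (`|h| + `|k|).
Proof.
move=> e0.
pose e1 := Num.min 1 (e / 8).
have e10 : 0 < e1 by rewrite lt_min ltr01 divr_gt0.
have e11 : e1 <= 1 by rewrite ge_min lexx.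
have e1e : e1 <= e / 8 by rewrite ge_min lexx orbT.
clearbody e1.
have [c1 c10 P1] := derive_le (is_derive_expR (0 : R)) e10.
have [c2 c20 P2] := derive_le (is_derive_cos (0 : R)) e10.
have [c3 c30 P3] := derive_le (is_derive_sin (0 : R)) e10.
exists (Num.min e1 (Num.min c1 (Num.min c2 c3))).
  by rewrite !lt_min e10 c10 c20 c30.
move=> h k; rewrite !le_min => /and4P[h1 /P1 hP _ _] /and4P[k1 _ /P2 kP /P3 lP].
move: hP kP lP; rewrite !add0r expR0 cos0 sin0 oppr0 !mul1r mul0r !subr0 ?addr0.
set A := expR h; set B := cos k; set S := sin k => hA kB kS.
apply: (le_trans (nm_le_reim _)); rewrite !reD !imD !reN !imN /= subr0 -/A -/B -/S.
have A3 : `|A| <= 3.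
  have -> : A = 1 + h + (A - 1 - h) by ring.
  apply: (le_trans (ler_normD _ _)); have := ler_normD 1 h; rewrite normr1.
  have : e1 * `|h| <= 1 * 1.
    by apply: ler_pM => //; [exact: ltW|exact: le_trans h1 e11].
  lra.
have t1 : `|A * B - 1 - h| <= e1 * `|h| + 3 * (e1 * `|k|).
  have -> : A * B - 1 - h = (A - 1 - h) + A * (B - 1) by ring.
  apply: (le_trans (ler_normD _ _)); apply: lerD => //.
  by rewrite normrM; apply: ler_pM.
have t2 : `|A * S - k| <= 2 * (e1 * `|k|) + 3 * (e1 * `|k|).
  have -> : A * S - k = (h + (A - 1 - h)) * k + A * (S - k) by ring.
  apply: (le_trans (ler_normD _ _)); apply: lerD => //; last first.
    by rewrite normrM; apply: ler_pM.
  rewrite normrM mulrA ler_wpM2r//.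
  apply: (le_trans (ler_normD _ _)).
  have : e1 * `|h| <= e1 * 1.
    by apply: ler_wpM2l; [exact: ltW|exact: le_trans h1 e11].
  lra.
have : e1 * `|h| <= e / 8 * `|h| by apply: ler_wpM2r.
have : e1 * `|k| <= e / 8 * `|k| by apply: ler_wpM2r.
have : 0 <= e * `|h| by rewrite mulr_ge0// ltW.
have : 0 <= e * `|k| by rewrite mulr_ge0// ltW.
have -> : e / 8 * `|h| = e * `|h| / 8 by ring.
have -> : e / 8 * `|k| = e * `|k| / 8 by ring.
rewrite mulrDr; lra.
Qed.

Lemma cdiff_polar f p x y d : cdiff f (p + cis x y) d ->
  forall e : R, 0 < e -> exists2 c : R, 0 < c & forall x' y',
    `|x' - x| <= c -> `|y' - y| <= c ->
    nm (f (p + cis x' y') - f (p + cis x y)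
        - d * cis x y * Complex (x' - x) (y' - y))
      <= e * (`|x' - x| + `|y' - y|).
Proof.
move=> fd e e0; pose r := expR x.
have r0 : 0 < r by exact: expR_gt0.
have k0 : 0 < 1 + nm d by rewrite ltr_pwDl// nm_ge0.
pose e1 := Num.min 1 (e / (4 * r * (1 + nm d))).
have e10 : 0 < e1 by rewrite lt_min ltr01 divr_gt0// !mulr_gt0.
have e11 : e1 <= 1 by rewrite ge_min lexx.
have e1e : e1 <= e / (4 * r * (1 + nm d)) by rewrite ge_min lexx orbT.
clearbody e1.
have [c1 c10 P1] := cis_local e10.
have e20 : 0 < e / (4 * r) by rewrite divr_gt0// mulr_gt0.
have [c2 c20 P2] := fd _ e20.
exists (Num.min c1 (c2 / (4 * r))).
  by rewrite lt_min c10 divr_gt0// mulr_gt0.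
move=> x' y'; rewrite !le_min => /andP[h1 h2] /andP[k1 k2].
move: h1 h2 k1 k2; set h := x' - x; set k := y' - y => h1 h2 k1 k2.
have Ex : cis x' y' = cis x y * cis h k by rewrite -cisD /h /k !subrKC.
set s := `|h| + `|k|; have s0 : 0 <= s by exact: addr_ge0.
have := P1 h k h1 k1; set u := cis h k - 1 - Complex h k; rewrite -/s => uP.
have wz : (p + cis x' y') - (p + cis x y) = cis x y * (Complex h k + u).
  by rewrite Ex /u; ring.
have nms : nm ((p + cis x' y') - (p + cis x y)) <= 2 * r * s.
  rewrite wz nmM nm_cis -/r (mulrC 2) -mulrA ler_pM2l//.
  apply: (le_trans (nmD _ _)); have := nm_le_reim (Complex h k : C); rewrite -/s.
  have : e1 * s <= 1 * s by apply: ler_wpM2r.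
  lra.
have fP : nm ((p + cis x' y') - (p + cis x y)) <= c2.
  apply: (le_trans nms).
  have : s <= c2 / (4 * r) + c2 / (4 * r) by apply: lerD.
  move=> /(ler_wpM2l (ltW (mulr_gt0 (ltr0n R 2) r0)))/le_trans; apply.
  by rewrite le_eqVlt; apply/orP; left; apply/eqP; field; rewrite gt_eqF.
move: fP => /P2; rewrite wz => fP.
have -> : f (p + cis x' y') - f (p + cis x y) - d * cis x y * Complex h k =
  (f (p + cis x' y') - f (p + cis x y) - d * (cis x y * (Complex h k + u)))
  + d * cis x y * u by ring.
apply: (le_trans (nmD _ _)).
have A1 : nm (f (p + cis x' y') - f (p + cis x y)
   - d * (cis x y * (Complex h k + u))) <= e / 2 * s.
  apply: (le_trans fP); rewrite -wz.
  apply: (le_trans (ler_wpM2l (ltW e20) nms)).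
  rewrite le_eqVlt; apply/orP; left; apply/eqP; field; rewrite gt_eqF//.
have A2 : nm (d * cis x y * u) <= e / 2 * s.
  rewrite !nmM nm_cis -/r.
  apply: (le_trans (ler_wpM2l _ uP)); first by rewrite mulr_ge0 ?nm_ge0// ltW.
  rewrite mulrA; apply: ler_wpM2r => //.
  have : nm d * r * e1 <= (1 + nm d) * r * (e / (4 * r * (1 + nm d))).
    apply: ler_pM => //; rewrite ?mulr_ge0 ?nm_ge0// ?(ltW r0) ?(ltW e10)//.
    by rewrite ler_pM2r// lerDr.
  have -> : (1 + nm d) * r * (e / (4 * r * (1 + nm d))) = e / 4.
    by field; rewrite !gt_eqF.
  lra.
lra.
Qed.

Lemma eps_continuous (g : R -> R) (x : R) :
  (forall e : R, 0 < e -> exists2 c : R, 0 < c &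
     forall x', `|x' - x| <= c -> `|g x' - g x| <= e) -> {for x, continuous g}.
Proof.
move=> H; apply/cvgrPdist_le => e e0; have [c c0 cP] := H e e0.
apply/nbhs_ballP; exists c => // x'; rewrite /ball_ /= distrC => xc.
by rewrite distrC cP// ltW.
Qed.

Lemma ccont_polar f p x y d : cdiff f (p + cis x y) d ->
  forall e : R, 0 < e -> exists2 c : R, 0 < c & forall x' y',
    `|x' - x| <= c -> `|y' - y| <= c ->
    nm (f (p + cis x' y') - f (p + cis x y)) <= e.
Proof.
move=> fd e e0; have [c c0 cP] := cdiff_polar fd ltr01.
pose D := d * cis x y.
have k0 : 0 < 2 * (1 + nm D) by rewrite mulr_gt0// ltr_pwDl// nm_ge0.
exists (Num.min c (e / (2 * (1 + nm D)))); first by rewrite lt_min c0 divr_gt0.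
move=> x' y'; rewrite !le_min => /andP[h1 h2] /andP[k1 k2].
have := cP _ _ h1 k1; rewrite -/D; set s := `|_| + `|_| => t1.
have s2 : (1 + nm D) * s <= e.
  have : s <= e / (2 * (1 + nm D)) + e / (2 * (1 + nm D)) by apply: lerD.
  by rewrite -mulrDl ler_pdivlMr// => ?; lra.
rewrite -(subrK (D * Complex (x' - x) (y' - y)) (f _ - f _)).
apply: (le_trans (nmD _ _)); apply: le_trans s2; rewrite [leRHS]mulrDl.
by apply: lerD => //; rewrite nmM ler_wpM2l ?nm_ge0// (nm_le_reim (Complex _ _)).
Qed.

Lemma diff2_polar f p x y d : cdiff f (p + cis x y) d ->
  exists px py qy, diff2 (fun x y => im (f (p + cis x y))) x y px py /\
                   diff2 (fun x y => re (f (p + cis x y))) x y py qy.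
Proof.
move=> fd; pose D := d * cis x y.
exists (im D), (re D), (- im D); split=> e e0;
  have [c c0 cP] := cdiff_polar fd e0; exists c => // x' y' h k.
  apply: le_trans (cP _ _ h k); apply: le_trans (im_le_nm _).
  by rewrite -/D !imD !imN imM /= opprD addrA (addrAC _ (- (re D * _))).
apply: le_trans (cP _ _ h k); apply: le_trans (re_le_nm _).
by rewrite -/D !reD !reN reM /= opprD addrA mulNr.
Qed.

Lemma mean_value f p (r rho : R) : 0 < rho < r ->
  (forall z, 0 < nm (z - p) <= r -> exists d, cdiff f z d) -> ccont f p ->
  exists2 U : R -> R,
    forall y, 0 <= y <= pi *+ 2 -> is_derive y 1 U (re (f (p + cis (ln rho) y)))
    & U (pi *+ 2) - U 0 = pi *+ 2 * re (f p).
Proof.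
move=> /andP[rho0 rr] fd fc.
have r0 : 0 < r by exact: lt_trans rr.
pose X := ln rho; pose X' := ln r.
have XX' : X < X' by rewrite ltr_ln.
have pi0 : 0 < pi *+ 2 :> R by rewrite mulrn_wgt0// pi_gt0.
have Fd x y : x <= X' -> exists d, cdiff f (p + cis x y) d.
  move=> xX; apply: fd; rewrite addrC addKr nm_cis expR_gt0/=.
  by rewrite -(lnK r0) ler_expR.
have contQ x : x <= X' -> continuous (fun y => re (f (p + cis x y))).
  move=> xX y; apply: eps_continuous => e e0; have [d dP] := Fd x y xX.
  have [c c0 cP] := ccont_polar dP e0; exists c => // y' yc.
  rewrite -reN -reD; apply: (le_trans (re_le_nm _)); apply: cP => //.
  by rewrite subrr normr0 ltW.
have contP y : continuous (fun x => im (f (p + cis (Num.min x X') y))).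
  move=> x; apply: eps_continuous => e e0.
  have [|d dP] := Fd (Num.min x X') y; first by rewrite ge_min lexx orbT.
  have [c c0 cP] := ccont_polar dP e0; exists c => // x' xc.
  rewrite -imN -imD; apply: (le_trans (im_le_nm _)); apply: cP => //.
    apply: le_trans xc.
    have := ler_norm (x' - x); have := ler_norm (x - x').
    rewrite (distrC x) ler_norml; move: `|x' - x| => t t1 t2.
    by case: (leP x' X'); case: (leP x X') => a1 a2; apply/andP; split; lra.
  by rewrite subrr normr0 ltW.
have prim (a : R) : exists pr : (R -> R) -> R -> R, forall g, continuous g ->
    forall x, a < x -> is_derive x 1 (pr g) (g x).
  have H (g : R -> R) : exists F : R -> R, continuous g ->
      forall x, a < x -> is_derive x 1 F (g x).
    have [cg|ncg] := pselect (continuous g); last by exists g.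
    by have [F FP] := exists_primitive a cg; exists F.
  by have [pr prP] := choice H; exists pr.
have [G0 G0P] := prim (-1).
pose G x := G0 (fun y => re (f (p + cis x y))).
have GP (x y : R) : x <= X' -> 0 <= y -> is_derive y 1 (G x) (re (f (p + cis x y))).
  by move=> xX y0; apply: (G0P _ (contQ _ xX)); apply: lt_le_trans y0; rewrite ltrN10.
exists (G X); first by move=> y /andP[y0 _]; apply: GP => //; exact: ltW.
have same x1 : x1 <= X -> G X (pi *+ 2) - G X 0 = G x1 (pi *+ 2) - G x1 0.
  move=> x1X; have [F0 F0P] := prim (x1 - 1).
  pose F x y := F0 (fun x => im (f (p + cis (Num.min x X') y))) x.
  have FP (x y : R) : x1 <= x -> x <= X' -> is_derive x 1 (F^~ y) (im (f (p + cis x y))).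
    move=> xx xX; have := F0P _ (contP y) x.
    by rewrite (min_idPl xX); apply; rewrite (lt_le_trans _ xx)// gtrBl.
  have : circulation F G x1 0 (X - x1) (pi *+ 2) = 0.
    apply: (@goursat_rectangle _ (fun x y => im (f (p + cis x y)))
                                 (fun x y => re (f (p + cis x y)))).
    - by rewrite subr_ge0.
    - exact: ltW.
    - move=> x y /andP[_]; rewrite subrKC => xX _.
      have [|d dP] := Fd x y; first exact: le_trans (ltW XX').
      exact: diff2_polar dP.
    - move=> x y /andP[xx]; rewrite subrKC => xX _; apply: FP => //.
      exact: le_trans (ltW XX').
    - move=> x y /andP[xx]; rewrite subrKC => xX /andP[y0 _]; apply: GP => //.
      exact: le_trans (ltW XX').
  rewrite /circulation subrKC add0r.
  have Fs x : F x (pi *+ 2) = F x 0.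
    rewrite /F; congr (F0 _ _); apply/funext => x'.
    by rewrite /cis cos2pi sin2pi cos0 sin0.
  rewrite !Fs.
  lra.
apply/eqP; rewrite -subr_eq0 -normr_le0; apply/ler_addgt0Pl => e e0; rewrite addr0.
have e1 : 0 < e / (pi *+ 2) by exact: divr_gt0.
have [c c0 cP] := fc _ e1.
pose x1 := Num.min X (ln c).
have x1X : x1 <= X by rewrite ge_min lexx.
rewrite (same _ x1X).
pose phi := fun y => G x1 y - y * re (f p).
have -> : G x1 (pi *+ 2) - G x1 0 - pi *+ 2 * re (f p) = phi (pi *+ 2) - phi 0.
  rewrite /phi; ring.
have -> : e = e / (pi *+ 2) * (pi *+ 2 - 0) by rewrite subr0 divfK ?gt_eqF.
apply: (@increment_le _ _ (fun y => re (f (p + cis x1 y)) - re (f p))).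
- exact: ltW.
- move=> y /andP[y0 _].
  have x1X' : x1 <= X' by apply: le_trans (ltW XX').
  have dG := GP _ _ x1X' y0.
  rewrite /phi; apply: is_derive_eq.
  by rewrite /GRing.scale /=; ring.
- move=> y _; rewrite -reN -reD; apply: (le_trans (re_le_nm _)); apply: cP.
  by rewrite addrC addKr nm_cis -(lnK c0) ler_expR ge_min lexx orbT.
Qed.

End MeanValue.

(** * The maximum principle *)

Section MaximumPrinciple.
Variable R : realType.
Local Notation C := (Cplx R).
Local Notation re := (@complex.Re R).
Local Notation im := (@complex.Im R).
Local Notation "x %:C" := (real_complex R x : C) (format "x %:C") : ring_scope.
Implicit Types (f g : C -> C) (z w p d : C).

Definition square (rho : R) z := `|re z| <= rho /\ `|im z| <= rho.

Definition inner_square (rho : R) z := `|re z| < rho /\ `|im z| < rho.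

Lemma nm_sqr z : nm z ^+ 2 = re z ^+ 2 + im z ^+ 2.
Proof. by rewrite nm_def sqr_sqrtr// addr_ge0// sqr_ge0. Qed.

Lemma increment_le0 (f df : R -> R) (a b : R) : a <= b ->
  (forall x, a <= x <= b -> is_derive x 1 f (df x)) ->
  (forall x, a <= x <= b -> df x <= 0) -> f b <= f a.
Proof.
move=> ab fdf df0.
have [c cab E] : exists2 c, c \in `[a, b]%R & f b - f a = df c * (b - a).
  apply: MVT_segment => // [x|].
    by rewrite in_itv /= => /andP[ax xb]; apply: fdf; rewrite !ltW.
  apply: continuous_in_subspaceT => x; rewrite inE /= in_itv /= => xab.
  have := fdf x xab => -[+ _]; move=> /derivable1_diffP.
  exact: differentiable_continuous.
rewrite -subr_le0 E mulr_le0_ge0 ?subr_ge0//.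
by apply: df0; rewrite in_itv in cab.
Qed.

Lemma square_max (g : C -> R) (rho : R) : 0 <= rho ->
  (forall z, square rho z -> forall e : R, 0 < e -> exists2 c : R, 0 < c &
    forall w, nm (w - z) <= c -> `|g w - g z| <= e) ->
  exists2 p, square rho p & forall z, square rho z -> g z <= g p.
Proof.
move=> r0 gc.
pose A := (`[- rho, rho]%classic `*` `[- rho, rho]%classic : set (R * R)).
have AE x y : A (x, y) <-> square rho (Complex x y).
  by rewrite /A /square /= !in_itv /= -!ler_norml; split=> -[].
have := @compact_EVT_max _ R (fun q : R * R => g (Complex q.1 q.2)) A.
move=> /(_ _ _ _)[].
- by exists (0, 0); apply/AE; rewrite /square /= normr0.
- by apply: compact_setX; exact: segment_compact.
- apply: continuous_in_subspaceT => -[x y]; rewrite inE => /AE xy.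
  apply/cvgrPdist_le => e e0; have [c c0 cP] := gc _ xy e e0.
  apply/(@nbhs_ballP R (R * R)%type); exists (c / 2); first by rewrite /= divr_gt0.
  move=> [x' y'] [] /=; rewrite /ball_ /= => h k; rewrite distrC; apply: cP.
  apply: (le_trans (nm_le_reim _)); rewrite reD imD reN imN /=.
  have h' : `|x - x'| < c / 2 := h; have k' : `|y - y'| < c / 2 := k.
  rewrite (distrC x') (distrC y'); lra.
move=> [x y]; rewrite inE => /AE xy H; exists (Complex x y) => // z zQ.
have := H (re z, im z); rewrite inE; case: z zQ => a b zQ; apply.
exact/AE.
Qed.

Lemma exists_punctured (rho : R) (S : seq C) p : inner_square rho p ->
  exists2 r : R, 0 < r &
    forall z, 0 < nm (z - p) <= r -> inner_square rho z /\ z \notin S.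
Proof.
move=> [h k].
have [r1 r10 r1P] : exists2 r : R, 0 < r &
    forall z, 0 < nm (z - p) <= r -> z \notin S.
  elim: S => [|s S [r r0 IH]]; first by exists 1.
  have [sp|sp] := eqVneq s p.
    exists r => // z zr; rewrite inE negb_or IH// andbT sp -subr_eq0 -nm_eq0.
    by case/andP: zr => /gt_eqF ->.
  have n0 : 0 < nm (s - p) by rewrite nm_gt0 subr_eq0.
  exists (Num.min r (nm (s - p) / 2)); first by rewrite lt_min r0 divr_gt0.
  move=> z; rewrite le_min => /and3P[z0 zr zs].
  rewrite inE negb_or IH ?z0// andbT; apply: contraTneq zs => ->.
  rewrite -ltNge; lra.
pose r := Num.min r1 (Num.min ((rho - `|re p|) / 2) ((rho - `|im p|) / 2)).
exists r; first by rewrite !lt_min r10 !divr_gt0// subr_gt0.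
move=> z; rewrite !le_min => /and4P[z0 zr zx zy]; split; last first.
  by apply: r1P; rewrite z0.
have zE : z = p + (z - p) by rewrite subrKC.
rewrite zE; set w := z - p in zx zy *.
have := re_le_nm w; have := im_le_nm w; rewrite /inner_square reD imD.
have := ler_normD (re p) (re w); have := ler_normD (im p) (im w); lra.
Qed.

Lemma re_maximum_principle f (rho M : R) (S : seq C) : 0 < rho ->
  (forall z, square rho z -> ccont f z) ->
  (forall z, inner_square rho z -> z \notin S -> exists d, cdiff f z d) ->
  (forall z, square rho z -> ~ inner_square rho z -> re (f z) <= M) ->
  forall z, square rho z -> re (f z) <= M.
Proof.
move=> rho0 fc fd fM z0 z0Q.
have sqr_le z : square rho z -> nm z ^+ 2 <= 2 * rho ^+ 2.
  move=> [h k]; rewrite nm_sqr -(real_normK (num_real (re z))).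
  rewrite -(real_normK (num_real (im z))).
  have : `|re z| ^+ 2 <= rho ^+ 2 by rewrite lerXn2r ?nnegrE// ltW.
  have : `|im z| ^+ 2 <= rho ^+ 2 by rewrite lerXn2r ?nnegrE// ltW.
  lra.
apply/ler_addgt0Pr => e' e'0.
pose e := e' / (2 * rho ^+ 2).
have e0 : 0 < e by rewrite divr_gt0// mulr_gt0// exprn_gt0.
have ee : e * (2 * rho ^+ 2) = e' by rewrite divfK// gt_eqF// mulr_gt0// exprn_gt0.
pose g z := re (f z) + e * nm z ^+ 2.
have [p pQ pmax] : exists2 p, square rho p & forall z, square rho z -> g z <= g p.
  apply: square_max => [|z zQ d d0]; first exact: ltW.
  have d20 : 0 < d / 2 by rewrite divr_gt0.
  have [c c0 cP] := fc _ zQ _ d20.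
  have K0 : 0 < e * (1 + 2 * nm z) by rewrite mulr_gt0// ltr_pwDl// mulr_ge0// nm_ge0.
  exists (Num.min c (Num.min 1 (d / 2 / (e * (1 + 2 * nm z))))).
    by rewrite !lt_min c0 ltr01 divr_gt0.
  move=> w; rewrite !le_min => /and3P[/cP wc w1]; rewrite ler_pdivlMr// => wd.
  have -> : g w - g z = re (f w - f z) + e * ((nm w - nm z) * (nm w + nm z)).
    by rewrite /g reD reN; ring.
  apply: (le_trans (ler_normD _ _)).
  have := re_le_nm (f w - f z); rewrite normrM (gtr0_norm e0) normrM.
  have nwz : `|nm w - nm z| <= nm (w - z).
    rewrite ler_norml; have := nmD (w - z) z; have := nmD (z - w) w.
    by rewrite !subrK (nm_distC z); lra.
  have nwz2 : `|nm w + nm z| <= 1 + 2 * nm z.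
    rewrite ger0_norm ?addr_ge0 ?nm_ge0//; have := nmD (w - z) z; rewrite subrK; lra.
  have : e * (`|nm w - nm z| * `|nm w + nm z|) <= d / 2.
    by apply: le_trans wd; rewrite [leRHS]mulrCA ler_pM2l// ler_pM.
  lra.
have gz0 : re (f z0) <= g p.
  by apply: le_trans (pmax _ z0Q); rewrite lerDl mulr_ge0 ?sqr_ge0// ltW.
apply: (le_trans gz0).
have [pin|pout] := pselect (inner_square rho p); last first.
  have := fM _ pQ pout; have := sqr_le _ pQ => /(ler_wpM2l (ltW e0)).
  rewrite ee /g; lra.
exfalso.
have [r r0 rP] := exists_punctured S pin.
have [||U dU UE] := @mean_value R f p r (r / 2) _ _ (fc _ pQ).
- by rewrite divr_gt0//=; lra.
- by move=> z /rP[]; exact: fd.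
have pi0 : 0 < pi *+ 2 :> R by rewrite mulrn_wgt0// pi_gt0.
pose q := r / 2; have q0 : 0 < q by rewrite divr_gt0.
pose phi := fun y : R => U y - (re (f p) * y
  - e * (2 * q * (re p * sin y - im p * cos y) + q ^+ 2 * y)).
have : phi (pi *+ 2) <= phi 0.
  apply: (@increment_le0 _ (fun y => re (f (p + cis (ln q) y)) - (re (f p)
  - e * (2 * q * (re p * cos y + im p * sin y) + q ^+ 2)))) => [|y yI|y yI].
  - exact: ltW.
  - have dUy := dU _ yI; rewrite /phi; apply: is_derive_eq.
    rewrite -/q /GRing.scale /=; ring.
  - set w := cis (ln q) y.
    have nw : nm w = q by rewrite nm_cis lnK.
    have wQ : square rho (p + w).
      have [|[h k] _] := rP (p + w); last by split; exact: ltW.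
      by rewrite addrC addKr nw q0 /q; lra.
    have := pmax _ wQ; rewrite /g !nm_sqr !reD !imD.
    have E0 := nm_sqr w; rewrite nw in E0; move: E0.
    have -> : re w = q * cos y by rewrite /w /= lnK.
    have -> : im w = q * sin y by rewrite /w /= lnK.
    move=> E; rewrite -subr_ge0; set A := re (f (p + w)).
    have -> : re (f p) + e * (re p ^+ 2 + im p ^+ 2) -
      (A + e * ((re p + q * cos y) ^+ 2 + (im p + q * sin y) ^+ 2)) =
      re (f p) - A - e * (2 * q * (re p * cos y + im p * sin y) +
         ((q * cos y) ^+ 2 + (q * sin y) ^+ 2)) by ring.
    rewrite -E; lra.
rewrite /phi sin2pi cos2pi sin0 cos0 => H.
have : 0 < e * (q ^+ 2 * (pi *+ 2)) by apply: mulr_gt0 => //; apply: mulr_gt0 => //; rewrite exprn_gt0.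
move: H UE; rewrite !mulr0 !mulr1 !sub0r !addr0.
set P := pi *+ 2; nra.
Qed.

Lemma cdiffM c f z d : cdiff f z d -> cdiff (fun w => c * f w) z (c * d).
Proof.
move=> fd e e0; have k0 : 0 < 1 + nm c by rewrite ltr_pwDl// nm_ge0.
have [|r r0 rP] := fd (e / (1 + nm c)); first by rewrite divr_gt0.
exists r => // w /rP H.
have -> : c * f w - c * f z - c * d * (w - z) = c * (f w - f z - d * (w - z)) by ring.
rewrite nmM; apply: (le_trans (ler_wpM2l (nm_ge0 _) H)).
rewrite mulrA ler_wpM2r ?nm_ge0// mulrA ler_pdivrMr// mulrC ler_pM2l//.
by rewrite lerDr.
Qed.

Lemma ccontM c f z : ccont f z -> ccont (fun w => c * f w) z.
Proof.
move=> fd e e0; have k0 : 0 < 1 + nm c by rewrite ltr_pwDl// nm_ge0.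
have [|r r0 rP] := fd (e / (1 + nm c)); first by rewrite divr_gt0.
exists r => // w /rP H.
rewrite -mulrBr nmM; apply: (le_trans (ler_wpM2l (nm_ge0 _) H)).
rewrite mulrA ler_pdivrMr// mulrC ler_pM2l//.
by rewrite lerDr.
Qed.

Theorem maximum_principle f (rho M : R) (S : seq C) : 0 < rho ->
  (forall z, square rho z -> ccont f z) ->
  (forall z, inner_square rho z -> z \notin S -> exists d, cdiff f z d) ->
  (forall z, square rho z -> ~ inner_square rho z -> nm (f z) <= M) ->
  forall z, square rho z -> nm (f z) <= M.
Proof.
move=> rho0 fc fd fM z zQ.
have [f0|f0] := eqVneq (f z) 0.
  have rQ : square rho rho%:C.
    by rewrite /square /= normr0 ger0_norm ?lexx ltW.
  rewrite f0 nm0; apply: le_trans (fM _ rQ _); rewrite ?nm_ge0//.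
  by move=> []; rewrite /= ger0_norm ?ltxx// ltW.
have n0 : 0 < nm (f z) by rewrite nm_gt0.
pose c : C := Complex (re (f z)) (- im (f z)) / (nm (f z))%:C.
have nc : nm c = 1.
  rewrite /c nmM nmV nmC gtr0_norm// {1}nm_def /= sqrrN -nm_def divff//.
  by rewrite gt_eqF.
have cf : c * f z = (nm (f z))%:C.
  have -> : c * f z = (Complex (re (f z)) (- im (f z)) * f z) / (nm (f z))%:C.
    by rewrite /c mulrAC.
  have -> : Complex (re (f z)) (- im (f z)) * f z = (nm (f z) ^+ 2)%:C.
    by apply: Cplx_eq; rewrite ?reM ?imM nm_sqr /=; ring.
  by rewrite expr2 rmorphM /= mulfK//; apply/eqP => /(@complexI R) /eqP; rewrite gt_eqF.
have := @re_maximum_principle (fun w => c * f w) rho M S rho0.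
move=> /(_ _ _ _ z zQ); rewrite cf; apply.
- by move=> w wQ; apply: ccontM; exact: fc.
- by move=> w wQ wS; have [d dP] := fd _ wQ wS; exists (c * d); exact: cdiffM.
- move=> w wQ wS; apply: le_trans (fM _ wQ wS).
  by rewrite (le_trans (ler_norm _))// (le_trans (re_le_nm _))// nmM nc mul1r.
Qed.

End MaximumPrinciple.

(** * Cauchy estimates *)

Section EpsilonDelta.
Variable R : realType.
Local Notation C := (Cplx R).
Local Notation re := (@complex.Re R).
Local Notation "x %:C" := (real_complex R x : C) (format "x %:C") : ring_scope.
Variables (V W : normedModType C).
Implicit Types (f : V -> W) (x y h : V).

Lemma gt0C (e : C) : 0 < e -> exists2 r : R, 0 < r & e = r%:C.
Proof.
rewrite ltcE /= => /andP[/eqP i0 r0]; exists (re e) => //.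
by case: e i0 r0 => a b /= -> _.
Qed.

Lemma nbhs_nm (x : V) (A : set V) : nbhs x A <->
  exists2 c : R, 0 < c & forall y, nm (y - x) <= c -> A y.
Proof.
split=> [/nbhs_ballP[e /= /gt0C[r r0 ->] rA]|[c c0 cA]].
  exists (r / 2); first by rewrite divr_gt0.
  move=> y yx; apply: rA; rewrite -ball_normE /ball_ /= distrC nmE ltcC; lra.
apply/nbhs_ballP; exists c%:C => /=; first by rewrite ltcC.
move=> y; rewrite -ball_normE /ball_ /= distrC nmE ltcC => yx.
by apply: cA; exact: ltW.
Qed.

Lemma continuous_nm f x : {for x, continuous f} <->
  forall e : R, 0 < e -> exists2 c : R, 0 < c &
    forall y, nm (y - x) <= c -> nm (f y - f x) <= e.
Proof.
split=> [/cvgrPdist_le fc e e0|H].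
  have := fc e%:C; rewrite ltcC => /(_ e0) /nbhs_nm[c c0 cP]; exists c => // y /cP.
  by rewrite distrC nmE lecC.
apply/cvgrPdist_le => _ /gt0C[r r0 ->]; have [c c0 cP] := H r r0.
by apply/nbhs_nm; exists c => // y /cP; rewrite distrC nmE lecC.
Qed.

Lemma differentiable_nm f x : differentiable f x ->
  forall e : R, 0 < e -> exists2 c : R, 0 < c & forall h, nm h <= c ->
    nm (f (h + x) - f x - 'd f x h) <= e * nm h.
Proof.
move=> df e e0; have := differentiable_le df (e := e%:C).
rewrite ltcC => /(_ e0) /nbhs_nm[c c0 cP]; exists c => // h.
by have := cP h; rewrite subr0 !nmE -rmorphM lecC.
Qed.

Lemma nm_differentiable f (df : {linear V -> W}) x (K : R) :
  (forall h, nm (df h) <= K * nm h) ->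
  (forall e : R, 0 < e -> exists2 c : R, 0 < c & forall h, nm h <= c ->
    nm (f (h + x) - f x - df h) <= e * nm h) ->
  differentiable f x /\ ('d f x : V -> W) = df.
Proof.
move=> Kdf H; apply: le_differentiable.
  move=> z; apply/cvgrPdist_le => _ /gt0C[r r0 ->].
  have K0 : 0 < 1 + `|K| by rewrite ltr_pwDl.
  apply/nbhs_nm; exists (r / (1 + `|K|)); first by rewrite divr_gt0.
  move=> y; rewrite ler_pdivlMr// => yz; rewrite -linearB nmE lecC.
  apply: (le_trans (Kdf _)); apply: le_trans yz.
  rewrite nm_distC mulrC ler_wpM2l ?nm_ge0// (le_trans (ler_norm _))//.
  by rewrite lerDr.
move=> _ /gt0C[r r0 ->]; have [c c0 cP] := H r r0.
apply/nbhs_nm; exists c => // h; rewrite subr0 => /cP.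
by rewrite !nmE -rmorphM lecC.
Qed.

Lemma diff_bounded f x : differentiable f x ->
  exists2 K : R, 0 <= K & forall h, nm ('d f x h) <= K * nm h.
Proof.
move=> df; have /(_ 0)/continuous_nm : continuous ('d f x) by exact: diff_continuous.
move=> /(_ 1 ltr01)[c c0 cP]; exists c^-1; first by rewrite invr_ge0 ltW.
move=> h; have [->|h0] := eqVneq h 0; first by rewrite linear0 !nm0 mulr0.
have n0 : 0 < nm h by rewrite nm_gt0.
have := cP ((c / nm h)%:C *: h); rewrite subr0 linear0 subr0 linearZ /= !nmZ nmC.
rewrite gtr0_norm ?divr_gt0// divfK ?gt_eqF// lexx => /(_ isT).
rewrite mulrAC ler_pdivrMr// mul1r => H.
by rewrite mulrC ler_pdivlMr// mulrC.
Qed.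

End EpsilonDelta.

Section CauchyEstimates.
Variable R : realType.
Local Notation C := (Cplx R).
Local Notation "x %:C" := (real_complex R x : C) (format "x %:C") : ring_scope.
Implicit Types (f g h : C -> C) (z w p d a : C).

Lemma cdiffP f z d : cdiff f z d <-> is_derive z 1 f d.
Proof.
split=> [fd|[/derivable1_diffP dff dfv]].
  pose L : {linear C -> C} := ( *:%R d : C -> C).
  have LE (w : C) : L w = d * w by [].
  have [||dff dfE] := @nm_differentiable R C C f L z (nm d).
  - by move=> w; rewrite LE nmM.
  - move=> e e0; have [c c0 cP] := fd e e0; exists c => // w wc.
    by have := cP (w + z); rewrite addrK LE; apply.
  - split; first exact/derivable1_diffP.
    by rewrite deriveE// dfE LE mulr1.
move=> e e0; have [c c0 cP] := differentiable_nm dff e0.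
exists c => // w wc; have := cP (w - z); rewrite subrK => /(_ wc).
have -> // : 'd f z (w - z) = d * (w - z).
by rewrite -dfv deriveE// -[w - z in LHS]mulr1 -[X in 'd f z X]/((w - z) *: 1) linearZ mulrC.
Qed.

Lemma ccontP f z : ccont f z <-> {for z, continuous f}.
Proof. exact: iff_sym (continuous_nm f z). Qed.

Definition slope h a d z := if z == a then d else (h z - h a) / (z - a).

Lemma slope_near h a d z : z != a ->
  \forall w \near z, (h w - h a) / (w - a) = slope h a d w.
Proof.
move=> za; apply/nbhs_nm; exists (nm (z - a) / 2).
  by rewrite divr_gt0// nm_gt0 subr_eq0.
move=> w wz; rewrite /slope; case: eqP => // wa; exfalso; move: wz; rewrite wa nm_distC {wa}.
have : 0 < nm (z - a) by rewrite nm_gt0 subr_eq0.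
lra.
Qed.

Lemma slope_cdiff h a d z d' : z != a -> cdiff h z d' ->
  exists d'', cdiff (slope h a d) z d''.
Proof.
move=> za /cdiffP dh.
have za0 : z - a != 0 by rewrite subr_eq0.
have : derivable (fun w => (h w - h a) / (w - a)) z 1.
  by apply: derivableM; [|apply: derivableV].
move=> /(near_eq_derivable _) H; exists ('D_1 (slope h a d) z).
by apply/cdiffP/derivableP; apply: H => //; exact: slope_near.
Qed.

Lemma slope_cont h a d z : z != a -> ccont h z -> ccont (slope h a d) z.
Proof.
move=> za /ccontP ch; apply/ccontP.
have za0 : z - a != 0 by rewrite subr_eq0.
rewrite /prop_for /continuous_at.
have -> : slope h a d z = (h z - h a) / (z - a) by rewrite /slope (negPf za).
have c2 : h w - h a @[w --> z] --> h z - h a.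
  exact: cvgB ch (cvg_cst (h a)).
have c3 : w - a @[w --> z] --> z - a by exact: cvgB cvg_id (cvg_cst a).
have c4 : (w - a)^-1 @[w --> z] --> (z - a)^-1 by exact: cvgV za0 c3.
have H : (h w - h a) / (w - a) @[w --> z] --> (h z - h a) / (z - a).
  exact: cvgM c2 c4.
exact: cvg_trans (near_eq_cvg (slope_near h d za)) H.
Qed.

Lemma slope_cont_pt h a d : cdiff h a d -> ccont (slope h a d) a.
Proof.
move=> hd e e0; have [c c0 cP] := hd e e0; exists c => // w /cP H.
rewrite /slope eqxx; case: eqP => [_|/eqP wa]; first by rewrite subrr nm0 ltW.
have wa0 : w - a != 0 by rewrite subr_eq0.
have -> : (h w - h a) / (w - a) - d = (h w - h a - d * (w - a)) / (w - a).
  by field.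
by rewrite nmM nmV ler_pdivrMr// nm_gt0.
Qed.

Lemma slope_bound h a d (rho B eta : R) (S : seq C) : 0 < rho -> 0 < eta ->
  (forall z, square rho z -> ccont h z) ->
  (forall z, inner_square rho z -> z \notin S -> exists d, cdiff h z d) ->
  cdiff h a d ->
  (forall z, square rho z -> ~ inner_square rho z ->
     nm (h z) <= B /\ eta <= nm (z - a)) -> nm (h a) <= B ->
  forall z, square rho z -> nm (slope h a d z) <= 2 * B / eta.
Proof.
move=> rho0 eta0 hc hd had hB haB.
apply: (@maximum_principle R (slope h a d) rho (2 * B / eta) (a :: S)) => //.
- move=> z zQ; have [->|za] := eqVneq z a; first exact: slope_cont_pt.
  by apply: slope_cont => //; exact: hc.
- move=> z zQ; rewrite inE negb_or => /andP[za zS].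
  have [d' d'P] := hd _ zQ zS; exact: slope_cdiff d'P.
- move=> z zQ zB; have [hz ze] := hB z zQ zB.
  have za : z != a.
    by apply: contraTneq ze => ->; rewrite subrr nm0 -ltNge.
  rewrite /slope (negPf za) nmM nmV.
  have B0 : 0 <= B by apply: le_trans haB; exact: nm_ge0.
  apply: ler_pM; rewrite ?invr_ge0 ?nm_ge0//.
    by apply: (le_trans (nmB _ _)); lra.
  by rewrite lef_pV2 // posrE // (lt_le_trans eta0).
Qed.

Lemma boundary_far (rho : R) z a (q : R) : ~ inner_square rho z ->
  nm a <= q -> rho - q <= nm (z - a).
Proof.
move=> zB aq.
have : rho <= nm z.
  rewrite leNgt; apply/negP => zr; apply: zB; split.
    exact: le_lt_trans (re_le_nm _) zr.
  exact: le_lt_trans (im_le_nm _) zr.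
have := nmD (z - a) a; rewrite subrK; lra.
Qed.

Lemma square_nm (rho : R) z : square rho z -> nm z <= 2 * rho.
Proof. by move=> [h k]; apply: (le_trans (nm_le_reim _)); lra. Qed.

Lemma nm_square (rho : R) z : nm z <= rho -> square rho z.
Proof. by move=> h; split; apply: le_trans h; rewrite ?re_le_nm ?im_le_nm. Qed.

Theorem cauchy_slope g (rho M : R) : 0 < rho ->
  (forall z, nm z <= 2 * rho -> derivable g z 1 /\ nm (g z) <= M) ->
  forall z, nm z <= rho -> nm (slope g 0 ('D_1 g 0) z) <= 2 * M / rho.
Proof.
move=> r0 gd z zr.
have d0 z' : nm z' <= 2 * rho -> cdiff g z' ('D_1 g z').
  by move=> /gd[dg _]; apply/cdiffP; exact: derivableP.
have n0 : nm (0 : C) <= 2 * rho by rewrite nm0 mulr_ge0// ltW.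
apply: (@slope_bound g 0 _ rho M rho [::]) => //.
- by move=> w /square_nm/d0; exact: cdiff_cont.
- by move=> w [h k] _; exists ('D_1 g w); apply/d0/square_nm; split; exact: ltW.
- exact: d0.
- move=> w wQ wB; split; first by have [] := gd _ (square_nm wQ).
  rewrite -[leLHS]subr0; apply: boundary_far => //; by rewrite nm0.
- by have [] := gd _ n0.
- exact: nm_square.
Qed.

Theorem cauchy_taylor g (rho M : R) : 0 < rho ->
  (forall z, nm z <= 2 * rho -> derivable g z 1 /\ nm (g z) <= M) ->
  forall z, nm z <= rho ->
    nm (g z - g 0 - 'D_1 g 0 * z) <= 8 * M / rho ^+ 2 * nm z ^+ 2.
Proof.
move=> r0 gd z zr.
have d0 z' : nm z' <= 2 * rho -> cdiff g z' ('D_1 g z').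
  by move=> /gd[dg _]; apply/cdiffP; exact: derivableP.
have n0 : nm (0 : C) <= 2 * rho by rewrite nm0 mulr_ge0// ltW.
have M0 : 0 <= M by have [_] := gd _ n0; apply: le_trans; exact: nm_ge0.
pose h := slope g 0 ('D_1 g 0).
have hc w : square rho w -> ccont h w.
  move=> /square_nm/d0 wd; have [->|w0] := eqVneq w 0.
    by apply: slope_cont_pt; exact: d0.
  by apply: slope_cont => //; exact: cdiff_cont wd.
have hd w : nm w <= 2 * rho -> w != 0 -> exists d, cdiff h w d.
  by move=> /d0 wd w0; exact: slope_cdiff wd.
have hB w : square rho w -> nm (h w) <= 2 * M / rho.
  apply: (@slope_bound g 0 _ rho M rho [::]) => //.
  - by move=> w' /square_nm/d0; exact: cdiff_cont.
  - by move=> w' [h' k] _; exists ('D_1 g w'); apply/d0/square_nm; split; exact: ltW.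
  - exact: d0.
  - move=> w' wQ wB; split; first by have [] := gd _ (square_nm wQ).
    by rewrite -[leLHS]subr0; apply: boundary_far => //; rewrite nm0.
  - by have [] := gd _ n0.
pose K := 8 * M / rho ^+ 2.
have K0 : 0 <= K by apply: divr_ge0; [exact: mulr_ge0|exact: sqr_ge0].
have lip a w : a != 0 -> nm a <= rho / 2 -> square rho w ->
    nm (h w - h a) <= K * nm (w - a).
  move=> a0 ar wQ; have [d ad] : exists d, cdiff h a d by apply: hd => //; lra.
  have aQ : square rho a by apply: nm_square; lra.
  have := @slope_bound h a d rho (2 * M / rho) (rho / 2) [:: 0] r0 _ hc _ ad _ (hB _ aQ) w wQ.
  rewrite /slope; case: eqP => [->|/eqP wa]; first by rewrite !subrr !nm0 mulr0.
  have wa0 : 0 < nm (w - a) by rewrite nm_gt0 subr_eq0.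
  rewrite nmM nmV ler_pdivrMr// => H; apply: le_trans (H _ _ _) _.
  - by rewrite divr_gt0.
  - move=> w' [h' k]; rewrite inE => w'0; apply: hd => //.
    by apply: square_nm; split; exact: ltW.
  - move=> w' wQ' wB; split; first exact: hB.
    by have := boundary_far wB ar; lra.
  - rewrite ler_pM2r// /K le_eqVlt; apply/orP; left; apply/eqP.
    by field; rewrite gt_eqF.
have [->|z0] := eqVneq z 0; first by rewrite mulr0 !subrr nm0 expr0n /= mulr0.
have hz : nm (h z - 'D_1 g 0) <= K * nm z.
  apply/ler_addgt0Pr => e e0.
  have e20 : 0 < e / 2 by rewrite divr_gt0.
  have := hc 0; rewrite /square /= normr0 => /(_ (conj (ltW r0) (ltW r0)) _ e20)[c c0 cP].
  have K1 : 0 < 1 + K by rewrite ltr_pwDl.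
  pose t := Num.min c (Num.min (rho / 2) (e / 2 / (1 + K))).
  have t0 : 0 < t by rewrite !lt_min c0 !divr_gt0.
  have tc : t <= c by rewrite ge_min lexx.
  have tr : t <= rho / 2 by rewrite !ge_min lexx orbT.
  have tK : t <= e / 2 / (1 + K) by rewrite !ge_min lexx !orbT.
  have nt : nm t%:C = t by rewrite nmC gtr0_norm.
  have h0 : h 0 = 'D_1 g 0 by rewrite /h /slope eqxx.
  have := cP t%:C; rewrite subr0 nt h0 => /(_ tc) t1.
  have := lip t%:C z; rewrite nt -nm_eq0 nt gt_eqF// => /(_ isT tr (nm_square zr)) t2.
  rewrite -(subrK (h t%:C) (h z)) -addrA; apply: (le_trans (nmD _ _)).
  have : K * nm (z - t%:C) <= K * (nm z + t).
    by apply: ler_wpM2l => //; rewrite -[in leRHS]nt; exact: nmB.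
  have : K * t <= e / 2.
    by move: tK; rewrite ler_pdivlMr// mulrDr mulr1 mulrC; lra.
  by rewrite mulrDr; lra.
have -> : g z - g 0 - 'D_1 g 0 * z = (h z - 'D_1 g 0) * z.
  by rewrite /h /slope (negPf z0) mulrBl subr0 divfK.
by rewrite nmM expr2 mulrA ler_wpM2r// nm_ge0.
Qed.

End CauchyEstimates.

(** * Derivatives of holomorphic functions *)

Lemma rate_cvgR (R : realType) (u : nat -> R) (K : R) :
  (forall n m, `|u n - u m| <= K / n.+1%:R + K / m.+1%:R) ->
  exists l, forall n, `|u n - l| <= K / n.+1%:R.
Proof.
move=> H.
have le n m : u n - K / n.+1%:R <= u m + K / m.+1%:R.
  have := H n m; rewrite ler_norml => /andP[_].
  by move: (K / _) (K / _) => a b; lra.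
pose A := range (fun n => u n - K / n.+1%:R).
exists (sup A) => n; rewrite ler_norml.
have : u n - K / n.+1%:R <= sup A.
  apply: ub_le_sup; last by exists n.
  by exists (u 0%N + K / 1%:R) => _ [m _ <-]; exact: le.
have : sup A <= u n + K / n.+1%:R.
  apply: ge_sup; first by exists (u 0%N - K / 1%:R), 0%N.
  by move=> _ [m _ <-]; exact: le.
by move: (K / _) => a h1 h2; apply/andP; split; lra.
Qed.

Lemma le0_rate (R : realType) (a K : R) :
  (forall n, a <= K / n.+1%:R) -> a <= 0.
Proof.
move=> H; rewrite leNgt; apply/negP => a0.
have K0 : 0 < K.
  by have := H 0%N; rewrite divr1 => aK; exact: lt_le_trans aK.
have := archi_boundP (divr_ge0 (ltW K0) (ltW a0)); set n := Num.bound _ => nP.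
have := H n; rewrite leNgt => /negP; apply.
rewrite ltr_pdivrMr ?ltr0n// -ltr_pdivrMl//.
rewrite mulrC; apply: (lt_le_trans nP); by rewrite ler_nat.
Qed.

Section Holomorphic.
Variable R : realType.
Local Notation C := (Cplx R).
Local Notation re := (@complex.Re R).
Local Notation im := (@complex.Im R).
Local Notation "x %:C" := (real_complex R x : C) (format "x %:C") : ring_scope.

Lemma rate_cvg (u : nat -> C) (K : R) :
  (forall n m, nm (u n - u m) <= K / n.+1%:R + K / m.+1%:R) ->
  exists l, forall n, nm (u n - l) <= (2 * K) / n.+1%:R.
Proof.
move=> H.
have [|a aP] := @rate_cvgR R (re \o u) K.
  move=> n m; apply: le_trans (H n m); rewrite /= -reN -reD; exact: re_le_nm.
have [|b bP] := @rate_cvgR R (im \o u) K.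
  move=> n m; apply: le_trans (H n m); rewrite /= -imN -imD; exact: im_le_nm.
exists (Complex a b) => n; apply: (le_trans (nm_le_reim _)).
rewrite reD imD reN imN /=; have := aP n; have := bP n => /=.
rewrite -mulrA mulr2n mulrDl !mul1r => ? ?; exact: lerD.
Qed.

Variable V : normedModType C.
Implicit Types (f : V -> C) (x y h v w : V).

Definition holo_bounded f x0 (r M : R) :=
  forall y, nm (y - x0) <= r -> differentiable f y /\ nm (f y) <= M.

Lemma line_derivable f y h (z : C) : differentiable f (y + z *: h) ->
  is_derive z 1 (fun z : C => f (y + z *: h)) ('d f (y + z *: h) h).
Proof.
move=> df.
have dl : is_diff z (fun z : C => y + z *: h) (fun t : C => t *: h).
  by apply: is_diff_eq; rewrite add0r.
have dfl : is_diff z (f \o (fun z : C => y + z *: h))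
    ('d f (y + z *: h) \o (fun t : C => t *: h)).
  by apply: is_diff_comp; exact: differentiableP.
have dd : differentiable (f \o (fun z : C => y + z *: h)) z by exact: ex_diff.
split; first exact/derivable1_diffP.
by rewrite deriveE// [X in X _ = _](@diff_val _ _ _ _ _ _ _ dfl) /= scale1r.
Qed.

Lemma taylor_bound f x0 (r M : R) : 0 < r -> holo_bounded f x0 (r + r) M ->
  forall y h, nm (y - x0) <= r -> 2 * nm h <= r ->
  nm (f (y + h) - f y - 'd f y h) <= 32 * M / r ^+ 2 * nm h ^+ 2.
Proof.
move=> r0 fg y h yr hr.
have [->|h0] := eqVneq h 0.
  by rewrite addr0 subrr sub0r linear0 nmN !nm0 expr0n /= mulr0.
have n0 : 0 < nm h by rewrite nm_gt0.
pose rho := r / (2 * nm h).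
have rho0 : 0 < rho by rewrite divr_gt0// mulr_gt0.
pose g (z : C) := f (y + z *: h).
have gP (z : C) : nm z <= 2 * rho ->
    is_derive z 1 g ('d f (y + z *: h) h) /\ nm (g z) <= M.
  move=> zr; have [|d b] := fg (y + z *: h).
    rewrite addrAC; apply: (le_trans (nmD _ _)); apply: lerD => //.
    rewrite nmZ -ler_pdivlMr//; apply: (le_trans zr).
    by rewrite le_eqVlt; apply/orP; left; apply/eqP; rewrite /rho; field; rewrite gt_eqF.
  by split=> //; exact: line_derivable.
have := @cauchy_taylor R g rho M rho0 _ 1.
have d0 : 'D_1 g 0 = 'd f y h.
  have [|[_ ->] _] := gP 0; first by rewrite nm0 mulr_ge0// ltW.
  by rewrite scale0r addr0.
rewrite nm1 d0 mulr1 expr1n mulr1 /g scale1r scale0r addr0 => H.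
apply: (le_trans (H _ _)).
- by move=> z /gP[[]].
- by rewrite ler_pdivlMr ?mulr_gt0// mul1r.
- rewrite le_eqVlt; apply/orP; left; apply/eqP; rewrite /rho.
  by field; rewrite !gt_eqF.
Qed.

Lemma derivative_bound f x0 (r M : R) : 0 < r -> holo_bounded f x0 (r + r) M ->
  forall y h, nm (y - x0) <= r -> nm ('d f y h) <= 4 * M / r * nm h.
Proof.
move=> r0 fg y h yr.
have [->|h0] := eqVneq h 0; first by rewrite linear0 !nm0 mulr0.
have n0 : 0 < nm h by rewrite nm_gt0.
pose rho := r / (2 * nm h).
have rho0 : 0 < rho by rewrite divr_gt0// mulr_gt0.
pose g (z : C) := f (y + z *: h).
have gP (z : C) : nm z <= 2 * rho ->
    is_derive z 1 g ('d f (y + z *: h) h) /\ nm (g z) <= M.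
  move=> zr; have [|d b] := fg (y + z *: h).
    rewrite addrAC; apply: (le_trans (nmD _ _)); apply: lerD => //.
    rewrite nmZ -ler_pdivlMr//; apply: (le_trans zr).
    by rewrite le_eqVlt; apply/orP; left; apply/eqP; rewrite /rho; field; rewrite gt_eqF.
  by split=> //; exact: line_derivable.
have := @cauchy_slope R g rho M rho0 _ 0.
have d0 : 'D_1 g 0 = 'd f y h.
  have [|[_ ->] _] := gP 0; first by rewrite nm0 mulr_ge0// ltW.
  by rewrite scale0r addr0.
rewrite nm0 /slope eqxx d0 => H.
apply: (le_trans (H _ _)).
- by move=> z /gP[[]].
- exact: ltW.
- rewrite le_eqVlt; apply/orP; left; apply/eqP; rewrite /rho.
  by field; rewrite !gt_eqF.
Qed.

Lemma near_holo_bounded f x0 : (\forall y \near x0, differentiable f y) ->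
  exists r M : R, 0 < r /\ holo_bounded f x0 r M.
Proof.
move=> /nbhs_nm[c c0 cP].
have : {for x0, continuous f}.
  by apply: differentiable_continuous; apply: cP; rewrite subrr nm0 ltW.
move=> /continuous_nm /(_ _ ltr01)[d d0 dP].
exists (Num.min c d), (nm (f x0) + 1); split; first by rewrite lt_min c0.
move=> y; rewrite le_min => /andP[/cP ? /dP H]; split=> //.
by rewrite -(subrK (f x0) (f y)); apply: (le_trans (nmD _ _)); lra.
Qed.

Lemma pack_linear (W : lmodType C) (L : V -> W) : linear L ->
  exists LL : {linear V -> W}, (LL : V -> W) = L.
Proof.
move=> Llin; pose m := GRing.isLinear.Build C V W *:%R L Llin.
pose LL : {linear V -> W} := HB.pack L m.
by exists LL.
Qed.

(* The difference quotients n (f (y + v / n) - f y) converge to the derivative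
   of f along v at rate 1/n, uniformly near x0; by the Cauchy estimates so do
   their differentials. *)
Theorem holomorphic_derivative f x0 v :
  (\forall y \near x0, differentiable f y) ->
  differentiable (fun y => 'd f y v) x0 /\
  exists (K : R) (N : nat), forall n w,
    nm ((N + n).+1%:R * ('d f (x0 + (N + n).+1%:R^-1 *: v) w - 'd f x0 w)
      - 'd (fun y => 'd f y v) x0 w) <= K * nm w / n.+1%:R.
Proof.
move=> /near_holo_bounded[r' [M [r'0 fg]]].
pose r := r' / 4; have r0 : 0 < r by rewrite divr_gt0.
have M0 : 0 <= M.
  by have [|_] := fg x0; [rewrite subrr nm0 ltW|apply: le_trans; exact: nm_ge0].
pose phi y := 'd f y v.
pose s n : R := (n.+1%:R)^-1 * (2 * nm v + r) / r.
pose N := Num.bound (2 * nm v / r).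
have Nbig n : 2 * nm v <= r * (N + n).+1%:R.
  have := archi_boundP (divr_ge0 (mulr_ge0 (ler0n R 2) (nm_ge0 v)) (ltW r0)).
  rewrite -/N ltr_pdivrMr// => h; apply: (le_trans (ltW h)).
  by rewrite mulrC ler_pM2l// ler_nat -addnS leq_addr.
pose k n : R := (N + n).+1%:R.
have k0 n : 0 < k n by rewrite ltr0n.
have kn n : n.+1%:R <= k n by rewrite ler_nat ltnS leq_addl.
pose t n : C := (k n)^-1%:C.
have nt n : nm (t n *: v) = nm v / k n.
  by rewrite nmZ nmC ger0_norm ?invr_ge0 ?ltW// mulrC.
have ntr n : 2 * nm (t n *: v) <= r.
  by rewrite nt mulrA ler_pdivrMr// Nbig.
pose h n y := (k n)%:C * (f (y + t n *: v) - f y).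
have fdiff y : nm (y - x0) <= 4 * r -> differentiable f y.
  by move=> yr; have [] := fg y => //; apply: (le_trans yr); rewrite /r; lra.
have hdiff n y : nm (y - x0) <= 2 * r ->
    is_diff y (h n) (fun w => (k n)%:C * ('d f (y + t n *: v) w - 'd f y w)).
  move=> yr.
  have d1 : is_diff y f ('d f y) by apply/differentiableP/fdiff; lra.
  have d2 : is_diff (y + t n *: v) f ('d f (y + t n *: v)).
    apply/differentiableP/fdiff; rewrite addrAC; apply: (le_trans (nmD _ _)).
    by have := ntr n; lra.
  have d3 : is_diff y (fun y => y + t n *: v) id by apply: is_diff_eq; rewrite addr0.
  have d4 : is_diff y (f \o (fun y => y + t n *: v)) ('d f (y + t n *: v) \o id).
    exact: is_diff_comp.
  have d5 := is_diffZ (k n)%:C (is_diffB d4 d1).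
  exact: d5.
pose A := 8 * M / r ^+ 2 * nm v ^+ 2.
have A0 : 0 <= A.
  by apply: mulr_ge0; rewrite ?sqr_ge0//; apply: divr_ge0; rewrite ?sqr_ge0 ?mulr_ge0.
have hphi n y : nm (y - x0) <= 2 * r -> nm (h n y - phi y) <= A / k n.
  move=> yr.
  have := @taylor_bound f x0 (2 * r) M _ _ y (t n *: v) yr.
  rewrite nt => H.
  have -> : h n y - phi y = (k n)%:C * (f (y + t n *: v) - f y - 'd f y (t n *: v)).
    have kC : (k n)%:C * t n = 1.
      by rewrite -rmorphM /= mulfV// gt_eqF.
    have -> : 'd f y (t n *: v) = t n * phi y by rewrite linearZ.
    by rewrite mulrBr mulrA kC mul1r.
  rewrite nmM nmC gtr0_norm//.
  have {}H : nm (f (y + t n *: v) - f y - 'd f y (t n *: v)) <=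
     32 * M / (2 * r) ^+ 2 * (nm v / k n) ^+ 2.
    apply: H.
    - by rewrite mulr_gt0.
    - by move=> z zr; apply: fg; apply: (le_trans zr); rewrite /r; lra.
    - by rewrite -nt; apply: (le_trans (ntr n)); lra.
  apply: (le_trans (ler_wpM2l (ltW (k0 n)) H)).
  rewrite le_eqVlt; apply/orP; left; apply/eqP; rewrite /A.
  by field; rewrite !gt_eqF.
pose B := 4 * M / (2 * r) * nm v + A.
have B0 : 0 <= B.
  rewrite addr_ge0// mulr_ge0 ?nm_ge0// divr_ge0 ?mulr_ge0//; exact: ltW.
have k1 n : 1 <= k n by rewrite ler1n.
have hB n y : nm (y - x0) <= 2 * r -> nm (h n y) <= B.
  move=> yr; rewrite -(subrK (phi y) (h n y)) addrC; apply: (le_trans (nmD _ _)).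
  apply: lerD.
    apply: (@derivative_bound f x0 (2 * r) M); rewrite ?mulr_gt0//.
    by move=> z zr; apply: fg; apply: (le_trans zr); rewrite /r; lra.
  apply: (le_trans (hphi n y yr)); rewrite ler_pdivrMr//.
  by rewrite ler_peMr.
have hgood n : holo_bounded (h n) x0 (r + r) B.
  move=> y yr; have yr2 : nm (y - x0) <= 2 * r by lra.
  by split; [have [] := hdiff n y yr2|exact: hB].
have x00 (q : R) : 0 <= q -> nm (x0 - x0) <= q by rewrite subrr nm0.
pose dh n w := (k n)%:C * ('d f (x0 + t n *: v) w - 'd f x0 w).
have dhE n w : 'd (h n) x0 w = dh n w.
  have H := hdiff n x0 (x00 _ (mulr_ge0 (ler0n R 2) (ltW r0))).
  by rewrite (@diff_val _ _ _ _ _ _ _ H).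
have dhC n m w : nm (dh n w - dh m w) <=
    (4 * A / r * nm w) / k n + (4 * A / r * nm w) / k m.
  have g2 : holo_bounded (h n - h m) x0 (r + r) (A / k n + A / k m).
    move=> y yr; have yr2 : nm (y - x0) <= 2 * r by lra.
    split; first by have [dn _] := hdiff n y yr2; have [dm _] := hdiff m y yr2;
      apply: differentiableB.
    have -> : (h n - h m) y = (h n y - phi y) - (h m y - phi y).
      by rewrite opprB addrA subrK.
    by apply: (le_trans (nmB _ _)); apply: lerD; exact: hphi.
  have := derivative_bound r0 g2 w (x00 _ (ltW r0)).
  have Hn := hdiff n x0 (x00 _ (mulr_ge0 (ler0n R 2) (ltW r0))).
  have Hm := hdiff m x0 (x00 _ (mulr_ge0 (ler0n R 2) (ltW r0))).
  have E := @diff_val _ _ _ _ _ _ _ (is_diffB Hn Hm).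
  have -> : 'd (h n - h m) x0 w = dh n w - dh m w by rewrite [X in X w = _]E.
  move=> /le_trans; apply.
  rewrite le_eqVlt; apply/orP; left; apply/eqP.
  by field; rewrite !gt_eqF.
have Kw w : 0 <= 4 * A / r * nm w.
  apply: mulr_ge0 (nm_ge0 _); apply: divr_ge0 (ltW r0); exact: mulr_ge0.
have dh_lim w : exists l, forall n, nm (dh n w - l) <= 2 * (4 * A / r * nm w) / n.+1%:R.
  apply: rate_cvg => n m; apply: (le_trans (dhC n m w)).
  by apply: lerD; apply: ler_wpM2l => //; rewrite lef_pV2 ?posrE ?ltr0n ?kn ?k0.
have [L LP] := choice dh_lim.
have Llin : linear L.
  move=> a w w'; apply/eqP; rewrite -subr_eq0 -nm_eq0 eq_le nm_ge0 andbT.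
  pose K w := 2 * (4 * A / r * nm w).
  apply: (@le0_rate _ _ (K (a *: w + w') + nm a * K w + K w')) => n.
  have -> : L (a *: w + w') - (a *: L w + L w') =
     a *: (dh n w - L w) + (dh n w' - L w') - (dh n (a *: w + w') - L (a *: w + w')).
    have -> : dh n (a *: w + w') = a * dh n w + dh n w'.
      have lz y : 'd f y (a *: w + w') = a * 'd f y w + 'd f y w' by rewrite linearP.
      by rewrite /dh !lz; ring.
    have sE (b : C) : a *: b = a * b by [].
    by rewrite !sE; ring.
  apply: (le_trans (nmB _ _)).
  have p0 := nmD (a *: (dh n w - L w)) (dh n w' - L w').
  have p1 : nm (a *: (dh n w - L w)) <= nm a * (K w / n.+1%:R).
    by rewrite nmZ ler_wpM2l ?nm_ge0 ?LP.
  have p2 := LP w' n; have p3 := LP (a *: w + w') n.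
  move: p0 p1 p2 p3; rewrite /K; move: (n.+1%:R^-1 : R) => q.
  move: (nm (_ - _)) (nm (dh _ _ - _)) (nm (_ *: (_ - _))) (nm (_ + (_ - _))) => *.
  lra.
have [LL LLE] := pack_linear Llin.
have Lrate n w : nm (dh n w - L w) <= 2 * (4 * A / r * nm w) / n.+1%:R by exact: LP.
have B1 : 0 <= 32 * B / r ^+ 2 by apply: divr_ge0; rewrite ?sqr_ge0 ?mulr_ge0.
have Ltaylor w : 2 * nm w <= r ->
    nm (phi (x0 + w) - phi x0 - L w) <= 32 * B / r ^+ 2 * nm w ^+ 2.
  move=> wr; rewrite -subr_le0.
  apply: (@le0_rate _ _ (A + A + 2 * (4 * A / r * nm w))) => n.
  rewrite lerBlDr.
  have xw : nm (x0 + w - x0) <= 2 * r.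
    by rewrite addrC addKr; have := nm_ge0 w; lra.
  have kA : A / k n <= A / n.+1%:R.
    by apply: ler_wpM2l => //; rewrite lef_pV2 ?posrE ?ltr0n ?kn ?k0.
  have t1 := le_trans (hphi n _ xw) kA.
  have t2 := le_trans (hphi n _ (x00 _ (mulr_ge0 (ler0n R 2) (ltW r0)))) kA.
  have t3 := taylor_bound r0 (hgood n) (x00 _ (ltW r0)) wr.
  rewrite dhE in t3.
  have -> : phi (x0 + w) - phi x0 - L w =
    (h n (x0 + w) - h n x0 - dh n w) + (dh n w - L w)
    - (h n (x0 + w) - phi (x0 + w)) + (h n x0 - phi x0) by ring.
  have p1 := nmD (h n (x0 + w) - h n x0 - dh n w + (dh n w - L w)
    - (h n (x0 + w) - phi (x0 + w))) (h n x0 - phi x0).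
  have p2 := nmB (h n (x0 + w) - h n x0 - dh n w + (dh n w - L w))
    (h n (x0 + w) - phi (x0 + w)).
  have p3 := nmD (h n (x0 + w) - h n x0 - dh n w) (dh n w - L w).
  have p4 := Lrate n w.
  move: t1 t2 t3 p1 p2 p3 p4; move: (n.+1%:R^-1 : R) => q *; lra.
have [dphi dphiE] : differentiable phi x0 /\ ('d phi x0 : V -> C) = LL.
  apply: (@nm_differentiable R V C phi LL x0 (2 * (4 * A / r) + 4 * B / r)) => [w|e e0].
    rewrite LLE; have := Lrate 0%N w.
    have := derivative_bound r0 (hgood 0%N) w (x00 _ (ltW r0)); rewrite dhE divr1.
    rewrite -{2}(subKr (dh 0%N w) (L w)) => h1 h2; apply: (le_trans (nmB _ _)).
    by rewrite mulrDl [leRHS]addrC -(mulrA 2); apply: lerD.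
  pose c := Num.min (r / 2) (e / (1 + 32 * B / r ^+ 2)).
  have B2 : 0 < 1 + 32 * B / r ^+ 2 by rewrite ltr_pwDl.
  exists c; first by rewrite lt_min !divr_gt0.
  move=> w; rewrite le_min => /andP[wr]; rewrite ler_pdivlMr// => we.
  rewrite LLE (addrC w); apply: (le_trans (Ltaylor _ _)); first lra.
  rewrite expr2 mulrA ler_wpM2r ?nm_ge0// mulrC; apply: le_trans we.
  by rewrite ler_wpM2l ?nm_ge0// lerDr.
split=> //; exists (2 * (4 * A / r)), N => n w.
have nC m : (m%:R : R)%:C = m%:R by rewrite rmorph_nat.
have -> : (N + n).+1%:R = (k n)%:C by rewrite nC.
have -> : (k n)%:C^-1 = t n by rewrite /t fmorphV.
have E : 'd phi x0 w = L w by rewrite -LLE -dphiE.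
have H : nm (dh n w - 'd phi x0 w) <= 2 * (4 * A / r) * nm w / n.+1%:R.
  by rewrite E -[2 * _ * _]mulrA; exact: Lrate.
exact: H.
Qed.

Theorem derivative_sym f x0 v w :
  (\forall y \near x0, differentiable f y) ->
  'd (fun y => 'd f y v) x0 w = 'd (fun y => 'd f y w) x0 v.
Proof.
move=> fd; have [_ [K [N KP]]] := holomorphic_derivative v fd.
have [dpsi _] := holomorphic_derivative w fd.
set psi := fun y => 'd f y w.
have [D DE DP] : exists2 D : {linear V -> C}, 'd psi x0 v = D v &
    forall e : R, 0 < e -> exists2 c : R, 0 < c & forall h, nm h <= c ->
      nm (psi (h + x0) - psi x0 - D h) <= e * nm h.
  by exists ('d psi x0) => //; exact: differentiable_nm dpsi.
apply: etrans (esym DE).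
apply/eqP; rewrite -subr_eq0 -nm_eq0 eq_le nm_ge0 andbT.
apply/ler_addgt0Pr => e e0; rewrite add0r.
have v1 : 0 < 2 * (1 + nm v) by rewrite mulr_gt0// ltr_pwDl// nm_ge0.
have [c c0 cP] := DP _ (divr_gt0 e0 v1).
have a0 : 0 <= nm v / c by rewrite divr_ge0 ?nm_ge0// ltW.
pose n := (Num.bound (nm v / c)%R + Num.bound (2 * `|K * nm w| / e)%R)%N.
pose k : R := (N + n).+1%:R; have k0 : 0 < k by rewrite ltr0n.
have nk : nm v / c <= k.
  apply: (le_trans (ltW (archi_boundP a0))); rewrite ler_nat /n.
  by rewrite leqW// addnCA leq_addr.
have ne : K * nm w / n.+1%:R <= e / 2.
  have b0 : 0 <= 2 * `|K * nm w| / e by rewrite divr_ge0 ?mulr_ge0// ltW.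
  have /ltW := archi_boundP b0; rewrite ler_pdivrMr// => H.
  rewrite ler_pdivrMr ?ltr0n//; apply: (le_trans (ler_norm _)).
  have : (Num.bound (2 * `|K * nm w| / e))%:R * e <= n.+1%:R * e.
    by rewrite ler_pM2r// ler_nat leqW// leq_addl.
  move: H; set b := Num.bound _; move: (b%:R : R) (n.+1%:R : R) => {}b q; lra.
have kC : (N + n).+1%:R = k%:C :> C by rewrite rmorph_nat.
have := KP n w; rewrite kC -fmorphV /= => h1.
have nkv : nm (k^-1%:C *: v) = nm v / k.
  by rewrite nmZ nmC gtr0_norm ?invr_gt0// mulrC.
have := cP (k^-1%:C *: v); rewrite nkv ler_pdivrMr// -ler_pdivrMl//.
rewrite mulrC nk => /(_ isT); rewrite (addrC (_ *: v)) => h2.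
have lz : D (k^-1%:C *: v) = k^-1%:C * D v by rewrite linearZ.
rewrite lz in h2.
have kk : k%:C * k^-1%:C = 1 by rewrite -rmorphM /= mulfV// gt_eqF.
have h3 : nm (k%:C * (psi (x0 + k^-1%:C *: v) - psi x0) - D v) <= e / 2.
  have -> : k%:C * (psi (x0 + k^-1%:C *: v) - psi x0) - D v =
    k%:C * (psi (x0 + k^-1%:C *: v) - psi x0 - k^-1%:C * D v).
    by rewrite [RHS]mulrBr mulrA kk mul1r.
  rewrite nmM nmC gtr0_norm//; apply: (le_trans (ler_wpM2l (ltW k0) h2)).
  have -> : k * (e / (2 * (1 + nm v)) * (nm v / k)) = e / 2 * (nm v / (1 + nm v)).
    by field; rewrite !gt_eqF// ltr_pwDl// nm_ge0.
  apply: ler_piMr; first by apply: divr_ge0 => //; exact: ltW.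
  by rewrite ler_pdivrMr ?ltr_pwDl ?nm_ge0// mul1r lerDr.
set a := k%:C * _ in h1 h3.
have -> : 'd (fun y => 'd f y v) x0 w - D v =
  (a - D v) - (a - 'd (fun y => 'd f y v) x0 w) by ring.
by apply: (le_trans (nmB _ _)); rewrite (splitr e) lerD// (le_trans h1).
Qed.

End Holomorphic.

(** * Differentials of matrix-valued maps *)

Section IsDiff.
Variable R : realType.
Local Notation C := (Cplx R).
Variables (V W : normedModType C).

Lemma nm_is_diff (f : V -> W) (df : V -> W) x (K : R) : linear df ->
  (forall h, nm (df h) <= K * nm h) ->
  (forall e : R, 0 < e -> exists2 c : R, 0 < c & forall h, nm h <= c ->
    nm (f (h + x) - f x - df h) <= e * nm h) ->
  is_diff x f df.
Proof.
move=> dflin; have [L LE] := pack_linear dflin; rewrite -LE => K0 H.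
by have [d dE] := nm_differentiable K0 H; split.
Qed.

Lemma is_diff_linear (f df : V -> W) x : is_diff x f df -> linear df.
Proof. by case=> _ <- a u v; rewrite linearP. Qed.

Lemma is_diff_nm (f df : V -> W) x : is_diff x f df ->
  forall e : R, 0 < e -> exists2 c : R, 0 < c & forall h, nm h <= c ->
    nm (f (h + x) - f x - df h) <= e * nm h.
Proof. by case=> d <- e e0; exact: differentiable_nm. Qed.

Lemma is_diff_bounded (f df : V -> W) x : is_diff x f df ->
  exists2 K : R, 0 <= K & forall h, nm (df h) <= K * nm h.
Proof. by case=> d <-; exact: diff_bounded. Qed.

Lemma is_diff_near (f g df : V -> W) x : (\forall y \near x, f y = g y) ->
  is_diff x f df -> is_diff x g df.
Proof.
move=> fg fd; have [K _ KP] := is_diff_bounded fd.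
apply: (nm_is_diff (is_diff_linear fd) KP) => e e0.
have [c c0 cP] := is_diff_nm fd e0.
move/nbhs_nm: fg => [d d0 dP].
exists (Num.min c d); first by rewrite lt_min c0.
move=> h; rewrite le_min => /andP[/cP hc hd].
by rewrite -(dP (h + x)) ?addrK// -(dP x)// subrr nm0 ltW.
Qed.

Lemma is_diff_unique (f df dg : V -> W) x : is_diff x f df -> is_diff x f dg ->
  df = dg.
Proof. by case=> _ <- [_ <-]. Qed.

End IsDiff.

Section LinearMap.
Variables (K : numFieldType) (V : normedModType K).

Lemma is_diff_linear_map (W : normedModType K) (f : V -> W) x :
  linear f -> continuous f -> is_diff x f f.
Proof.
move=> lin fc; pose mm := GRing.isLinear.Build K V W *:%R _ lin.
pose L : {linear V -> W} := HB.pack f mm.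
by split; [exact: (@linear_differentiable _ _ _ L x fc)|exact: (@diff_lin _ _ _ L x fc)].
Qed.

End LinearMap.

Section MatrixCalculus.
Variables (K : numFieldType) (V : normedModType K).

Lemma is_diff_coord m n (F dF : V -> 'M[K]_(m, n)) x i j :
  is_diff x F dF -> is_diff x (fun y => F y i j) (fun h => dF h i j).
Proof.
move=> Fd; have dL : is_diff (F x) (fun A => A i j) (fun A => A i j).
  apply: is_diff_linear_map; last exact: coord_continuous.
  by move=> a A B; rewrite !mxE.
exact: (is_diff_comp Fd dL).
Qed.

Lemma is_diff_sum (W : normedModType K) n (f df : 'I_n -> V -> W) x :
  (forall i, is_diff x (f i) (df i)) ->
  is_diff x (fun y => \sum_i f i y) (fun h => \sum_i df i h).
Proof.
elim: n f df => [|n IH] f df H.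
  have -> : (fun y => \sum_(i < 0) f i y) = cst 0 :> (V -> W).
    by apply/funext => y; rewrite big_ord0.
  have -> : (fun y => \sum_(i < 0) df i y) = (0 : V -> W).
    by apply/funext => y; rewrite big_ord0.
  exact: is_diff_cst.
have -> : (fun y => \sum_(i < n.+1) f i y) =
    f ord0 + (fun y => \sum_(i < n) f (lift ord0 i) y).
  by apply/funext => y; rewrite big_ord_recl.
have -> : (fun y => \sum_(i < n.+1) df i y) =
    df ord0 + (fun y => \sum_(i < n) df (lift ord0 i) y).
  by apply/funext => y; rewrite big_ord_recl.
by apply: is_diffD => //; apply: IH => i; exact: H.
Qed.

Lemma is_diff_mul (f g df dg : V -> K) x : is_diff x f df -> is_diff x g dg ->
  is_diff x (fun y => f y * g y) (fun h => df h * g x + f x * dg h).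
Proof.
move=> fd gd; have H := is_diffM fd gd.
suff <- : f x *: dg + g x *: df = (fun h => df h * g x + f x * dg h) by [].
by apply/funext => h; rewrite [LHS]addrC mulrC.
Qed.

Lemma is_diff_mx m n (F dF : V -> 'M[K]_(m, n)) x :
  (forall i j, is_diff x (fun y => F y i j) (fun h => dF h i j)) ->
  is_diff x F dF.
Proof.
move=> Fd.
have -> : F = fun y => \sum_i \sum_j F y i j *: delta_mx i j.
  by apply/funext => y; exact: matrix_sum_delta.
have -> : dF = fun y => \sum_i \sum_j dF y i j *: delta_mx i j.
  by apply/funext => y; exact: matrix_sum_delta.
apply: (@is_diff_sum _ _ (fun i y => \sum_j F y i j *: delta_mx i j)
  (fun i y => \sum_j dF y i j *: delta_mx i j)) => i.
apply: (@is_diff_sum _ _ (fun j y => F y i j *: delta_mx i j)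
  (fun j y => dF y i j *: delta_mx i j)) => j.
have dk : differentiable (fun y => F y i j) x by have [] := Fd i j.
split; first exact: (differentiableZl _ dk).
rewrite (diffZl _ dk); apply/funext => h; congr (_ *: _).
by have [_ dE] := Fd i j; exact: (congr1 (@^~ h) dE).
Qed.

Lemma is_diff_mulmx m n p (F dF : V -> 'M[K]_(m, n)) (G dG : V -> 'M[K]_(n, p)) x :
  is_diff x F dF -> is_diff x G dG ->
  is_diff x (fun y => F y *m G y) (fun h => dF h *m G x + F x *m dG h).
Proof.
move=> Fd Gd; apply: is_diff_mx => i j.
have -> : (fun y => (F y *m G y) i j) = (fun y => \sum_k F y i k * G y k j).
  by apply/funext => y; rewrite mxE.
have -> : (fun h => (dF h *m G x + F x *m dG h) i j) =
   (fun h => \sum_k (dF h i k * G x k j + F x i k * dG h k j)).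
  by apply/funext => h; rewrite !mxE -big_split.
apply: (@is_diff_sum _ _ (fun k y => F y i k * G y k j)
  (fun k h => dF h i k * G x k j + F x i k * dG h k j)) => k.
by apply: (@is_diff_mul (fun y => F y i k) (fun y => G y k j)
  (fun h => dF h i k) (fun h => dG h k j)); exact: is_diff_coord.
Qed.

End MatrixCalculus.

Section Matrix.
Variable R : realType.
Local Notation C := (Cplx R).
Local Notation "x %:C" := (real_complex R x : C) (format "x %:C") : ring_scope.

Lemma nm_coord m n (A : 'M[C]_(m, n)) i j : nm (A i j) <= nm A.
Proof.
rewrite -lecC -!nmE {2}/Num.Def.normr /= mx_normE -[leLHS]nngE num_le.
exact: (le_bigmax _ (fun x => (`|A x.1 x.2|)%:nng) (i, j)).
Qed.

Lemma nm_mx_le m n (A : 'M[C]_(m, n)) (e : R) : 0 <= e ->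
  (forall i j, nm (A i j) <= e) -> nm A <= e.
Proof.
move=> e0 H; rewrite -lecC -nmE.
have [->|A0] := eqVneq A 0; first by rewrite normr0 lecR.
have : mx_norm A != 0 by apply: contra_neq A0; exact: mx_norm_eq0.
move=> /mx_norm_neq0[[i j] /= E].
have -> : `|A| = `|A i j| by exact: E.
by rewrite nmE lecC.
Qed.

Variable V : normedModType C.

Lemma differentiable_mx m n (F : V -> 'M[C]_(m, n)) x :
  (forall i j, differentiable (fun y => F y i j) x) -> differentiable F x.
Proof.
move=> Fd.
have [D DP] : exists D : 'I_m * 'I_n -> V -> C,
    forall ij, is_diff x (fun y => F y ij.1 ij.2) (D ij).
  have H (ij : 'I_m * 'I_n) : exists D : V -> C, is_diff x (fun y => F y ij.1 ij.2) D.
    by exists ('d (fun y => F y ij.1 ij.2) x); exact: differentiableP.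
  by have [D DP] := choice H; exists D.
suff H : is_diff x F (fun h => \matrix_(i, j) D (i, j) h) by exact: ex_diff.
apply: is_diff_mx => i j.
have -> : (fun h => (\matrix_(i, j) D (i, j) h) i j) = D (i, j).
  by apply/funext => h; rewrite mxE.
exact: DP (i, j).
Qed.

Lemma differentiable_near (f g : V -> C) x : (\forall y \near x, f y = g y) ->
  differentiable f x -> differentiable g x.
Proof. by move=> /is_diff_near H /differentiableP /H[]. Qed.

Lemma differentiable_derivative m n (F : V -> 'M[C]_(m, n)) x0 v :
  (\forall y \near x0, differentiable F y) ->
  differentiable (fun y => 'd F y v) x0.
Proof.
move=> Fd; apply: differentiable_mx => i j.
have E : (\forall y \near x0, 'd (fun z => F z i j) y v = 'd F y v i j).
  apply: filterS Fd => y dy.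
  have := is_diff_coord i j (differentiableP dy).
  by case=> _ ->.
apply: (differentiable_near E).
have fd : \forall y \near x0, differentiable (fun z => F z i j) y.
  apply: filterS Fd => y dy.
  by have [] := is_diff_coord i j (differentiableP dy).
exact: (holomorphic_derivative v fd).1.
Qed.

Lemma derivative_sym_mx m n (F : V -> 'M[C]_(m, n)) x0 v w :
  (\forall y \near x0, differentiable F y) ->
  'd (fun y => 'd F y v) x0 w = 'd (fun y => 'd F y w) x0 v.
Proof.
move=> Fd; apply/matrixP => i j.
have fd : \forall y \near x0, differentiable (fun z => F z i j) y.
  apply: filterS Fd => y dy.
  by have [] := is_diff_coord i j (differentiableP dy).
have step u t : 'd (fun y => 'd F y u) x0 t i j
    = 'd (fun y => 'd (fun z => F z i j) y u) x0 t.
  have E : (\forall y \near x0, 'd F y u i j = 'd (fun z => F z i j) y u).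
    apply: filterS Fd => y dy.
    by have := is_diff_coord i j (differentiableP dy); case=> _ ->.
  have D := is_diff_coord i j (differentiableP (differentiable_derivative u Fd)).
  by have [_ dE] := is_diff_near E D; exact: esym (congr1 (@^~ t) dE).
apply: etrans (step _ _) _; apply: etrans (derivative_sym _ _ fd) _.
exact: esym (step _ _).
Qed.

Lemma liouville (f : V -> C) (M : R) :
  (forall y, differentiable f y) -> (forall y, nm (f y) <= M) ->
  forall y, f y = f 0.
Proof.
move=> fd fM y; have [->//|y0] := eqVneq y 0.
apply/eqP; rewrite -subr_eq0 -nm_eq0 eq_le nm_ge0 andbT.
apply: (@le0_rate _ _ (2 * M)) => n.
have n0 : 0 < n.+1%:R :> R by rewrite ltr0n.
pose g (z : C) := f (0 + z *: y).
have := @cauchy_slope R g n.+1%:R M n0 _ 1.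
rewrite /slope oner_eq0 subr0 divr1 /g scale1r scale0r !add0r; apply.
  move=> z _; split => //.
  by have [] := @line_derivable R V f 0 y z (fd _).
by rewrite nm1 ler1n.
Qed.

Lemma zero_derivative_segment (f : V -> C) x y :
  (forall t : R, 0 <= t <= 1 -> is_diff (x + t%:C *: (y - x)) f 0) -> f y = f x.
Proof.
move=> f0.
have key (q : C -> R) : (forall z w, q (z - w) = q z - q w) ->
    (forall z, `|q z| <= nm z) -> q (f y) = q (f x).
  move=> qB qn; pose phi (t : R) := q (f (x + t%:C *: (y - x))).
  have dphi (t : R) : 0 <= t <= 1 -> is_derive t 1 phi 0.
    move=> /f0 ft.
    have L0 : linear (fun _ : R => 0 : R) by move=> a u v; rewrite scaler0 addr0.
    pose mm := GRing.isLinear.Build R R R *:%R _ L0.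
    pose L : {linear R -> R} := HB.pack (fun _ : R => 0 : R) mm.
    have Lc : continuous L by move=> z; exact: cst_continuous.
    have [|d dE] := @le_differentiable R R R phi L t Lc.
      move=> e e0; have k0 : 0 < 1 + nm (y - x) by rewrite ltr_pwDl// nm_ge0.
      have e1 : 0 < e / (1 + nm (y - x)) by rewrite divr_gt0.
      have [c c0 cP] := is_diff_nm ft e1.
      apply/(@nbhs_ballP R R); exists (c / (1 + nm (y - x))); first by rewrite /= divr_gt0.
      move=> h; rewrite -ball_normE /ball_ /= sub0r normrN => hc.
      rewrite subr0 /phi -qB; apply: (le_trans (qn _)).
      have := cP (h%:C *: (y - x)).
      rewrite nmZ nmC addrCA -scalerDl -rmorphD /= => H.
      have hy : `|h| * nm (y - x) <= `|h| * (1 + nm (y - x)) by rewrite ler_wpM2l// lerDr.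
      have hc' : `|h| * nm (y - x) <= c.
        by apply: (le_trans hy); rewrite -ler_pdivlMr//; exact: ltW.
      have {H} := H hc'; rewrite subr0 => /le_trans; apply.
      apply: (le_trans (ler_wpM2l (ltW e1) hy)).
      by rewrite mulrCA mulfVK ?gt_eqF// mulrC.
    apply: DeriveDef; first exact/derivable1_diffP.
    by rewrite deriveE// [X in X 1]dE.
  have : `|phi 1 - phi 0| <= 0 * (1 - 0).
    by apply: (@increment_le R phi (fun=> 0)) => // z _; rewrite normr0.
  rewrite mul0r normr_le0 subr_eq0 /phi => /eqP.
  by rewrite scale0r addr0 (_ : real_complex R 1 = 1)// scale1r subrKC.
apply: Cplx_eq; apply: key => z *; rewrite ?reD ?reN ?imD ?imN//.
  exact: re_le_nm.
exact: im_le_nm.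
Qed.

Lemma locally_constant0 (f : V -> C) x0 :
  (\forall y \near x0, is_diff y f 0) -> \forall y \near x0, f y = f x0.
Proof.
move=> /nbhs_nm[c c0 cP]; apply/nbhs_nm; exists c => // y yc.
apply: zero_derivative_segment => t /andP[t0 t1]; apply: cP.
rewrite addrC addKr nmZ nmC ger0_norm//; apply: le_trans yc.
by rewrite ler_piMl ?nm_ge0.
Qed.

End Matrix.

Section InverseMatrix.
Variable R : realType.
Local Notation C := (Cplx R).

Lemma nm_sum n (F : 'I_n -> C) : nm (\sum_i F i) <= \sum_i nm (F i).
Proof.
elim/big_ind2: _ => [|x y z t h k|//]; first by rewrite nm0.
by apply: (le_trans (nmD _ _)); exact: lerD.
Qed.

Lemma nm_mulmx m n p (A : 'M[C]_(m, n)) (B : 'M[C]_(n, p)) :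
  nm (A *m B) <= n%:R * (nm A * nm B).
Proof.
apply: nm_mx_le => [|i j]; first by rewrite !mulr_ge0 ?nm_ge0.
rewrite mxE; apply: (le_trans (nm_sum _)).
apply: (@le_trans _ _ (\sum_(k < n) nm A * nm B)).
  by apply: ler_sum => k _; rewrite nmM; apply: ler_pM; rewrite ?nm_ge0 ?nm_coord.
by rewrite sumr_const card_ord mulr_natl.
Qed.

Variable V : normedModType C.

Lemma is_diff_cont (W : normedModType C) (f df : V -> W) x : is_diff x f df ->
  {for x, continuous f}.
Proof. by case=> d _; exact: differentiable_continuous. Qed.

End InverseMatrix.

Section InverseMatrixDifferential.
Variables (K : numFieldType) (V : normedModType K).

Lemma differentiable_bigsum (I : Type) (s : seq I) (F : I -> V -> K) x :
  (forall i, differentiable (F i) x) -> differentiable (fun y => \sum_(i <- s) F i y) x.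
Proof.
move=> Fd; elim: s => [|i s IH].
  rewrite (_ : (fun y => _) = cst 0); first exact: differentiable_cst.
  by apply/funext => y; rewrite big_nil.
rewrite (_ : (fun y => _) = F i + (fun y => \sum_(j <- s) F j y)); first exact: differentiableD.
by apply/funext => y; rewrite big_cons.
Qed.

Lemma differentiable_bigprod (I : Type) (s : seq I) (F : I -> V -> K) x :
  (forall i, differentiable (F i) x) -> differentiable (fun y => \prod_(i <- s) F i y) x.
Proof.
move=> Fd; elim: s => [|i s IH].
  rewrite (_ : (fun y => _) = cst 1); first exact: differentiable_cst.
  by apply/funext => y; rewrite big_nil.
rewrite (_ : (fun y => _) = F i * (fun y => \prod_(j <- s) F j y)); first exact: differentiableM.
by apply/funext => y; rewrite big_cons.
Qed.

Lemma differentiable_det n (M : V -> 'M[K]_n) x :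
  (forall i j, differentiable (fun y => M y i j) x) ->
  differentiable (fun y => \det (M y)) x.
Proof.
move=> Md; apply: differentiable_bigsum => s.
apply: differentiableM; first exact: differentiable_cst.
by apply: differentiable_bigprod => i; exact: Md.
Qed.

Lemma unitmx_near n (M : V -> 'M[K]_n) x : differentiable M x ->
  M x \in unitmx -> \forall y \near x, M y \in unitmx.
Proof.
move=> /differentiableP Md; rewrite unitmxE unitfE => Mu.
have dd : differentiable (fun y => \det (M y)) x.
  by apply: differentiable_det => i j; have [] := is_diff_coord i j Md.
have nz : \forall z \near \det (M x), z != 0.
  apply/nbhs_ballP; exists `|\det (M x)|; first by rewrite /= normr_gt0.
  by move=> z; rewrite -ball_normE /ball_ /=; apply: contraTneq => ->; rewrite subr0 ltxx.
have nM : \forall y \near x, \det (M y) != 0 by exact: (differentiable_continuous dd nz).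
by apply: filterS nM => y; rewrite unitmxE unitfE.
Qed.

End InverseMatrixDifferential.

Lemma inv_is_diff (R : realType) (V : normedModType (Cplx R)) n
    (M dM : V -> 'M[Cplx R]_n) x : is_diff x M dM -> M x \in unitmx ->
  is_diff x (fun y => invmx (M y)) (fun h => - (invmx (M x) *m dM h *m invmx (M x))).
Proof.
move=> Md Mu; have [dM' _] := Md; have Mn := unitmx_near dM' Mu.
have entry i j : differentiable (fun y => M y i j) x by have [] := is_diff_coord i j Md.
have dX : differentiable (fun y => invmx (M y)) x.
  apply: differentiable_mx => i j.
  have dD : differentiable (fun y => (\det (M y))^-1) x.
    by apply: differentiableV; [exact: differentiable_det|move: Mu; rewrite unitmxE unitfE].
  have dI : differentiable (fun y => (\det (M y))^-1 * cofactor (M y) j i) x.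
    apply: (differentiableM dD); apply: (differentiableM (differentiable_cst _ x)).
    apply: differentiable_det => k l.
    by rewrite (_ : (fun y => _) = (fun y => M y (lift j k) (lift i l)))//; apply/funext => y; rewrite !mxE.
  apply: differentiable_near dI; apply: filterS Mn => y My.
  by rewrite /invmx My !mxE.
split; first exact: dX.
apply/funext => h.
have H := is_diff_mulmx Md (differentiableP dX).
have E : \forall y \near x, M y *m invmx (M y) = cst 1%:M y.
  by apply: filterS Mn => y My; rewrite mulmxV.
have /(congr1 (@^~ h)) /= := is_diff_unique (is_diff_near E H) (is_diff_cst 1%:M x).
move=> /eqP; rewrite addrC addr_eq0 => /eqP /(congr1 (mulmx (invmx (M x)))).
by rewrite mulKmx// mulmxN mulmxA.
Qed.

(** * Period matrices *)

Section PeriodMatrix.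
Variable R : realType.
Local Notation C := (Cplx R).
Local Notation re := (@complex.Re R).
Local Notation im := (@complex.Im R).

Definition conjC (z : C) : C := Complex (re z) (- im z).

Lemma conjCK z : conjC (conjC z) = z.
Proof. by apply: Cplx_eq; rewrite /= ?opprK. Qed.
Lemma conjCD z w : conjC (z + w) = conjC z + conjC w.
Proof. by apply: Cplx_eq; rewrite /= ?reD ?imD ?opprD. Qed.
Lemma conjCM z w : conjC (z * w) = conjC z * conjC w.
Proof. by apply: Cplx_eq; rewrite /= ?reM ?imM /=; ring. Qed.
Lemma conjC0 : conjC 0 = 0.
Proof. by apply: Cplx_eq; rewrite /= ?oppr0. Qed.
Lemma conjC_sum n (F : 'I_n -> C) : conjC (\sum_i F i) = \sum_i conjC (F i).
Proof. by apply: (big_morph conjC conjCD conjC0). Qed.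

Definition conjCmx m n (A : 'M[C]_(m, n)) : 'M[C]_(m, n) := map_mx conjC A.

Lemma conjCmx_mul m n p (A : 'M[C]_(m, n)) (B : 'M[C]_(n, p)) :
  conjCmx (A *m B) = conjCmx A *m conjCmx B.
Proof.
apply/matrixP => i j; rewrite !mxE conjC_sum; apply: eq_bigr => k _.
by rewrite conjCM !mxE.
Qed.

Lemma conjCmxK m n (A : 'M[C]_(m, n)) : conjCmx (conjCmx A) = A.
Proof. by apply/matrixP => i j; rewrite !mxE conjCK. Qed.

Lemma conjCmx0 m n : conjCmx (0 : 'M[C]_(m, n)) = 0.
Proof. by apply/matrixP => i j; rewrite !mxE conjC0. Qed.

Lemma conjCmxZ m n a (A : 'M[C]_(m, n)) : conjCmx (a *: A) = conjC a *: conjCmx A.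
Proof. by apply/matrixP => i j; rewrite !mxE conjCM. Qed.

Definition embed_mx m n (A : 'M[R]_(m, n)) : 'M[C]_(m, n) :=
  map_mx (real_complex R : R -> C) A.

Definition period_matrix r (P : 'M[C]_(r + r, r)) : Prop :=
  forall x : 'rV[R]_(r + r), embed_mx x *m P = 0 -> x = 0.

Lemma period_unit r (P : 'M[C]_(r + r, r)) : period_matrix P ->
  row_mx P (conjCmx P) \in unitmx.
Proof.
move=> indep; rewrite -row_free_unit; apply: inj_row_free => v.
rewrite mul_mx_row => /eqP; rewrite row_mx_eq0 => /andP[/eqP vP /eqP vP'].
have cvP : conjCmx v *m P = 0.
  by rewrite -[P]conjCmxK -conjCmx_mul vP' conjCmx0.
have reP : embed_mx (map_mx re v) = 2^-1 *: (v + conjCmx v).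
  apply/matrixP => i j; rewrite !mxE; apply: (@mulfI _ 2); first by rewrite pnatr_eq0.
  rewrite mulVKf ?pnatr_eq0//; apply: Cplx_eq; rewrite ?reD ?imD ?reM ?imM /=; ring.
have imP : embed_mx (map_mx im v) = - (2^-1 * 'i%C) *: (v - conjCmx v).
  apply/matrixP => i j; rewrite !mxE; apply: (@mulfI _ 2); first by rewrite pnatr_eq0.
  rewrite mulNr -mulrA mulrN mulVKf ?pnatr_eq0//.
  by apply: Cplx_eq; rewrite ?reN ?imN ?reM ?imM ?reD ?imD ?reN ?imN /=; ring.
have re0 : map_mx re v = 0.
  by apply: indep; rewrite reP -scalemxAl mulmxDl vP cvP addr0 scaler0.
have im0 : map_mx im v = 0.
  by apply: indep; rewrite imP -scalemxAl mulmxBl vP cvP subr0 scaler0.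
apply/matrixP => i j; move/matrixP: re0 => /(_ i j); move/matrixP: im0 => /(_ i j).
by rewrite !mxE => h k; apply: Cplx_eq.
Qed.

Lemma period_left_inverse r (P : 'M[C]_(r + r, r)) : period_matrix P ->
  exists K, K *m P = 1%:M.
Proof.
move=> /period_unit Qu; exists (usubmx (invmx (row_mx P (conjCmx P)))).
have := mulVmx Qu; rewrite -{1}[invmx _]vsubmxK mul_col_mx !mul_mx_row.
by rewrite scalar_mx_block => /eq_col_mx[/eq_row_mx[]].
Qed.

Lemma period_span r (P : 'M[C]_(r + r, r)) : period_matrix P ->
  forall q : 'M[C]_(r + r, 1), exists a b, q = P *m a + conjCmx P *m b.
Proof.
move=> /period_unit Qu q; pose c := invmx (row_mx P (conjCmx P)) *m q.
exists (usubmx c), (dsubmx c).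
by rewrite -mul_row_col vsubmxK mulmxA mulmxV// mul1mx.
Qed.

Lemma colinear (v : 'rV[C]_2) (a b : 'cV[C]_2) : v != 0 -> v *m a = 0 ->
  v *m b = 0 -> a != 0 -> exists nu, b = nu *: a.
Proof.
move=> v0 va vb a0.
have rk : (\rank v^T = 1)%N.
  by apply/eqP; rewrite eqn_leq rank_leq_col lt0n mxrank_eq0 trmx_eq0.
have ka : (a^T <= kermx v^T)%MS by apply/sub_kermxP; rewrite -trmx_mul va trmx0.
have kb : (b^T <= kermx v^T)%MS by apply/sub_kermxP; rewrite -trmx_mul vb trmx0.
have rk1 : (\rank (kermx v^T) = 1)%N by rewrite mxrank_ker rk.
have : (b^T <= a^T)%MS.
  apply: (submx_trans kb); rewrite -(mxrank_leqif_sup ka).2 rk1.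
  by rewrite eqn_leq lt0n mxrank_eq0 trmx_eq0 a0 andbT rank_leq_row.
move=> /submxP[D bD]; exists (D 0 0); apply: (can_inj (@trmxK _ _ _)).
by rewrite bD linearZ /= {1}[D]mx11_scalar mul_scalar_mx.
Qed.

End PeriodMatrix.

(** * Special coordinates and automorphisms *)

Lemma continuous_quotient (K : numFieldType) (V : normedModType K) (f g : V -> K) x :
  {for x, continuous f} -> {for x, continuous g} -> g x != 0 ->
  {for x, continuous (fun y => f y / g y)}.
Proof. by move=> fc gc g0; apply: cvgM => //; apply: cvgV. Qed.

Section SpecialCoordinates.
Variable R : realType.
Local Notation C := (Cplx R).
Local Notation V := 'rV[C]_2.

Variables (O : set V) (P : V -> 'M[C]_(2 + 2, 2)) (a : V -> 'cV[C]_2)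
  (A : V -> 'M[C]_2).
Hypothesis O_open : open O.
Hypothesis dP : forall y, O y -> differentiable P y.
Hypothesis da : forall y, O y -> differentiable a y.
Hypothesis dZ : forall y, O y -> forall e : V,
  'd (fun y => P y *m a y) y e = P y *m A y *m e^T.
Hypothesis A_unit : forall y, O y -> A y \in unitmx.
Hypothesis P_period : forall y, O y -> period_matrix (P y).

Lemma O_near y : O y -> \forall z \near y, O z.
Proof. by move=> Oy; apply: open_nbhs_nbhs; split. Qed.

Lemma is_diff_P y : O y -> is_diff y P ('d P y).
Proof. by move=> /dP; exact: differentiableP. Qed.

Lemma central_charge y e : O y ->
  P y *m A y *m e^T = 'd P y e *m a y + P y *m 'd a y e.
Proof.
move=> Oy; rewrite -dZ//.
have H := is_diff_mulmx (is_diff_P Oy) (differentiableP (da Oy)).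
by have [_ dE] := H; exact: (congr1 (@^~ e) dE).
Qed.

Lemma second_form_kills y (k : 'rV[C]_(2 + 2)) e : O y -> k *m P y = 0 ->
  k *m 'd P y e *m a y = 0.
Proof.
move=> Oy kP; have := congr1 (mulmx k) (central_charge e Oy).
rewrite mulmxDr !mulmxA kP !mul0mx addr0 => ->.
by [].
Qed.

Lemma period_projector y0 : O y0 -> exists (pr : V -> 'M[C]_(2 + 2)) (K : 'M[C]_(2, 2 + 2)),
  \forall y \near y0, [/\ O y, differentiable pr y, pr y *m P y = 0,
    (forall k : 'rV[C]_(2 + 2), k *m P y = 0 -> k *m pr y = k) &
    is_diff y (fun z => invmx (K *m P z)) ('d (fun z => invmx (K *m P z)) y) /\
    pr y = 1%:M - P y *m invmx (K *m P y) *m K].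
Proof.
move=> Oy0; have [K KP] := period_left_inverse (P_period Oy0).
exists (fun y => 1%:M - P y *m invmx (K *m P y) *m K), K.
have dK y : O y -> is_diff y (fun z => K *m P z) (fun h => K *m 'd P y h).
  move=> Oy; have H := is_diff_mulmx (is_diff_cst K y) (is_diff_P Oy).
  suff -> : (fun h => K *m 'd P y h) = (fun h : V => (0 : V -> 'M[C]_(2, 2 + 2)) h *m P y + K *m 'd P y h) by exact: H.
  by apply/funext => h; rewrite mul0mx add0r.
have Ku0 : K *m P y0 \in unitmx by rewrite KP unitmx1.
have nB : \forall y \near y0, K *m P y \in unitmx by apply: unitmx_near => //; case: (dK _ Oy0).
near=> y.
have Oy : O y by near: y; exact: O_near.
have Ku : K *m P y \in unitmx by near: y; exact: nB.
have dX := inv_is_diff (dK _ Oy) Ku.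
split; first exact: Oy.
- have H := is_diff_mulmx (is_diff_mulmx (is_diff_P Oy) dX) (is_diff_cst K y).
  have [d _] := is_diffB (is_diff_cst (1%:M : 'M[C]_(2 + 2)) y) H.
  exact: d.
- by rewrite mulmxBl mul1mx -!mulmxA mulVmx// mulmx1 subrr.
- by move=> k kP; rewrite mulmxBr mulmx1 !mulmxA kP !mul0mx subr0.
- by split; [apply: differentiableP; case: dX|].
Unshelve. all: by end_near. Qed.

Definition curved y := exists (k : 'rV[C]_(2 + 2)) (e : V),
  k *m P y = 0 /\ k *m 'd P y e != 0.

Lemma curved_near y0 : O y0 -> curved y0 -> \forall y \near y0, O y /\ curved y.
Proof.
move=> Oy0 [k [e [kP ke]]]; have [pr [K prP]] := period_projector Oy0.
have [_ dpr _ /(_ k kP) kpr _] := nbhs_singleton prP.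
pose f y := k *m pr y *m 'd P y e.
have fc : {for y0, continuous f}.
  have dd : differentiable (fun y => 'd P y e) y0.
    apply: differentiable_derivative; apply: filterS (O_near Oy0) => y Oy.
    exact: dP.
  have H := is_diff_mulmx (is_diff_mulmx (is_diff_cst k y0) (differentiableP dpr))
     (differentiableP dd).
  exact: (is_diff_cont H).
have f0 : f y0 != 0 by rewrite /f kpr.
have n0 : 0 < nm (f y0) / 2 by rewrite divr_gt0// nm_gt0.
move/continuous_nm: fc => /(_ _ n0)[c c0 cP].
have nc : \forall y \near y0, f y != 0.
  apply/nbhs_nm; exists c; first exact: c0.
  move=> y /cP fy; apply/eqP => fy0; rewrite fy0 sub0r nmN in fy.
  by move: fy; rewrite leNgt ltr_pdivrMr// ltr_pMr ?ltr1n// nm_gt0 f0.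
apply: filterS2 prP nc => y [Oy _ prPy _ _] fy; split=> //.
exists (k *m pr y), e; split; last exact: fy.
by rewrite -mulmxA prPy mulmx0.
Qed.

Section Automorphism.
Variable N : 'M[C]_(2 + 2).
Hypothesis NP : forall y, O y -> exists D, N *m P y = P y *m D.

Lemma second_form_automorphism y0 (k : 'rV[C]_(2 + 2)) : O y0 ->
  exists2 D, N *m P y0 = P y0 *m D &
    forall e, k *m P y0 = 0 -> k *m N *m 'd P y0 e = k *m 'd P y0 e *m D.
Proof.
move=> Oy0; have [pr [K prP]] := period_projector Oy0.
pose D y := invmx (K *m P y) *m (K *m N *m P y).
have NPD : \forall y \near y0, N *m P y = P y *m D y.
  apply: filterS prP => y [Oy _ prPy _ [_ prE]].
  have [E NE] := NP Oy; have : pr y *m (N *m P y) = 0.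
    by rewrite NE mulmxA prPy mul0mx.
  rewrite prE mulmxBl mul1mx => /eqP; rewrite subr_eq0 => /eqP {1}->.
  by rewrite /D !mulmxA.
have [_ _ _ _ [dX _]] := nbhs_singleton prP.
have dPy := is_diff_P Oy0.
exists (D y0); first exact: nbhs_singleton NPD.
move=> e kP.
have H1 := is_diff_mulmx (is_diff_cst N y0) dPy.
have H2 := is_diff_mulmx dPy (is_diff_mulmx dX (is_diff_mulmx (is_diff_cst (K *m N) y0) dPy)).
have H1' := is_diff_near NPD H1.
have E := congr1 (fun f => f e) (is_diff_unique H1' H2).
have [S {}E] : exists S, N *m 'd P y0 e = 'd P y0 e *m D y0 + P y0 *m S.
  eexists; apply: etrans E.
  by rewrite (_ : 0 e = (0 : 'M[C]_(2 + 2))) ?mul0mx ?add0r.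
by rewrite -mulmxA E mulmxDr (mulmxA k (P y0)) kP mul0mx addr0 mulmxA.
Qed.

Lemma central_charge_eigen y : O y -> curved y ->
  exists nu, N *m (P y *m a y) = nu *: (P y *m a y).
Proof.
move=> Oy [k [e [kP ke]]].
have [D ND /(_ e kP) kN] := second_form_automorphism k Oy.
have kNP : k *m N *m P y = 0 by rewrite -mulmxA ND mulmxA kP mul0mx.
have va := second_form_kills e Oy kP.
have := second_form_kills e Oy kNP; rewrite kN -mulmxA => vDa.
have [a0|a0] := eqVneq (a y) 0.
  by exists 0; rewrite a0 !mulmx0 scaler0.
have [nu nuE] := colinear ke va vDa a0.
by exists nu; rewrite mulmxA ND -mulmxA nuE scalemxAr.
Qed.

Lemma mulmx_trmx_eq0 m n (M : 'M[C]_(m, n)) :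
  (forall e : 'rV[C]_n, M *m e^T = 0) -> M = 0.
Proof.
move=> M0; apply/matrixP => i j.
have := M0 (delta_mx 0 j); rewrite trmx_delta -colE => /matrixP/(_ i 0).
by rewrite !mxE.
Qed.

Lemma root_isolated (p : {poly C}) (z : C) : p != 0 ->
  exists2 r : R, 0 < r & forall w, nm (w - z) <= r -> root p w -> w = z.
Proof.
move=> p0; have [s pE] := closed_field_poly_normal p.
have [|r r0 rP] := @exists_punctured R (nm z + 1) s z.
  by split; apply: (@le_lt_trans _ _ (nm z)); rewrite ?re_le_nm ?im_le_nm ?ltrDl.
exists r => // w wr; rewrite pE rootZ ?lead_coef_eq0// root_prod_XsubC => ws.
apply/eqP/negPn/negP => wz; have [|_] := rP w; last by rewrite ws.
by rewrite wr andbT nm_gt0 subr_eq0.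
Qed.

Hypothesis N_real : conjCmx N = N.
Hypothesis N_nonscalar : forall nu, N <> nu%:M.

Lemma central_charge_nonzero (U : set V) y0 : O y0 -> nbhs y0 U ->
  exists y, [/\ U y, nbhs y U & P y *m a y != 0].
Proof.
move=> Oy0 U0; apply: contrapT => H.
have Z0 : \forall y \near y0, (cst 0 : V -> 'cV[C]_(2 + 2)) y = P y *m a y.
  have := nbhs_interior U0; apply: filterS => y yU; apply/esym/eqP/negPn/negP => Zy.
  by apply: H; exists y; split=> //; exact: nbhs_singleton yU.
have H1 := is_diff_near Z0 (is_diff_cst (0 : 'cV[C]_(2 + 2)) y0).
have E (e : V) : P y0 *m A y0 *m e^T = 0.
  rewrite -dZ//; case: H1 => _ dE.
  exact: (congr1 (@^~ e) dE).
have PA := mulmx_trmx_eq0 E.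
have P0 : P y0 = 0.
  by rewrite -[P y0]mulmx1 -(mulmxV (A_unit Oy0)) mulmxA PA mul0mx.
have [K] := period_left_inverse (P_period Oy0); rewrite P0 mulmx0.
by move=> /matrixP/(_ 0 0)/eqP; rewrite !mxE eqxx eq_sym oner_eq0.
Qed.

Theorem automorphism_not_curved y0 : O y0 -> ~ curved y0.
Proof.
move=> Oy0 cy0; have U0 := curved_near Oy0 cy0.
have [y1 [[Oy1 cy1] U1 Z1]] := central_charge_nonzero Oy0 U0.
pose Z y := P y *m a y.
have dZy y : O y -> is_diff y Z ('d Z y).
  move=> Oy; apply: differentiableP.
  by have [] := is_diff_mulmx (is_diff_P Oy) (differentiableP (da Oy)).
have [i Zi] : exists i, Z y1 i 0 != 0.
  apply: contrapT => H; move/eqP: Z1; apply; apply/matrixP => i j.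
  rewrite ord1 [RHS]mxE; apply/eqP/negPn/negP => Zi; apply: H; exists i; exact: Zi.
pose g y := Z y i 0; pose f y := (N *m Z y) i 0.
have dg : differentiable g y1 by have [] := is_diff_coord i 0 (dZy _ Oy1).
have df : differentiable f y1.
  by have [] := is_diff_coord i 0 (is_diff_mulmx (is_diff_cst N y1) (dZy _ Oy1)).
have gc : {for y1, continuous g} by exact: differentiable_continuous.
have fc : {for y1, continuous f} by exact: differentiable_continuous.
have nuc := continuous_quotient fc gc Zi.
pose nu0 := f y1 / g y1.
have chi0 : char_poly N^T != 0 by rewrite monic_neq0 ?char_poly_monic.
have [r r0 rP] := root_isolated nu0 chi0.
move/continuous_nm: nuc => /(_ _ r0)[c c0 cP].
have g0 : 0 < nm (g y1) / 2 by rewrite divr_gt0// nm_gt0.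
move/continuous_nm: gc => /(_ _ g0)[c' c'0 c'P].
have gn : \forall y \near y1, g y != 0.
  apply/nbhs_nm; exists c'; first exact: c'0.
  move=> y /c'P gy; apply/eqP => gy0; rewrite gy0 sub0r nmN in gy.
  by move: gy; rewrite leNgt ltr_pdivrMr// ltr_pMr ?ltr1n// nm_gt0 Zi.
have fg : \forall y \near y1, nm (f y / g y - nu0) <= r.
  by apply/nbhs_nm; exists c; [exact: c0|exact: cP].
have NZ : \forall y \near y1, N *m Z y = nu0 *: Z y.
  near=> y.
  have [Oy cy] : O y /\ curved y by near: y; exact: U1.
  have gy : g y != 0 by near: y; exact: gn.
  have fgy : nm (f y / g y - nu0) <= r by near: y; exact: fg.
  have [nu nuE] := central_charge_eigen Oy cy.
  suff nuN : nu = nu0 by rewrite -nuN -nuE.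
  have fE : f y / g y = nu by rewrite /f /Z nuE mxE mulfK.
  apply: rP; first by rewrite -fE.
  rewrite -eigenvalue_root_char; apply/eigenvalueP; exists (Z y)^T.
    by rewrite -trmx_mul nuE linearZ.
  rewrite trmx_eq0; apply: contra_neq gy => Zy0.
  by rewrite /g Zy0 mxE.
have NPy : \forall y \near y1, N *m P y = nu0 *: P y.
  have := nbhs_interior NZ; have := nbhs_interior U1.
  apply: filterS2 => y Uy NZy; have [Oy _] := nbhs_singleton Uy.
  have H1 := is_diff_near NZy (is_diff_mulmx (is_diff_cst N y) (dZy _ Oy)).
  have H2 := is_diffZ nu0 (dZy _ Oy).
  have E := is_diff_unique H1 H2.
  have dE (e : V) : N *m (P y *m A y *m e^T) = nu0 *: (P y *m A y *m e^T).
    have dZe : 'd Z y e = P y *m A y *m e^T by exact: dZ.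
    rewrite -dZe; apply: etrans (congr1 (@^~ e) E).
    by rewrite (_ : 0 e = (0 : 'M[C]_(2 + 2))) ?mul0mx ?add0r.
  have NPA : N *m (P y *m A y) - nu0 *: (P y *m A y) = 0.
    apply: mulmx_trmx_eq0 => e.
    by rewrite mulmxBl -mulmxA dE scalemxAl subrr.
  apply/eqP; rewrite -subr_eq0; apply/eqP.
  rewrite -[LHS]mulmx1 -(mulmxV (A_unit Oy)) mulmxA mulmxBl.
  by rewrite -mulmxA -scalemxAl NPA mul0mx.
have NP1 := nbhs_singleton NPy.
have NPc : N *m conjCmx (P y1) = conjC nu0 *: conjCmx (P y1).
  by rewrite -{1}N_real -conjCmx_mul NP1 conjCmxZ.
have [nuR|nuC] := eqVneq nu0 (conjC nu0).
  apply: (N_nonscalar (nu := nu0)).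
  have Qu := period_unit (P_period Oy1).
  rewrite -[LHS]mulmx1 -(mulmxV Qu) mulmxA mul_mx_row NP1 NPc -nuR.
  by rewrite -scale_row_mx -scalemxAl mulmxV// scalemx1.
have [k [e [kP ke]]] := cy1; move/eqP: ke; apply.
have dNP : N *m 'd P y1 e = nu0 *: 'd P y1 e.
  have H1 := is_diff_near NPy (is_diff_mulmx (is_diff_cst N y1) (is_diff_P Oy1)).
  have H2 := is_diffZ nu0 (is_diff_P Oy1).
  apply: etrans (congr1 (@^~ e) (is_diff_unique H1 H2)).
  by rewrite (_ : 0 e = (0 : 'M[C]_(2 + 2))) ?mul0mx ?add0r.
apply/matrixP => i' j; rewrite [RHS]mxE.
have -> : (k *m 'd P y1 e) i' j = (k *m col j ('d P y1 e)) i' 0.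
  by rewrite [LHS]mxE [RHS]mxE; apply: eq_bigr => l _; rewrite [in RHS]mxE.
set q := col j _.
have Nq : N *m q = nu0 *: q by rewrite /q colE mulmxA dNP scalemxAl.
have [al [be qE]] := period_span (P_period Oy1) q.
have be0 : conjCmx (P y1) *m be = 0.
  have : (conjC nu0 - nu0) *: (conjCmx (P y1) *m be) = 0.
    move: Nq; rewrite qE mulmxDr !mulmxA NP1 NPc -!scalemxAl scalerDr scalerBl.
    by move=> /addrI ->; rewrite subrr.
  move=> /eqP; rewrite scaler_eq0 subr_eq0 eq_sym (negPf nuC) => /eqP.
  exact.
by rewrite qE be0 addr0 mulmxA kP mul0mx mxE.
Unshelve. all: by end_near. Qed.

End Automorphism.
End SpecialCoordinates.

(** * Baire's theorem over the complex numbers *)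

Section BaireComplex.
Variable R : realType.
Local Notation C := (Cplx R).
Local Notation re := (@complex.Re R).
Local Notation im := (@complex.Im R).

Lemma norm_coord m n (A : 'M[R]_(m, n)) i j : `|A i j| <= `|A|.
Proof.
rewrite {2}/Num.Def.normr /= mx_normE -[leLHS]nngE num_le.
exact: (le_bigmax _ (fun x => (`|A x.1 x.2|)%:nng) (i, j)).
Qed.

Lemma norm_mx_le m n (A : 'M[R]_(m, n)) (e : R) : 0 <= e ->
  (forall i j, `|A i j| <= e) -> `|A| <= e.
Proof.
move=> e0 H.
have [->|A0] := eqVneq A 0; first by rewrite normr0.
have : mx_norm A != 0 by apply: contra_neq A0; exact: mx_norm_eq0.
move=> /mx_norm_neq0[[i j] /= E].
by have -> : `|A| = `|A i j| by exact: E.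
Qed.

Definition to_complex n (x : 'rV[R]_(n + n)) : 'rV[C]_n :=
  \row_j (Complex (x 0 (lshift n j)) (x 0 (rshift n j)) : C).

Definition of_complex n (z : 'rV[C]_n) : 'rV[R]_(n + n) :=
  row_mx (map_mx re z) (map_mx im z).

Lemma of_complexK n : cancel (@of_complex n) (@to_complex n).
Proof.
move=> z; apply/rowP => j; rewrite mxE row_mxEl row_mxEr !mxE.
exact: Cplx_eq.
Qed.

Lemma to_complexK n : cancel (@to_complex n) (@of_complex n).
Proof.
move=> x; rewrite -[RHS]hsubmxK /of_complex; congr row_mx.
  by apply/rowP => j; rewrite !mxE.
by apply/rowP => j; rewrite !mxE.
Qed.

Lemma to_complex_continuous n (x : 'rV[R]_(n + n)) (A : set 'rV[C]_n) :
  nbhs (to_complex x) A -> nbhs x (@to_complex n @^-1` A).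
Proof.
move=> /nbhs_nm[e e0 eA].
apply/(@nbhs_ballP R 'rV[R]_(n + n)); exists (e / 2); first by rewrite /= divr_gt0.
move=> y; rewrite -ball_normE /ball_ /= => xy; apply: eA.
apply: nm_mx_le; first exact: ltW.
move=> i j; apply: (le_trans (nm_le_reim _)).
rewrite !mxE reD imD reN imN /=.
have := norm_coord (x - y) 0 (lshift n j); have := norm_coord (x - y) 0 (rshift n j).
rewrite !mxE !(distrC (x _ _)); move: xy; move: `|x - y| => t; lra.
Qed.

Lemma of_complex_continuous n (z : 'rV[C]_n) (A : set 'rV[R]_(n + n)) :
  nbhs (of_complex z) A -> nbhs z (@of_complex n @^-1` A).
Proof.
move=> /(@nbhs_ballP R 'rV[R]_(n + n))[e /= e0 eA].
apply/nbhs_nm; exists (e / 2); first by rewrite divr_gt0.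
move=> w zw; apply: eA; rewrite -ball_normE /ball_ /=.
apply: (@le_lt_trans _ _ (e / 2)); last by rewrite ltr_pdivrMr// ltr_pMr// ltr1n.
apply: norm_mx_le; first by rewrite divr_ge0// ltW.
have H k : nm (z 0 k - w 0 k) <= e / 2.
  have := nm_coord (z - w) 0 k; rewrite !mxE => /le_trans; apply.
  by rewrite nm_distC.
move=> i j; rewrite ord1; case: (splitP j) => k jE.
  rewrite (_ : j = lshift n k); last exact/val_inj.
  rewrite /of_complex [X in `|X|]mxE [X in _ + X]mxE !row_mxEl !mxE -reN -reD; exact: le_trans (re_le_nm _) (H k).
rewrite (_ : j = rshift n k); last exact/val_inj.
rewrite /of_complex [X in `|X|]mxE [X in _ + X]mxE !row_mxEr !mxE -imN -imD; exact: le_trans (im_le_nm _) (H k).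
Qed.

Theorem baire_complex n (O : set 'rV[C]_n.+1) (F : nat -> set 'rV[C]_n.+1) :
  open O -> O !=set0 ->
  (forall i y, O y -> ~ F i y -> \forall z \near y, ~ F i z) ->
  (forall y, O y -> exists i, F i y) ->
  exists i y, O y /\ \forall z \near y, F i z.
Proof.
move=> Oo [y0 Oy0] Fc cov; apply: contrapT => noF.
have /nbhs_nm[c c0 cO] : nbhs y0 O by apply: open_nbhs_nbhs; split.
pose X := 'rV[R]_(n.+1 + n.+1).
pose G i : set X := [set x | ~ (nm (to_complex x - y0) <= c / 2 /\ F i (to_complex x))].
have Go i : open (G i).
  rewrite openE => x Gx; rewrite /interior.
  suff : nbhs (to_complex x) [set z | ~ (nm (z - y0) <= c / 2 /\ F i z)].
    by move=> /to_complex_continuous.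
  case: (leP (nm (to_complex x - y0)) (c / 2)) => hx.
    have Ox : O (to_complex x) by apply: cO; lra.
    have nF : ~ F i (to_complex x) by move=> Fx; apply: Gx.
    by apply: filterS (Fc _ _ Ox nF) => z nFz [_].
  apply/nbhs_nm; exists ((nm (to_complex x - y0) - c / 2) / 2).
    by rewrite divr_gt0// subr_gt0.
  move=> z zx [zy _]; have := nmD (to_complex x - z) (z - y0).
  by rewrite addrA subrK nm_distC in zx *; lra.
have Gd i : dense (G i).
  move=> W [x Wx] Wo; apply: contrapT => WG; apply: noF.
  have sub x' : W x' -> nm (to_complex x' - y0) <= c / 2 /\ F i (to_complex x').
    by move=> Wx'; apply: contrapT => nx'; apply: WG; exists x'; split.
  exists i, (to_complex x); split; first by apply: cO; have [] := sub _ Wx; lra.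
  have : nbhs (of_complex (to_complex x)) W.
    by rewrite to_complexK; apply: open_nbhs_nbhs; split.
  move=> /of_complex_continuous; apply: filterS => z /= /sub[_].
  by rewrite of_complexK.
pose XX : completeNormedModType R := HB.pack X (Complete.on X).
have [|||x [xB xG]] := @Baire R XX G _ [set x | nm (to_complex x - y0) < c / 2].
- by move=> i; split; [exact: Go|exact: Gd].
- by exists (of_complex y0); rewrite /= of_complexK subrr nm0 divr_gt0.
- rewrite openE => x /= xB; rewrite /interior.
  suff : nbhs (to_complex x) [set z | nm (z - y0) < c / 2].
    by move=> /to_complex_continuous.
  apply/nbhs_nm; exists ((c / 2 - nm (to_complex x - y0)) / 2).
    by rewrite divr_gt0// subr_gt0.
  move=> z zx /=; have := nmD (z - to_complex x) (to_complex x - y0).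
  by rewrite addrA subrK; move: xB; rewrite /mkset; lra.
have [i Fi] : exists i, F i (to_complex x).
  by apply: cov; apply: cO; move: xB; rewrite /mkset /=; lra.
by apply: (xG i) => //; split; [exact: ltW|].
Qed.

End BaireComplex.

(** * The Liouville form of a scaled symplectic form *)

Section Slices.
Variables (K : numFieldType) (V1 V2 W : normedModType K).

Lemma is_diff_slice1 (f : V1 * V2 -> W) df (p : V1 * V2) : is_diff p f df ->
  is_diff (p.1) (fun x => f (x, p.2)) (fun h => df (h, 0)).
Proof.
case: p => p1 p2 fd.
have H : is_diff p1 (fun x : V1 => (x, p2)) (fun h : V1 => (h, 0 : V2)).
  exact: (is_diff_pair (is_diff_id p1) (is_diff_cst p2 p1)).
exact: (is_diff_comp H fd).
Qed.

Lemma is_diff_slice2 (f : V1 * V2 -> W) df (p : V1 * V2) : is_diff p f df ->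
  is_diff (p.2) (fun x => f (p.1, x)) (fun h => df (0, h)).
Proof.
case: p => p1 p2 fd.
have H : is_diff p2 (fun x : V2 => (p1, x)) (fun h : V2 => (0 : V1, h)).
  exact: (is_diff_pair (is_diff_cst p1 p2) (is_diff_id p2)).
exact: (is_diff_comp H fd).
Qed.

Lemma is_diff_trmx m n (F dF : V1 -> 'M[K]_(m, n)) x : is_diff x F dF ->
  is_diff x (fun y => (F y)^T) (fun h => (dF h)^T).
Proof.
move=> Fd; apply: is_diff_mx => i j.
have -> : (fun y => (F y)^T i j) = (fun y => F y j i).
  by apply/funext => y; rewrite mxE.
have -> : (fun y => (dF y)^T i j) = (fun y => dF y j i).
  by apply/funext => y; rewrite mxE.
exact: is_diff_coord.
Qed.

Lemma is_diff_mulmxl m n p (A : 'M[K]_(m, n)) (G dG : V1 -> 'M[K]_(n, p)) x :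
  is_diff x G dG -> is_diff x (fun y => A *m G y) (fun h => A *m dG h).
Proof.
move=> Gd; have H := is_diff_mulmx (is_diff_cst A x) Gd.
suff -> : (fun h => A *m dG h) =
  (fun h => (0 : V1 -> 'M[K]_(m, n)) h *m G x + A *m dG h) by exact: H.
by apply/funext => h; rewrite mul0mx add0r.
Qed.

Lemma is_diff_mulmxr m n p (A : 'M[K]_(n, p)) (G dG : V1 -> 'M[K]_(m, n)) x :
  is_diff x G dG -> is_diff x (fun y => G y *m A) (fun h => dG h *m A).
Proof.
move=> Gd; have H := is_diff_mulmx Gd (is_diff_cst A x).
suff -> : (fun h => dG h *m A) =
  (fun h => dG h *m A + G x *m (0 : V1 -> 'M[K]_(n, p)) h) by exact: H.
by apply/funext => h; rewrite mulmx0 addr0.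
Qed.

Lemma is_diffE (f df : V1 -> W) x h : is_diff x f df -> 'd f x h = df h.
Proof. by case=> _ <-. Qed.

Lemma is_diff_congr (f g df dg : V1 -> W) x : is_diff x f df -> f = g ->
  df = dg -> is_diff x g dg.
Proof. by move=> ? <- <-. Qed.

End Slices.

Lemma cyclic_sum (K : comNzRingType) n (S : 'I_n -> 'I_n -> 'I_n -> K)
    (u v w : 'I_n -> K) :
  (forall i j k, S i j k + S j k i + S k i j = 0) ->
  \sum_i \sum_j \sum_k u i * (v j * (w k * S i j k)) +
  \sum_i \sum_j \sum_k v i * (w j * (u k * S i j k)) +
  \sum_i \sum_j \sum_k w i * (u j * (v k * S i j k)) = 0.
Proof.
move=> S0.
have -> : \sum_i \sum_j \sum_k v i * (w j * (u k * S i j k)) =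
  \sum_i \sum_j \sum_k u i * (v j * (w k * S j k i)).
  under eq_bigr do rewrite exchange_big /=.
  rewrite exchange_big /=; apply: eq_bigr => a _; apply: eq_bigr => b _.
  by apply: eq_bigr => c _; ring.
have -> : \sum_i \sum_j \sum_k w i * (u j * (v k * S i j k)) =
  \sum_i \sum_j \sum_k u i * (v j * (w k * S k i j)).
  rewrite exchange_big /=; apply: eq_bigr => a _.
  rewrite exchange_big /=; apply: eq_bigr => b _.
  by apply: eq_bigr => c _; ring.
rewrite -!big_split big1//= => a _; rewrite -!big_split big1//= => b _.
by rewrite -!big_split big1//= => c _; rewrite -!mulrDr S0 !mulr0.
Qed.

Section PairingAlgebra.
Variables (K : comNzRingType) (n : nat).
Implicit Types (a b v w : 'rV[K]_n) (A L : 'M[K]_n).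

Lemma trmx11 (X : 'M[K]_1) : X^T = X.
Proof. by apply/matrixP => i j; rewrite mxE !ord1. Qed.

Lemma pairing_transpose a b v w A L :
  (a *m A *m v^T) 0 0 = (b *m L *m w^T) 0 0 -> v *m (a *m A)^T = w *m (b *m L)^T.
Proof.
move=> E; rewrite -[LHS]trmx11 -[RHS]trmx11 !trmx_mul !trmxK.
by apply/matrixP => i j; rewrite !ord1.
Qed.

Lemma expand_scaling a b v w A L (X : 'M[K]_1) :
  (a *m A + b *m L) *m v^T + b *m A *m w^T = 1 *: X ->
  a *m A *m v^T + b *m L *m v^T + b *m A *m w^T = X.
Proof. by rewrite mulmxDl scale1r. Qed.

Lemma pairing_skew a b A : A^T = - A -> a *m A *m b^T = - (b *m A *m a^T).
Proof. by move=> AT; rewrite -[LHS]trmx11 !trmx_mul trmxK AT mulNmx mulmxN mulmxA. Qed.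

Lemma cartan_algebra (E v w dEv dEw : 'rV[K]_n) (L dLE dLv dLw : 'M[K]_n) :
  L^T = - L -> dLv^T = - dLv ->
  v *m dLE *m w^T + w *m dLv *m E^T + E *m dLw *m v^T = 0 ->
  dEv *m L *m w^T + v *m dLE *m w^T + v *m L *m dEw^T = v *m L *m w^T ->
  w *m (dEv *m L + E *m dLv)^T - v *m (dEw *m L + E *m dLw)^T = v *m L *m w^T.
Proof.
move=> sL sv; have sw (a b : 'rV[K]_n) : a *m b^T = b *m a^T.
  by rewrite -[LHS]trmx11 trmx_mul trmxK.
rewrite (sw w) (sw v) !mulmxDl (pairing_skew w E sv) => /eqP.
rewrite addr_eq0 subr_eq => /eqP -> <-.
by rewrite (pairing_skew v dEw sL) [- _ + E *m _ *m _]addrC opprD !addrA [LHS]addrAC.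
Qed.

End PairingAlgebra.

Section LiouvilleForm.
Variables (R : realType) (n : nat) (N : cmanifold R n).
Local Notation C := (Cplx R).
Local Notation V := 'rV[C]_n.
Variables (L : symplectic_form N) (D : set (C * N)) (act : C -> N -> N).
Hypothesis action : local_action D act.
Hypothesis scaling : forall l x c d, D (l, x) -> chart_at x c ->
  chart_at (act l x) d ->
  let T := 'd (cfun d \o act l \o cinv c) (cfun c x) in
  forall v w, bil (L d (cfun d (act l x))) (T v) (T w)
              = l * bil (L c (cfun c x)) v w.

Definition flow (d : chart R N n) (q : C * V) : V := cfun d (act q.1 (cinv d q.2)).

Lemma chart_at_cinv (d : chart R N n) y : atlas d -> ccod d y -> chart_at (cinv d y) d.
Proof. by move=> ad dy; split=> //; exact: cinv_dom. Qed.

Lemma ccod_near (d : chart R N n) y : ccod d y -> \forall z \near y, ccod d z.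
Proof. by move=> dy; apply: open_nbhs_nbhs; split=> //; exact: open_ccod. Qed.

Lemma cdom_near (d : chart R N n) x : cdom d x -> \forall z \near x, cdom d z.
Proof. by move=> dy; apply: open_nbhs_nbhs; split=> //; exact: open_cdom. Qed.

Lemma near_snd (T1 T2 : topologicalType) (x : T1) (y : T2) (Q : set T2) :
  nbhs y Q -> \forall q \near ((x, y) : T1 * T2), Q q.2.
Proof. by move=> Qy; exists (setT, Q); [split=> //; exact: filterT|case=> a b []]. Qed.

Lemma near_fst (T1 T2 : topologicalType) (x : T1) (y : T2) (Q : set T1) :
  nbhs x Q -> \forall q \near ((x, y) : T1 * T2), Q q.1.
Proof. by move=> Qy; exists (Q, setT); [split=> //; exact: filterT|case=> a b []]. Qed.

Lemma flow_domain d y : atlas d -> ccod d y ->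
  \forall q \near ((1, y) : C * V), [/\ ccod d q.2, D (q.1, cinv d q.2) &
    chart_at (act q.1 (cinv d q.2)) d].
Proof.
move=> ad dy; have xd := chart_at_cinv ad dy.
have [U [e [Ux [e0 UP]]]] := act_near1 action (cinv d y).
have nU : \forall q \near ((1, y) : C * V), U (cinv d q.2).
  apply: (near_snd (1 : C) (Q := fun z => U (cinv d z))).
  exact: (cinv_continuous dy Ux).
have n1 : \forall q \near ((1, y) : C * V), `|q.1 - 1| < (real_complex R e : C).
  apply: (near_fst y (Q := fun l : C => `|l - 1| < (real_complex R e : C))).
  apply/nbhs_nm; exists (e / 2); first by rewrite divr_gt0.
  move=> l /le_lt_trans le; rewrite nmE ltcC; apply: le.
  by rewrite ltr_pdivrMr// ltr_pMr// ltr1n.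
have D1 : D (1, cinv d y).
  apply: UP (nbhs_singleton Ux); by rewrite subrr normr0 ltcC.
have [cont _] := act_hol action D1 xd.
rewrite cinvK// in cont.
have nd : \forall q \near ((1, y) : C * V), cdom d (act q.1 (cinv d q.2)).
  apply: cont; rewrite /= (act1 action); apply: cdom_near; exact: xd.2.
near=> q; split.
- by near: q; apply: (near_snd (1 : C) (Q := ccod d)); exact: ccod_near.
- by apply: UP; near: q.
- by split=> //; near: q.
Unshelve. all: by end_near. Qed.

Lemma flow_differentiable d y : atlas d -> ccod d y ->
  \forall q \near ((1, y) : C * V), differentiable (flow d) q.
Proof.
move=> ad dy; apply: filterS (flow_domain ad dy) => -[l z] /= [dz Dl cl].
have [_ /(_ d)] := act_hol action Dl (chart_at_cinv ad dz).
by rewrite /= cinvK//; apply.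
Qed.

Lemma flow1 d y : ccod d y -> flow d (1, y) = y.
Proof. by move=> dy; rewrite /flow /= (act1 action) cinvK. Qed.

Definition euler (d : chart R N n) (y : V) : V :=
  'd (flow d) ((1, y) : C * V) ((1, 0) : C * V).

Definition liouville_form (d : chart R N n) (y : V) : 'cV[C]_n :=
  (euler d y *m L d y)^T.

Lemma flow_d2 (d : chart R N n) (y v : V) : atlas d -> ccod d y -> 'd (flow d) ((1, y) : C * V) ((0, v) : C * V) = v.
Proof.
move=> ad dy; have dd := nbhs_singleton (flow_differentiable ad dy).
have H := is_diff_slice2 (differentiableP dd).
have E : \forall z \near y, (fun x => flow d (1, x)) z = id z.
  by apply: filterS (ccod_near dy) => z dz; rewrite flow1.
have H2 := is_diff_near E H.
by have := congr1 (@^~ v) (is_diff_unique H2 (is_diff_id y)).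
Qed.

Lemma form_diff d y : atlas d -> ccod d y -> is_diff y (L d) ('d (L d) y).
Proof. by move=> ad dy; apply: differentiableP; exact: form_hol. Qed.

Lemma dform_entry d y u i j k : atlas d -> ccod d y -> u = delta_mx 0 i ->
  'd (L d) y u j k = 'D_(delta_mx 0 i) (fun z => L d z j k) y.
Proof.
move=> ad dy ->; have H := is_diff_coord j k (form_diff ad dy).
by have [H1 H2] := H; rewrite deriveE// H2.
Qed.

Lemma bilinear_sum (A : 'M[C]_n) (v w : V) :
  (v *m A *m w^T) 0 0 = \sum_j \sum_k v 0 j * (w 0 k * A j k).
Proof.
rewrite mxE exchange_big /=; apply: eq_bigr => k _.
rewrite mxE big_distrl /=; apply: eq_bigr => j _.
by rewrite !mxE; ring.
Qed.

Lemma dform_sum d y (u v w : V) : atlas d -> ccod d y ->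
  (v *m 'd (L d) y u *m w^T) 0 0 = \sum_i \sum_j \sum_k
    u 0 i * (v 0 j * (w 0 k * 'D_(delta_mx 0 i) (fun z => L d z j k) y)).
Proof.
move=> ad dy.
have -> : 'd (L d) y u = \sum_i u 0 i *: 'd (L d) y (delta_mx 0 i).
  rewrite {1}[u]row_sum_delta linear_sum; apply: eq_bigr => i _.
  by rewrite linearZ.
rewrite mulmx_sumr mulmx_suml summxE; apply: eq_bigr => i _.
rewrite -scalemxAr -scalemxAl mxE bilinear_sum big_distrr /=.
apply: eq_bigr => j _; rewrite big_distrr /=; apply: eq_bigr => k _.
by rewrite (dform_entry j k ad dy (erefl _)).
Qed.

Lemma form_closed3 d y (u v w : V) : atlas d -> ccod d y ->
  v *m 'd (L d) y u *m w^T + w *m 'd (L d) y v *m u^T + u *m 'd (L d) y w *m v^T = 0.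
Proof.
move=> ad dy; apply/matrixP => i' j'; rewrite !ord1 [RHS]mxE [LHS]mxE [X in X + _]mxE.
rewrite !dform_sum//.
apply: (@cyclic_sum _ _ (fun i j k => 'D_(delta_mx 0 i) (fun z => L d z j k) y)
  (u 0) (v 0) (w 0)) => a b c.
exact: (form_closed L ad dy).
Qed.

Lemma dform_skew d y u : atlas d -> ccod d y -> ('d (L d) y u)^T = - 'd (L d) y u.
Proof.
move=> ad dy; have H := form_diff ad dy.
have E : \forall z \near y, (L d z)^T = (- (L d : V -> 'M[C]_n)) z.
  by apply: filterS (ccod_near dy) => z dz; exact: form_skew.
have H1 := is_diff_near E (is_diff_trmx H).
exact: (congr1 (@^~ u) (is_diff_unique H1 (is_diffN H))).
Qed.

Lemma euler_is_diff d y : atlas d -> ccod d y ->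
  is_diff y (euler d) (fun v => 'd (fun q => 'd (flow d) q ((1, 0) : C * V))
    ((1, y) : C * V) ((0, v) : C * V)).
Proof.
move=> ad dy.
have H := differentiable_derivative ((1, 0) : C * V) (flow_differentiable ad dy).
exact: (is_diff_slice2 (differentiableP H)).
Qed.

Lemma euler_sym d y v : atlas d -> ccod d y -> 'd (euler d) y v =
  'd (fun q => 'd (flow d) q ((0, v) : C * V)) ((1, y) : C * V) ((1, 0) : C * V).
Proof.
move=> ad dy; apply: etrans (is_diffE v (euler_is_diff ad dy)) _.
exact: (derivative_sym_mx _ _ (flow_differentiable ad dy)).
Qed.

Lemma flow_scaling d y v w : atlas d -> ccod d y ->
  \forall q \near ((1, y) : C * V),
    'd (flow d) q ((0, v) : C * V) *m L d (flow d q) *m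
      ('d (flow d) q ((0, w) : C * V))^T = q.1 *: (v *m L d q.2 *m w^T).
Proof.
move=> ad dy.
apply: filterS2 (flow_domain ad dy) (flow_differentiable ad dy).
move=> [l z] [/= dz Dl cl] dfl.
have zc := chart_at_cinv ad dz.
have := scaling Dl zc cl; cbv zeta; rewrite cinvK// => H.
have T u : 'd ((cfun d \o act l) \o cinv d) z u = 'd (flow d) ((l, z) : C * V) ((0, u) : C * V).
  exact: (is_diffE u (is_diff_slice2 (differentiableP dfl))).
have := H v w; rewrite /bil !T => E.
by apply/matrixP => i j; rewrite !ord1 [RHS]mxE; exact: E.
Qed.

Lemma cartan_scaling d y v w : atlas d -> ccod d y ->
  'd (euler d) y v *m L d y *m w^T + v *m 'd (L d) y (euler d y) *m w^T
  + v *m L d y *m ('d (euler d) y w)^T = v *m L d y *m w^T.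
Proof.
move=> ad dy.
pose G u q := 'd (flow d) q ((0, u) : C * V).
have dG u : is_diff (1 : C) (fun l : C => G u (l, y)) (fun h : C => 'd (G u) ((1, y) : C * V) ((h, 0) : C * V)).
  have H := differentiable_derivative ((0, u) : C * V) (flow_differentiable ad dy).
  exact: (is_diff_slice1 (differentiableP H)).
have dfl := is_diff_slice1 (differentiableP (nbhs_singleton (flow_differentiable ad dy))).
have dL : is_diff (1 : C) (fun l : C => L d (flow d (l, y)))
   (fun h : C => 'd (L d) y ('d (flow d) ((1, y) : C * V) ((h, 0) : C * V))).
  have H : is_diff (flow d ((1, y) : C * V)) (L d) ('d (L d) y).
    by rewrite flow1//; exact: form_diff.
  exact: (is_diff_comp dfl H).
have H1 := is_diff_mulmx (is_diff_mulmx (dG v) dL) (is_diff_trmx (dG w)).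
have H2 : is_diff (1 : C) (fun l : C => l *: (v *m L d y *m w^T))
   (fun h : C => h *: (v *m L d y *m w^T)).
  exact: is_diff_scalel.
have E : \forall l \near (1 : C), G v (l, y) *m L d (flow d (l, y)) *m (G w (l, y))^T =
    l *: (v *m L d y *m w^T).
  have [[A B] [nA nB] AB] := flow_scaling v w ad dy.
  apply: filterS nA => l Al; apply: (AB (l, y)); split=> //=.
  exact: nbhs_singleton nB.
have G1 u : G u (1, y) = u by exact: flow_d2.
have K := expand_scaling (congr1 (fun f => f (1 : C)) (is_diff_unique (is_diff_near E H1) H2)).
rewrite (flow1 dy) !G1 in K.
by rewrite !euler_sym.
Qed.

Lemma liouville_form_is_diff d y : atlas d -> ccod d y ->
  is_diff y (liouville_form d) (fun v =>
    ('d (euler d) y v *m L d y + euler d y *m 'd (L d) y v)^T).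
Proof.
move=> ad dy; apply: is_diff_trmx; apply: is_diff_mulmx (form_diff ad dy).
by apply: differentiableP; case: (euler_is_diff ad dy).
Qed.

Theorem d_liouville_form d y v w : atlas d -> ccod d y ->
  w *m 'd (liouville_form d) y v - v *m 'd (liouville_form d) y w =
  v *m L d y *m w^T.
Proof.
move=> ad dy; have H := liouville_form_is_diff ad dy.
rewrite (is_diffE v H) (is_diffE w H).
apply: cartan_algebra (form_skew L ad dy) (dform_skew v ad dy) _ (cartan_scaling v w ad dy).
exact: form_closed3.
Qed.

Lemma euler_transition (c d : chart R N n) (x : N) : chart_at x c -> chart_at x d ->
  euler d (cfun d x) = 'd (cfun d \o cinv c) (cfun c x) (euler c (cfun c x)).
Proof.
move=> [ac cx] [ad dx].
have cc := cfun_cod cx; have dd := cfun_cod dx.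
pose t := cfun d \o cinv c.
have dt : is_diff (cfun c x) t ('d t (cfun c x)).
  by apply: differentiableP; apply: atlas_hol.
have Hc := is_diff_slice1 (differentiableP (nbhs_singleton (flow_differentiable ac cc))).
have Hd := is_diff_slice1 (differentiableP (nbhs_singleton (flow_differentiable ad dd))).
rewrite /= in Hc Hd.
have dt' : is_diff (flow c ((1, cfun c x) : C * V)) t ('d t (cfun c x)).
  by rewrite flow1.
have H := is_diff_comp Hc dt'.
have E : \forall l \near (1 : C),
    (t \o (fun l => flow c ((l, cfun c x) : C * V))) l = flow d ((l, cfun d x) : C * V).
  have [[A B] [nA nB] AB] := flow_domain ac cc.
  apply: filterS nA => l Al.
  have [|_ _ [_ /= cl]] := AB (l, cfun c x).
    by split=> //=; exact: nbhs_singleton nB.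
  rewrite (cfunK cx) in cl.
  by rewrite /t /flow /= (cfunK cx) (cfunK dx) (cfunK cl).
have := congr1 (fun f => f (1 : C)) (is_diff_unique (is_diff_near E H) Hd).
by move=> K; exact: esym K.
Qed.

Theorem liouville_form_transition (c d : chart R N n) (x : N) w :
  chart_at x c -> chart_at x d ->
  'd (cfun d \o cinv c) (cfun c x) w *m liouville_form d (cfun d x) =
  w *m liouville_form c (cfun c x).
Proof.
move=> xc xd; have := form_transition L xc xd; cbv zeta => H.
rewrite /liouville_form (euler_transition xc xd).
by apply: pairing_transpose; exact: H.
Qed.

End LiouvilleForm.

(** * Local families of tori *)

Lemma lattice_basis_mem (R : realType) (V : vectType (Cplx R)) n (L : set V)
    (b : 'I_n -> V) i : lattice_basis L b -> L (b i).
Proof.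
move=> [_ ->]; exists (fun j => if j == i then 1 else 0).
rewrite (bigD1 i)//= eqxx mulr1z big1 ?addr0// => j /negPf ->.
by rewrite mulr0z.
Qed.

Section LocalFamily.
Variables (R : realType) (r : nat) (M : cmanifold R r) (F : torus_family M).
Local Notation C := (Cplx R).
Local Notation V := 'rV[C]_r.
Local Notation T := (Defs.total F).
Variables (c : chart R M r) (U : set M)
  (frame : forall u, {linear V -> cov F u}) (per : M -> 'M[C]_(r + r, r)).
Hypothesis c_atlas : atlas c.
Hypothesis triv : local_triv U frame per.

Definition base_dom : set V := [set y | ccod c y /\ U (cinv c y)].

Definition chart_period (y : V) : 'M[C]_(r + r, r) := per (cinv c y).

Definition family_map (p : V * V) : T := texp (frame (cinv c p.2) p.1).

Lemma chart_at_dom y : base_dom y -> chart_at (cinv c y) c.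
Proof. by move=> [cy _]; apply: chart_at_cinv. Qed.

Lemma dom_near y : base_dom y -> \forall z \near y, base_dom z.
Proof.
move=> [cy Uy]; have nU : \forall z \near y, U (cinv c z).
  apply: (cinv_continuous cy); apply: open_nbhs_nbhs; split=> //.
  exact: triv_open triv.
by apply: filterS2 (ccod_near cy) nU => z; split.
Qed.

Lemma dom_open : open base_dom.
Proof. by rewrite openE => y /dom_near. Qed.

Lemma period_differentiable y : base_dom y -> differentiable chart_period y.
Proof.
move=> Yy; have := triv_per_hol triv Yy.2 (chart_at_dom Yy).
by rewrite (cinvK Yy.1).
Qed.

Lemma family_map_into p : base_dom p.2 -> diff_into family_map p.
Proof.
case: p => z y Yy; have := triv_hol triv z Yy.2 (chart_at_dom Yy).
by rewrite (cinvK Yy.1).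
Qed.

Lemma tproj_family_map z y : tproj (family_map (z, y)) = cinv c y.
Proof.
have : fiber (F := F) (cinv c y) (family_map (z, y)).
  by rewrite -texp_onto; exists (frame (cinv c y) z).
by [].
Qed.

Definition chart_map (d : chart R T (r + r)) (p : V * V) : 'rV[C]_(r + r) := cfun d (family_map p).

Lemma chart_map_near p d : base_dom p.2 -> chart_at (family_map p) d ->
  \forall q \near p, [/\ base_dom q.2, chart_at (family_map q) d & differentiable (chart_map d) q].
Proof.
move=> Yp [ad dp]; have [cont _] := family_map_into Yp.
have nd : \forall q \near p, cdom d (family_map q) by exact: (cont _ (cdom_near dp)).
have nY : \forall q \near p, base_dom q.2.
  by case: p Yp {dp cont nd} => z y Yy; apply: (near_snd z (Q := base_dom)); exact: dom_near.
near=> q.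
have dq : cdom d (family_map q) by near: q.
have Yq : base_dom q.2 by near: q.
by split=> //; have [_ /(_ d)] := family_map_into Yq; apply.
Unshelve. all: by end_near.
Qed.

Lemma chart_map_is_diff p d : base_dom p.2 -> chart_at (family_map p) d ->
  is_diff p (chart_map d) ('d (chart_map d) p).
Proof.
move=> Yp dp; apply: differentiableP.
by have [] := nbhs_singleton (chart_map_near Yp dp).
Qed.

Lemma chart_period_lat y a : base_dom y ->
  lat (frame (cinv c y) (row a (chart_period y))).
Proof. by move=> [_ Uy]; exact: (lattice_basis_mem a (triv_lattice triv Uy)). Qed.

Lemma family_map_shift z y a : base_dom y -> family_map (z + row a (chart_period y), y) = family_map (z, y).
Proof.
move=> Yy; apply/texp_eq; rewrite /= linearD addrC addKr.
exact: chart_period_lat.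
Qed.

Lemma triv_period_matrix u : U u -> period_matrix (per u).
Proof.
move=> Uu x x0; have [indep _] := triv_lattice triv Uu.
apply/rowP => a; rewrite mxE; apply: indep.
have : frame u (embed_mx x *m per u) = 0 by rewrite x0 linear0.
rewrite mulmx_sum_row linear_sum => H; apply: etrans _ H.
by apply: eq_bigr => b _; rewrite linearZ /= mxE.
Qed.

Lemma chart_period_matrix y : base_dom y -> period_matrix (chart_period y).
Proof. by move=> [_ Uy]; exact: triv_period_matrix. Qed.

Lemma chart_map_transition p d e xi : base_dom p.2 -> chart_at (family_map p) d ->
  chart_at (family_map p) e ->
  'd (chart_map e) p xi = 'd (cfun e \o cinv d) (chart_map d p) ('d (chart_map d) p xi).
Proof.
move=> Yp dp ep.
have dt : is_diff (chart_map d p) (cfun e \o cinv d) ('d (cfun e \o cinv d) (chart_map d p)).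
  by apply: differentiableP; apply: atlas_hol => //; case: dp; case: ep.
have H := is_diff_comp (chart_map_is_diff Yp dp) dt.
have E : \forall q \near p, ((cfun e \o cinv d) \o chart_map d) q = chart_map e q.
  by apply: filterS (chart_map_near Yp dp) => q [_ [_ dq] _]; rewrite /= /chart_map cfunK.
exact: (is_diffE xi (is_diff_near E H)).
Qed.

Lemma chart_map_inverse p d : base_dom p.2 -> chart_at (family_map p) d ->
  exists s : 'rV[C]_(r + r) -> V * V,
    [/\ forall xi, s ('d (chart_map d) p xi) = xi,
        forall w, 'd (chart_map d) p (s w) = w &
        forall w, 'd (cfun c \o @tproj _ _ _ F \o cinv d) (chart_map d p) w = (s w).2].
Proof.
case: p => z y /= Yy dp; have [ad dx] := dp.
have [s [sx sp]] := triv_inv triv z Yy.2.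
set x := family_map (z, y) in dp dx sx *; rewrite -/x in sx.
have xd : ccod d (cfun d x) by exact: cfun_cod.
have cx : chart_at (tproj x) c by rewrite /x tproj_family_map; exact: chart_at_dom.
have [dtc dtd] := tproj_hol dp.
rewrite /= cfunK// in dtc dtd.
have dt : is_diff (cfun d x) (cfun c \o @tproj _ _ _ F \o cinv d)
   ('d (cfun c \o @tproj _ _ _ F \o cinv d) (cfun d x)).
  by apply: differentiableP; exact: (dtd c cx).
have [_ sdiff] := nbhs_singleton sx.
have ds : is_diff (cfun d x) (s \o cinv d) ('d (s \o cinv d) (cfun d x)).
  by apply: differentiableP; exact: sdiff.
pose g w := ((s \o cinv d) w, (cfun c \o @tproj _ _ _ F \o cinv d) w).
have dinv : is_diff (cfun d x) g (fun w => ('d (s \o cinv d) (cfun d x) w,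
    'd (cfun c \o @tproj _ _ _ F \o cinv d) (cfun d x) w)).
  exact: (is_diff_pair ds dt).
have dpsi := chart_map_is_diff (p := (z, y)) Yy dp.
set ts := 'd (cfun c \o _ \o _) _ in dt dinv *.
set dsd := 'd (s \o _) _ in ds dinv *.
exists (fun w => (dsd w, ts w)); split=> //.
- have H := is_diff_comp dpsi dinv.
  have E : \forall q \near ((z, y) : V * V), (g \o chart_map d) q = id q.
    have near1 : \forall q \near ((z, y) : V * V),
        s (texp (frame (cinv c q.2) q.1)) = q.1.
      have [[A B] [nA nB] AB] := sp.
      exists (B, cinv c @^-1` A); first by split=> //=; exact: (cinv_continuous Yy.1).
      by move=> [z' y'] /= [Bz Ay]; exact: (AB (cinv c y', z')).
    apply: filterS2 near1 (chart_map_near (p := (z, y)) Yy dp) => -[z' y'] /= sq [Yq [_ dq] _].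
    by rewrite /g /chart_map /= cfunK// tproj_family_map (cinvK (proj1 Yq)) [X in (X, _)]sq.
  have K := is_diff_unique (is_diff_near E H) (is_diff_id ((z, y) : V * V)).
  by move=> xi; exact: (congr1 (@^~ xi) K).
- have sxz : s x = z by exact: (nbhs_singleton sp).
  have tcy : cfun c (tproj x) = y by rewrite /x tproj_family_map (cinvK (proj1 Yy)).
  have gx : g (cfun d x) = (z, y) by rewrite /g /= cfunK// sxz tcy.
  have dpsi' : is_diff (g (cfun d x)) (chart_map d) ('d (chart_map d) ((z, y) : V * V)).
    by rewrite gx.
  have H := is_diff_comp dinv dpsi'.
  have E : \forall w \near cfun d x, (chart_map d \o g) w = id w.
    have nx : \forall w \near cfun d x, texp (frame (tproj (cinv d w)) (s (cinv d w))) = cinv d w.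
      have : {for cfun d x, continuous (cinv d)} by exact: cinv_continuous.
      rewrite /prop_for /continuous_at cfunK// => cont.
      have sx1 : \forall x' \near x, texp (frame (tproj x') (s x')) = x'.
        by apply: filterS sx => x' [].
      exact: (cont _ sx1).
    have nc : \forall w \near cfun d x, cdom c (tproj (cinv d w)).
      by apply: dtc; rewrite /= cfunK//; apply: cdom_near; exact: cx.2.
    apply: filterS3 nx nc (ccod_near xd) => w wx wc wd /=.
    by rewrite /g /chart_map /family_map /= cfunK// wx cinvK.
  have K := is_diff_unique (is_diff_near E H) (is_diff_id (cfun d x)).
  by move=> w; exact: (congr1 (@^~ w) K).
Qed.

End LocalFamily.

Section Periodic.
Variable R : realType.
Local Notation C := (Cplx R).
Local Notation re := (@complex.Re R).

Lemma nm_dist_le (a b : C) (e : R) : nm (b - a) <= e -> `|nm a - nm b| <= e.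
Proof.
move=> H; rewrite ler_norml; have := nmD (a - b) b; have := nmD (b - a) a.
by rewrite !subrK (nm_distC a b); move: (nm a) (nm b) (nm _) H => *; apply/andP; split; lra.
Qed.

Lemma period_real_span r (P : 'M[C]_(r + r, r)) (z : 'rV[C]_r) :
  period_matrix P -> exists x : 'rV[R]_(r + r), z = embed_mx x *m P.
Proof.
move=> /period_unit Qu; pose v := row_mx z (conjCmx z) *m invmx (row_mx P (conjCmx P)).
have : v *m row_mx P (conjCmx P) = row_mx z (conjCmx z) by rewrite mulmxKV.
rewrite mul_mx_row => /eq_row_mx[vP vP'].
exists (map_mx re v).
have -> : embed_mx (map_mx re v) = 2^-1 *: (v + conjCmx v).
  apply/matrixP => i j; rewrite !mxE; apply: (@mulfI _ 2); first by rewrite pnatr_eq0.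
  rewrite mulVKf ?pnatr_eq0//; apply: Cplx_eq; rewrite ?reD ?imD ?reM ?imM /=; ring.
have cv : conjCmx v *m P = z by rewrite -[P]conjCmxK -conjCmx_mul vP' conjCmxK.
rewrite -scalemxAl mulmxDl vP cv.
apply/matrixP => i j; rewrite !mxE; apply: (@mulfI _ 2); first by rewrite pnatr_eq0.
by rewrite mulVKf ?pnatr_eq0//; ring.
Qed.

Variables (r : nat) (P : 'M[C]_(r + r, r)) (f : 'rV[C]_r -> C).
Hypothesis P_period : period_matrix P.
Hypothesis f_periodic : forall z a, f (z + row a P) = f z.

Lemma periodic_int z (k : 'I_(r + r) -> int) : f (z + \sum_a row a P *~ k a) = f z.
Proof.
have nat_shift z' a n : f (z' + row a P *+ n) = f z'.
  by elim: n z' => [|n IH] z'; rewrite ?mulr0n ?addr0// mulrSr addrA f_periodic IH.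
have int_shift z' a m : f (z' + row a P *~ m) = f z'.
  case: m => n; first by rewrite -pmulrn nat_shift.
  by rewrite NegzE mulrNz -pmulrn -[in RHS](subrK (row a P *+ n.+1) z') nat_shift.
elim/big_rec: _ z => [|a s _ IH] z; first by rewrite addr0.
by rewrite addrCA (addrC (row a P *~ k a)) int_shift IH.
Qed.

Lemma periodic_bounded : continuous f -> exists B : R, forall z, nm (f z) <= B.
Proof.
move=> fc.
pose g (x : 'rV[R]_(r + r)) := nm (f (embed_mx x *m P)).
have gc : continuous g.
  move=> x B /(@nbhs_ballP R R)[e' /= e'0 eB].
  have e0 : 0 < e' / 2 by rewrite divr_gt0.
  set e := e' / 2 in e0; have ee : e < e' by rewrite ltr_pdivrMr// ltr_pMr// ltr1n.
  have /continuous_nm/(_ e e0)[c c0 cP] := fc (embed_mx x *m P).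
  pose K : R := 1 + (r + r)%:R * nm P.
  have K0 : 0 < K by rewrite ltr_pwDl// mulr_ge0 ?nm_ge0.
  apply/(@nbhs_ballP R 'rV[R]_(r + r)); exists (c / K); first by rewrite /= divr_gt0.
  move=> y; rewrite -ball_normE /ball_ /= ltr_pdivlMr// => xy.
  have H : nm (f (embed_mx y *m P) - f (embed_mx x *m P)) <= e.
    apply: cP; rewrite -mulmxBl; apply: (le_trans (nm_mulmx _ _)).
    apply: le_trans (ltW xy).
    have : nm (embed_mx y - embed_mx x) <= `|x - y|.
      apply: nm_mx_le => // i j; rewrite !mxE -rmorphB nmC distrC.
      by have := norm_coord (x - y) i j; rewrite !mxE.
    move=> /(ler_wpM2r (nm_ge0 P)) /(ler_wpM2l (ler0n R (r + r))) /le_trans; apply.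
    by rewrite mulrCA mulrC [leRHS]mulrC ler_wpM2r ?normr_ge0// /K mulrC lerDr.
  apply: eB; rewrite /ball_ /=; apply: le_lt_trans ee.
  rewrite /g; move: H; exact: nm_dist_le.
pose A : set 'rV[R]_(r + r) := [set v | forall i, `[0, 1]%classic (v 0 i)].
have Ac : compact A by apply: (@rV_compact R _ (fun=> `[0, 1]%classic)) => i; exact: segment_compact.
have [||x xA xmax] := @EVT_max_rV R _ g A _ Ac.
- by exists 0 => i /=; rewrite mxE in_itv /= lexx ler01.
- by apply: continuous_subspaceT.
exists (g x) => z; have [y ->] := period_real_span z P_period.
pose k a := Num.floor (y 0 a).
pose t : 'rV[R]_(r + r) := \row_a (y 0 a - (k a)%:~R).
have -> : embed_mx y *m P = embed_mx t *m P + \sum_a row a P *~ k a.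
  have -> : \sum_a row a P *~ k a = (\row_a ((k a)%:~R : C)) *m P.
    rewrite mulmx_sum_row; apply: eq_bigr => a _.
    by rewrite mxE scaler_int.
  rewrite -mulmxDl; congr (_ *m P); apply/rowP => a.
  by rewrite !mxE rmorphB /= rmorph_int subrK.
rewrite periodic_int; apply: (xmax t).
rewrite inE => a /=; rewrite in_itv /= mxE /k.
have := floor_le_tmp (y 0 a); have := floorD1_gt (y 0 a).
by rewrite intrD => h1 h2; apply/andP; split; lra.
Qed.

End Periodic.

(** * Existence of special coordinates *)

Section PairCalculus.
Variables (K : numFieldType) (V1 V2 W : normedModType K).

Lemma is_diff_fst (p : V1 * V2) : is_diff p fst fst.
Proof. by apply: is_diff_linear_map => // x; exact: cvg_fst. Qed.

Lemma is_diff_snd (p : V1 * V2) : is_diff p snd snd.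
Proof. by apply: is_diff_linear_map => // x; exact: cvg_snd. Qed.

Lemma is_diff_row m n (a : 'I_m) (G dG : W -> 'M[K]_(m, n)) x :
  is_diff x G dG -> is_diff x (fun y => row a (G y)) (fun h => row a (dG h)).
Proof.
move=> Gd; have H := is_diff_mulmxl (delta_mx 0 a) Gd.
have -> : (fun y => row a (G y)) = (fun y => delta_mx 0 a *m G y).
  by apply/funext => y; rewrite rowE.
have -> : (fun y => row a (dG y)) = (fun y => delta_mx 0 a *m dG y).
  by apply/funext => y; rewrite rowE.
exact: H.
Qed.

End PairCalculus.

Lemma entry_sub (K : comNzRingType) n (X1 X2 : 'rV[K]_n) (t : 'cV[K]_n) (A1 A2 : 'M[K]_1) :
  X1 = X2 -> (X1 *m t + A1) 0 0 - (X2 *m t + A2) 0 0 = (A1 - A2) 0 0.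
Proof. by move=> ->; rewrite [X in X - _]mxE [X in _ - X]mxE [RHS]mxE [X in _ = _ + X]mxE opprD addrACA subrr add0r. Qed.

Lemma bilinear_shift (K : comNzRingType) n (X X' Y Z Z' : 'rV[K]_n) (A B : 'M[K]_n) :
  A = B -> X' = Y + X -> Z' = Z -> (Y *m A *m Z^T) 0 0 = 0 ->
  (X *m A *m Z^T) 0 0 = (X' *m B *m Z'^T) 0 0.
Proof.
by move=> -> -> -> H; rewrite mulmxDl mulmxDl [RHS]mxE H add0r.
Qed.

Lemma pair_eqP (T1 T2 : Type) (p q : T1 * T2) : p.1 = q.1 -> p.2 = q.2 -> p = q.
Proof. by case: p q => [? ?] [? ?] /= -> ->. Qed.

Section PulledBackForm.
Variables (R : realType) (r : nat) (M : cmanifold R r) (F : torus_family M).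
Local Notation C := (Cplx R).
Local Notation V := 'rV[C]_r.
Local Notation T := (Defs.total F).
Variables (c : chart R M r) (U : set M)
  (frame : forall u, {linear V -> cov F u}) (per : M -> 'M[C]_(r + r, r)).
Hypothesis c_atlas : atlas c.
Hypothesis triv : local_triv U frame per.
Variable L : symplectic_form T.
Hypothesis L_fiber : forall (x : T) d e, chart_at x d -> chart_at (tproj x) e ->
  let S := 'd (cfun e \o @tproj _ _ _ F \o cinv d) (cfun d x) in
  forall v w, S v = 0 -> S w = 0 -> bil (L d (cfun d x)) v w = 0.
Variable th : chart R T (r + r) -> 'rV[C]_(r + r) -> 'cV[C]_(r + r).
Hypothesis th_diff : forall d y, atlas d -> ccod d y -> differentiable (th d) y.
Hypothesis th_transition : forall d e x w, chart_at x d -> chart_at x e ->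
  'd (cfun e \o cinv d) (cfun d x) w *m th e (cfun e x) = w *m th d (cfun d x).
Hypothesis d_th : forall d y v w, atlas d -> ccod d y ->
  w *m 'd (th d) y v - v *m 'd (th d) y w = v *m L d y *m w^T.
Variable ch : T -> chart R T (r + r).
Hypothesis chP : forall x, chart_at x (ch x).

Local Notation Phi := (family_map c frame).
Local Notation psi := (chart_map c frame).
Local Notation dom := (base_dom c U).
Local Notation period := (chart_period c per).

Definition Theta (p xi : V * V) : C :=
  ('d (psi (ch (Phi p))) p xi *m th (ch (Phi p)) (psi (ch (Phi p)) p)) 0 0.

Lemma Theta_chart p d xi : dom p.2 -> chart_at (Phi p) d ->
  Theta p xi = ('d (psi d) p xi *m th d (psi d p)) 0 0.
Proof.
move=> Yp dp; set e := ch (Phi p).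
have E := chart_map_transition c_atlas triv xi Yp dp (chP (Phi p)).
apply: etrans (congr1 (fun v => (v *m th e (psi e p)) 0 0) E) _.
exact: (congr1 (fun A : 'M[C]_1 => A 0 0) (th_transition _ dp (chP (Phi p)))).
Qed.

Lemma Theta_near p d xi : dom p.2 -> chart_at (Phi p) d ->
  \forall q \near p, ('d (psi d) q xi *m th d (psi d q)) 0 0 = Theta q xi.
Proof.
move=> Yp dp; apply: filterS (chart_map_near c_atlas triv Yp dp) => q [Yq dq _].
by rewrite (Theta_chart _ Yq dq).
Qed.

Lemma Theta_is_diff p d eta : dom p.2 -> chart_at (Phi p) d ->
  is_diff p (Theta ^~ eta) (fun xi =>
    ('d (fun q => 'd (psi d) q eta) p xi *m th d (psi d p) +
     'd (psi d) p eta *m 'd (th d) (psi d p) ('d (psi d) p xi)) 0 0).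
Proof.
move=> Yp dp; apply: is_diff_near (Theta_near eta Yp dp) _.
have nd : \forall q \near p, differentiable (psi d) q.
  by apply: filterS (chart_map_near c_atlas triv Yp dp) => q [].
have H1 := differentiableP (differentiable_derivative eta nd).
have H2 : is_diff (psi d p) (th d) ('d (th d) (psi d p)).
  apply: differentiableP; apply: th_diff; first exact: dp.1.
  by apply: cfun_cod; exact: dp.2.
have H3 := is_diff_comp (chart_map_is_diff c_atlas triv Yp dp) H2.
exact: (is_diff_coord 0 0 (is_diff_mulmx H1 H3)).
Qed.

Lemma Theta_differentiable p xi : dom p.2 -> differentiable (Theta ^~ xi) p.
Proof. by move=> Yp; have [] := Theta_is_diff xi Yp (chP _). Qed.

Lemma Theta_linear p : dom p.2 -> linear (Theta p : V * V -> C).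
Proof.
move=> Yp a x y; rewrite /Theta; set D := 'd _ _; set t := th _ _.
have -> : D (a *: x + y) = a *: D x + D y by exact: linearP.
by rewrite mulmxDl -scalemxAl [LHS]mxE [X in X + _]mxE.
Qed.

Definition Omega d (p xi eta : V * V) : C :=
  ('d (psi d) p xi *m L d (psi d p) *m ('d (psi d) p eta)^T) 0 0.

Lemma d_Theta p d xi eta : dom p.2 -> chart_at (Phi p) d ->
  'd (Theta ^~ eta) p xi - 'd (Theta ^~ xi) p eta = Omega d p xi eta.
Proof.
move=> Yp dp.
have nd : \forall q \near p, differentiable (psi d) q.
  by apply: filterS (chart_map_near c_atlas triv Yp dp) => q [].
have E := derivative_sym_mx eta xi nd.
have cd : ccod d (psi d p) by apply: cfun_cod; exact: dp.2.
have A1 := is_diffE xi (Theta_is_diff eta Yp dp).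
have A2 := is_diffE eta (Theta_is_diff xi Yp dp).
apply: etrans (congr2 (fun x y => x - y) A1 A2) _.
apply: etrans (entry_sub _ _ _ E) _.
exact: (congr1 (fun A : 'M[C]_1 => A 0 0) (d_th _ _ dp.1 cd)).
Qed.

Definition shift a (p : V * V) : V * V := (p.1 + row a (period p.2), p.2).

Definition dshift a (p xi : V * V) : V * V :=
  (xi.1 + row a ('d period (p.2) xi.2), xi.2).

Lemma shift_is_diff a p : dom p.2 -> is_diff p (shift a) (dshift a p).
Proof.
move=> Yp.
have D1 := is_diff_fst p; have D2 := is_diff_snd p.
have DP : is_diff (p.2) period ('d period (p.2)).
  by apply: differentiableP; exact: (period_differentiable c_atlas triv).
have H := is_diff_pair (is_diffD D1 (is_diff_row a (is_diff_comp (f := snd) D2 DP))) D2.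
exact: H.
Qed.

Lemma dom_shift a p : dom p.2 -> dom (shift a p).2.
Proof. by []. Qed.

Lemma family_map_shiftE a p : dom p.2 -> Phi (shift a p) = Phi p.
Proof. by case: p => z y Yy; exact: (family_map_shift triv). Qed.

Lemma chart_map_shift a p d xi : dom p.2 -> chart_at (Phi p) d ->
  'd (psi d) (shift a p) (dshift a p xi) = 'd (psi d) p xi.
Proof.
move=> Yp dp.
have dp' : chart_at (Phi (shift a p)) d by rewrite family_map_shiftE.
have H := is_diff_comp (shift_is_diff a Yp)
  (chart_map_is_diff c_atlas triv (dom_shift a Yp) dp').
have E : \forall q \near p, (psi d \o shift a) q = psi d q.
  apply: filterS (chart_map_near c_atlas triv Yp dp) => q [Yq _ _].
  by rewrite /= /chart_map family_map_shiftE.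
exact: esym (is_diffE xi (is_diff_near E H)).
Qed.

Lemma Theta_shift a p xi : dom p.2 -> Theta (shift a p) (dshift a p xi) = Theta p xi.
Proof.
move=> Yp; have dp := chP (Phi p); have dp' : chart_at (Phi (shift a p)) (ch (Phi p)).
  by rewrite family_map_shiftE.
have psiE : psi (ch (Phi p)) (shift a p) = psi (ch (Phi p)) p.
  by rewrite /chart_map family_map_shiftE.
apply: etrans (Theta_chart _ (dom_shift a Yp) dp') _.
apply: etrans _ (esym (Theta_chart _ Yp dp)).
exact: (congr2 (fun v y => (v *m th (ch (Phi p)) y) 0 0) (chart_map_shift a xi Yp dp) psiE).
Qed.

Lemma chart_map_vertical p d f : dom p.2 -> chart_at (Phi p) d ->
  'd (cfun c \o @tproj _ _ _ F \o cinv d) (psi d p) ('d (psi d) p (f, 0)) = 0.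
Proof.
move=> Yp dp; have [s [sK _ sT]] := chart_map_inverse c_atlas triv Yp dp.
by rewrite sT sK.
Qed.

Lemma Omega_vertical p d f g : dom p.2 -> chart_at (Phi p) d ->
  Omega d p (f, 0) (g, 0) = 0.
Proof.
move=> Yp dp.
have cp : chart_at (tproj (Phi p)) c.
  by case: p Yp dp => z y Yy dp; rewrite tproj_family_map; exact: (chart_at_dom c_atlas Yy).
apply: (L_fiber dp cp); exact: chart_map_vertical.
Qed.

Lemma Omega_shift a p d e f : dom p.2 -> chart_at (Phi p) d ->
  Omega d (shift a p) (0, e) (f, 0) = Omega d p (0, e) (f, 0).
Proof.
move=> Yp dp; have dp' : chart_at (Phi (shift a p)) d by rewrite family_map_shiftE.
have psiE : psi d (shift a p) = psi d p by rewrite /chart_map family_map_shiftE.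
have V0 := Omega_vertical (row a ('d period (p.2) e)) f (dom_shift a Yp) dp'.
have E1 : dshift a p (f, 0) = (f, 0) by rewrite /dshift /= linear0 row0 addr0.
have E2 : dshift a p (0, e) = (row a ('d period (p.2) e), 0) + (0, e).
  by apply: pair_eqP; rewrite /= ?addr0 ?add0r.
have D1 := chart_map_shift a (f, 0) Yp dp; rewrite E1 in D1.
have D2 := chart_map_shift a (0, e) Yp dp; rewrite E2 in D2.
have D3 : 'd (psi d) p (0, e) = 'd (psi d) (shift a p) (row a ('d period (p.2) e), 0)
    + 'd (psi d) (shift a p) (0, e).
  by apply: etrans (esym D2) _; exact: linearD.
exact: (bilinear_shift (congr1 (L d) psiE) D3 (esym D1) V0).
Qed.

Definition covector y : 'cV[C]_r := \col_j Theta (0, y) (delta_mx 0 j, 0).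

Definition form_component e f (q : V * V) : C :=
  'd (Theta ^~ (f, 0)) q (0, e) - 'd (Theta ^~ (0, e)) q (f, 0).

Lemma dom_near_pair (p : V * V) : dom p.2 -> \forall q \near p, dom q.2.
Proof. by move=> Yp; apply: filterS (chart_map_near c_atlas triv Yp (chP _)) => q []. Qed.

Lemma periodic_fiber_constant (g : V * V -> C) y : dom y ->
  (forall z, differentiable g (z, y)) ->
  (forall a z, g (shift a (z, y)) = g (z, y)) ->
  forall z, g (z, y) = g (0, y).
Proof.
move=> Yy gd gp.
have gd1 z : differentiable (fun z => g (z, y)) z.
  by have [] := is_diff_slice1 (differentiableP (gd z)).
have [|B BP] := periodic_bounded (f := fun z => g (z, y)) (chart_period_matrix triv Yy) (fun z a => gp a z).
  by move=> z; apply: differentiable_continuous; exact: gd1.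
exact: (liouville gd1 BP).
Qed.

Lemma Theta_fiber y z f : dom y -> Theta (z, y) (f, 0) = (f *m covector y) 0 0.
Proof.
move=> Yy.
have -> : Theta (z, y) (f, 0) = Theta (0, y) (f, 0).
  have D z' : differentiable (Theta ^~ (f, 0)) (z', y) by exact: Theta_differentiable.
  have S a z' : Theta (shift a (z', y)) (f, 0) = Theta (z', y) (f, 0).
    have := Theta_shift (p := (z', y)) a (f, 0) Yy.
    by rewrite {1}/dshift /= linear0 row0 addr0.
  exact: (periodic_fiber_constant Yy D S z).
have lin : linear (fun f => Theta (0, y) (f, 0) : C).
  move=> k u v; have := Theta_linear (p := (0, y)) Yy k (u, 0) (v, 0).
  by rewrite (_ : k *: (u, 0) + (v, 0) = (k *: u + v, 0) :> V * V)//; apply: pair_eqP; rewrite //= scaler0 addr0.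
pose mm := GRing.isLinear.Build C V C *:%R _ lin.
pose l : {linear V -> C} := HB.pack (fun f => Theta (0, y) (f, 0) : C) mm.
rewrite -[LHS]/(l f) {1}[f]row_sum_delta linear_sum mxE.
by apply: eq_bigr => j _; rewrite linearZ /= mxE.
Qed.

Lemma form_componentE p d e f : dom p.2 -> chart_at (Phi p) d ->
  form_component e f p = Omega d p (0, e) (f, 0).
Proof. by move=> Yp dp; exact: (d_Theta (0, e) (f, 0) Yp dp). Qed.

Lemma form_component_fiber y z e f : dom y ->
  form_component e f (z, y) = form_component e f (0, y).
Proof.
move=> Yy.
have D z' : differentiable (form_component e f) (z', y).
  have D xi eta : differentiable (fun q => 'd (Theta ^~ xi) q eta) (z', y).
    have N : \forall q \near ((z', y) : V * V), differentiable (Theta ^~ xi) q.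
      apply: filterS (dom_near_pair (p := (z', y)) Yy) => q Yq.
      exact: Theta_differentiable.
    by have [] := holomorphic_derivative eta N.
  exact: (differentiableB (D (f, 0) (0, e)) (D (0, e) (f, 0))).
have S a z' : form_component e f (shift a (z', y)) = form_component e f (z', y).
  have dp := chP (Phi (z', y)).
  have dp' : chart_at (Phi (shift a (z', y))) (ch (Phi (z', y))) by rewrite family_map_shiftE.
  apply: etrans (form_componentE e f (p := shift a (z', y)) Yy dp') _.
  apply: etrans _ (esym (form_componentE e f (p := (z', y)) Yy dp)).
  exact: (Omega_shift a e f (p := (z', y)) Yy dp).
exact: (periodic_fiber_constant Yy D S z).
Qed.

Lemma covector_differentiable y : dom y -> differentiable covector y.
Proof.
move=> Yy; apply: differentiable_mx => i j.
have -> : (fun y => covector y i j) = (fun y => Theta (0, y) (delta_mx 0 i, 0)).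
  by apply/funext => y'; rewrite mxE.
have D : differentiable (Theta ^~ (delta_mx 0 i, 0)) ((0, y) : V * V).
  exact: Theta_differentiable.
by have [] := is_diff_slice2 (differentiableP D).
Qed.

Lemma Theta_fiber_derivative y z e f : dom y ->
  'd (Theta ^~ (f, 0)) ((z, y) : V * V) (0, e) = (f *m 'd covector y e) 0 0.
Proof.
move=> Yy.
have D : differentiable (Theta ^~ (f, 0)) ((z, y) : V * V) by exact: Theta_differentiable.
have H1 := is_diff_slice2 (differentiableP D).
have H2 := is_diff_coord 0 0 (is_diff_mulmxl f (differentiableP (covector_differentiable Yy))).
have E : \forall y' \near y, (f *m covector y') 0 0 = Theta (z, y') (f, 0).
  by apply: filterS (dom_near triv Yy) => y' Yy'; rewrite Theta_fiber.
exact: (congr1 (@^~ e) (is_diff_unique H1 (is_diff_near E H2))).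
Qed.

Lemma Theta_affine y z e : dom y -> Theta (z, y) (0, e) =
  Theta (0, y) (0, e) + ((z *m 'd covector y e) 0 0 - form_component e z (0, y)).
Proof.
move=> Yy; pose g z : C := Theta (z, y) (0, e).
pose dg f : C := (f *m 'd covector y e) 0 0 - form_component e f (0, y).
have gd z' : is_diff z' g dg.
  have D : differentiable (Theta ^~ (0, e)) ((z', y) : V * V) by exact: Theta_differentiable.
  apply: (is_diff_congr (is_diff_slice1 (differentiableP D))) => //.
  apply/funext => f; rewrite /dg -(form_component_fiber z' e f Yy) -(Theta_fiber_derivative z' e f Yy).
  by rewrite /form_component opprB addrC subrK.
have dgE f : 'd g 0 f = dg f by exact: (is_diffE f (gd 0)).
have lc : continuous ('d g 0) by apply: diff_continuous; case: (gd 0).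
have ld z' : is_diff z' ('d g 0) ('d g 0).
  by split; [exact: linear_differentiable|exact: diff_lin].
have hd z' : is_diff z' (fun w => g w - 'd g 0 w) (0 : V -> C).
  apply: DiffDef; first by apply: differentiableB; [case: (gd z')|case: (ld z')].
  have E := is_diffB (gd z') (ld z'); apply/funext => f; rewrite (is_diffE f E).
  by apply/eqP; rewrite subr_eq0 -dgE.
have := zero_derivative_segment (x := 0) (fun t _ => hd (0 + real_complex R t *: (z - 0))).
by rewrite linear0 subr0 => /eqP; rewrite subr_eq dgE => /eqP.
Qed.

Lemma covector_period_derivative y e a : dom y ->
  'd (fun y => period y *m covector y) y e a 0 =
  form_component e (row a (period y)) (0, y).
Proof.
move=> Yy; have Pd := differentiableP (period_differentiable c_atlas triv Yy).
have := is_diff_mulmx Pd (differentiableP (covector_differentiable Yy)).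
move=> /(is_diffE e) ->.
have := Theta_shift (p := (0, y)) a (0, e) Yy.
have -> : dshift a (0, y) (0, e) = (1 : C) *: (row a ('d period y e), 0) + (0, e).
  by apply: pair_eqP; rewrite /= ?scaler0 ?scale1r ?addr0 ?add0r.
have -> : shift a (0, y) = (row a (period y), y) by rewrite /shift /= add0r.
rewrite (Theta_linear (p := (_, y)) Yy) scale1r Theta_fiber// Theta_affine//.
rewrite addrCA -[RHS]addr0 => /addrI; rewrite addrA => /eqP; rewrite subr_eq0 => /eqP <-.
rewrite mxE -!row_mul; congr (_ + _); by rewrite [RHS]mxE.
Qed.

Lemma special_coordinates : exists (a : V -> 'cV[C]_r) (A : V -> 'M[C]_r),
  forall y, dom y -> [/\ differentiable a y,
    forall e, 'd (fun y => period y *m a y) y e = period y *m A y *m e^T &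
    A y \in unitmx].
Proof.
have [A AP] : exists A : V -> 'M[C]_r, forall y, dom y ->
    (forall e f, form_component e f (0, y) = (f *m A y *m e^T) 0 0) /\ A y \in unitmx.
  suff H y : exists B : 'M[C]_r, dom y ->
      (forall e f, form_component e f (0, y) = (f *m B *m e^T) 0 0) /\ B \in unitmx.
    by have [A AP] := choice H; exists A.
  have [Yy|?] := pselect (dom y); last by exists 0.
  set p : V * V := (0, y); set d := ch (Phi p); have dp : chart_at (Phi p) d := chP _.
  have [Jv JvP] : exists J : 'M[C]_(r, r + r), forall f, 'd (psi d) p (f, 0) = f *m J.
    have lin : linear (fun f : V => 'd (psi d) p ((f, 0) : V * V)).
      move=> k u v; rewrite -linearP; congr ('d _ _ _).
      by apply: pair_eqP; rewrite //= scaler0 addr0.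
    pose mm := GRing.isLinear.Build C V 'rV[C]_(r + r) *:%R _ lin.
    pose l : {linear V -> 'rV[C]_(r + r)} := HB.pack (fun f : V => 'd (psi d) p ((f, 0) : V * V)) mm.
    by exists (lin1_mx l) => f; rewrite mul_rV_lin1.
  have [Jh JhP] : exists J : 'M[C]_(r, r + r), forall e, 'd (psi d) p (0, e) = e *m J.
    have lin : linear (fun f : V => 'd (psi d) p ((0, f) : V * V)).
      move=> k u v; rewrite -linearP; congr ('d _ _ _).
      by apply: pair_eqP; rewrite //= scaler0 addr0.
    pose mm := GRing.isLinear.Build C V 'rV[C]_(r + r) *:%R _ lin.
    pose l : {linear V -> 'rV[C]_(r + r)} := HB.pack (fun f : V => 'd (psi d) p ((0, f) : V * V)) mm.
    by exists (lin1_mx l) => f; rewrite mul_rV_lin1.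
  set w := psi d p; have formE e f : form_component e f p = (f *m (Jv *m (L d w)^T *m Jh^T) *m e^T) 0 0.
    rewrite (form_componentE e f (p := p) Yy dp) /Omega JvP JhP.
    have tr (B : 'M[C]_1) : B 0 0 = B^T 0 0 by rewrite mxE.
    by rewrite tr !trmx_mul !trmxK !mulmxA.
  set B := Jv *m _ *m _ in formE; exists B => _; split=> //.
  rewrite -row_free_unit -kermx_eq0; apply/eqP/row_matrixP => i.
  set f := row i _; rewrite row0.
  have fB : f *m B = 0 by rewrite /f -row_mul mulmx_ker row0.
  have [s [sK Ks _]] := chart_map_inverse c_atlas triv (p := p) Yy dp.
  have fh e : Omega d p (0, e) (f, 0) = 0.
    by rewrite -(form_componentE e f (p := p) Yy dp) formE fB mul0mx mxE.
  have fv g : Omega d p (g, 0) (f, 0) = 0 by exact: Omega_vertical.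
  have L0 : L d w *m ('d (psi d) p (f, 0))^T = 0.
    apply/row_matrixP => j; rewrite row0; apply/rowP => k; rewrite ord1 [RHS]mxE.
    rewrite rowE; pose q := s (delta_mx 0 j).
    rewrite -[delta_mx 0 j]Ks -/q.
    have -> : 'd (psi d) p q = 'd (psi d) p (q.1, 0) + 'd (psi d) p (0, q.2).
      rewrite -linearD; congr ('d _ _ _).
      by apply: pair_eqP; rewrite /= ?addr0 ?add0r.
    have := fh q.2; have := fv q.1; rewrite /Omega -/w => h1 h2.
    by rewrite mulmxDl mxE mulmxA h1 mulmxA h2 addr0.
  have Lu : L d w \in unitmx.
    by apply: form_nondegenerate; [exact: dp.1|apply: cfun_cod; exact: dp.2].
  have f0 : 'd (psi d) p (f, 0) = 0.
    by apply: trmx_inj; rewrite trmx0 -(mulKmx Lu ('d (psi d) p (f, 0))^T) L0 mulmx0.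
  have : s ('d (psi d) p (f, 0)) = s ('d (psi d) p 0) by rewrite f0 linear0.
  by rewrite !sK => -[].
exists covector, A => y Yy; have [AE Au] := AP y Yy; split=> //.
  exact: covector_differentiable.
move=> e; apply/matrixP => a j; rewrite ord1 covector_period_derivative// AE.
by rewrite -!row_mul mxE.
Qed.

End PulledBackForm.

(** * Automorphisms as integer matrices *)

Lemma defect_sum (V : zmodType) (a b c d e : V) :
  a - (b + c) = a - (d + e) - (b - d) - (c - e).
Proof. by rewrite -[RHS]addrA -opprD addrACA -opprD opprB addrA subrK. Qed.

Section AdditiveGerm.
Variable R : realType.
Local Notation C := (Cplx R).
Variables V W : normedModType C.

Lemma nmMn (U : normedModType C) (v : U) k : nm (v *+ k) = nm v *+ k.
Proof. by rewrite -scaler_nat nmZ -(rmorph_nat (real_complex R)) nmC ger0_norm ?ler0n// mulr_natl. Qed.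

Lemma scale_nat (n : nat) (z : V) : (n.+1%:R^-1 *: z : V) *+ n.+1 = z.
Proof. by rewrite -scaler_nat scalerA divff ?scale1r// pnatr_eq0. Qed.

Lemma shrink (z : V) (c : R) : 0 < c ->
  exists n, forall m, (n <= m)%N -> nm ((m.+1%:R^-1 : C) *: z) <= c.
Proof.
move=> c0; exists (Num.truncn (nm z / c)) => m nm_.
have m0 : 0 < m.+1%:R :> R by rewrite ltr0n.
have -> : (m.+1%:R^-1 : C) = real_complex R m.+1%:R^-1.
  by rewrite fmorphV rmorph_nat.
rewrite nmZ nmC ger0_norm ?invr_ge0 ?(ltW m0)// mulrC ler_pdivrMr// mulrC -ler_pdivrMr//.
apply: ltW; apply: lt_le_trans (truncnS_gt _) _.
by rewrite ler_nat ltnS.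
Qed.

Lemma additive_germ_linear (f df : V -> W) (rho : R) : 0 < rho ->
  (forall x y, nm x <= rho -> nm y <= rho -> f (x + y) = f x + f y) ->
  is_diff 0 f df -> forall z, nm z <= rho -> f z = df z.
Proof.
move=> rho0 fD dfP z zr.
have f0 : f 0 = 0.
  have := fD 0 0; rewrite nm0 addr0 => /(_ (ltW rho0) (ltW rho0)) /eqP.
  by rewrite -subr_eq subrr => /eqP.
have lin := is_diff_linear dfP.
pose mm := GRing.isLinear.Build C V W *:%R _ lin.
pose l : {linear V -> W} := HB.pack df mm.
have fM n w : nm (w *+ n.+1) <= rho -> f (w *+ n.+1) = f w *+ n.+1.
  move=> wr; have : forall k, (k <= n)%N -> f (w *+ k.+1) = f w *+ k.+1.
    have wle k : (k <= n.+1)%N -> nm (w *+ k) <= rho.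
      move=> kn; apply: le_trans wr; rewrite (nmMn w k) (nmMn w n.+1).
      by rewrite -[leLHS]mulr_natl -[leRHS]mulr_natl ler_wpM2r ?nm_ge0// ler_nat.
    elim=> [|k IH] kn; first by rewrite !mulr1n.
    have w1 := wle 1%N isT; rewrite mulr1n in w1.
    by rewrite mulrSr fD ?wle// 1?ltnW// IH ?(ltnW kn)// -mulrSr.
  by apply.
apply/eqP; rewrite -subr_eq0 -nm_eq0 eq_le nm_ge0 andbT; apply/ler_addgt0Pl => e e0.
rewrite addr0; have e1 : 0 < e / (1 + nm z) by rewrite divr_gt0// ltr_pwDl// nm_ge0.
have [c c0 cP] := is_diff_nm dfP e1.
have [n /(_ n (leqnn n)) nc] := shrink z c0; set w := _ *: z in nc.
have zE : z = w *+ n.+1 by rewrite scale_nat.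
have dE : df z = df w *+ n.+1 by rewrite {1}zE -[df _]/(l _) raddfMn.
have fE : f z = f w *+ n.+1 by rewrite {1}zE fM -?zE.
have := cP w nc; rewrite addr0 f0 subr0 => H.
rewrite fE dE -mulrnBl (nmMn (f w - df w)).
apply: (@le_trans _ _ (e / (1 + nm z) * nm w *+ n.+1)); first by rewrite lerMn2r H orbT.
rewrite -mulrnAr -(nmMn w) -zE -mulrA ler_piMr ?(ltW e0)// mulrC ler_pdivrMr ?mul1r ?lerDr//.
by rewrite ltr_pwDl// nm_ge0.
Qed.
End AdditiveGerm.

Section LatticeBasis.
Variables (R : realType) (V : vectType (Cplx R)) (n : nat).
Local Notation C := (Cplx R).
Variables (L : set V) (b : 'I_n -> V).
Hypothesis Lb : lattice_basis L b.

Lemma lattice_basis_inj (k l : 'I_n -> int) :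
  \sum_i b i *~ k i = \sum_i b i *~ l i -> k =1 l.
Proof.
move=> kl i; have := Lb.1 (fun i => (k i - l i)%:~R).
have -> : \sum_i (real_complex R (k i - l i)%:~R : C) *: b i = 0.
  have E j : (real_complex R (k j - l j)%:~R : C) *: b j = b j *~ k j - b j *~ l j.
    by rewrite rmorph_int scaler_int mulrzBr.
  by rewrite (eq_bigr _ (fun j _ => E j)) sumrB kl subrr.
move=> /(_ erefl i) /eqP; rewrite intr_eq0 subr_eq0 => /eqP //.
Qed.

Lemma lattice_divisible0 q : L q ->
  (forall m, exists2 p, L p & q = p *+ m.+1) -> q = 0.
Proof.
rewrite Lb.2 => -[k ->] H; apply: big1 => i _.
have [p [l ->] E] := H `|k i|%N.
have kE : k i = l i * (`|k i|.+1)%:Z.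
  apply: (@lattice_basis_inj k (fun i' => l i' * (`|k i|.+1)%:Z)).
  by rewrite E -sumrMnl; apply: eq_bigr => j _; rewrite mulrzA -pmulrn.
have : `|k i|%N = (`|l i| * `|k i|.+1)%N by rewrite {1}kE abszM.
case: `|l i|%N => [|a]; first by move=> /eqP; rewrite mul0n absz_eq0 => /eqP ->; rewrite mulr0z.
by move=> ki; have := leq_addr (a * `|k i|.+1) `|k i|.+1; rewrite -mulSn -ki ltnn.
Qed.
End LatticeBasis.

Section AutomorphismMatrix.
Variables (R : realType) (r : nat) (M : cmanifold R r) (G : sk_geometry M).
Local Notation C := (Cplx R).
Local Notation V := 'rV[C]_r.
Variables (U : set M) (frame : forall u, {linear V -> cov G u})
  (per : M -> 'M[C]_(r + r, r)).
Hypothesis triv : local_triv U frame per.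
Variable u : M.
Hypothesis Uu : U u.

Local Notation L := (@lat _ _ _ G u).

Lemma period_in_lattice a : L (frame u (row a (per u))).
Proof. exact: (lattice_basis_mem a (triv_lattice triv Uu)). Qed.

Lemma lattice_combination v : L v -> exists k : 'I_(r + r) -> int,
  v = frame u (\sum_a row a (per u) *~ k a).
Proof.
have [_ LE] := triv_lattice triv Uu; rewrite {1}LE => -[k ->]; exists k.
by rewrite raddf_sum; apply: eq_bigr => a _; rewrite raddfMz.
Qed.

Lemma lattice0 : L 0. Proof. by []. Qed.

Lemma latticeB v w : L v -> L w -> L (v - w).
Proof.
have [_ LE] := triv_lattice triv Uu; rewrite LE => -[k ->] [l ->].
exists (fun a => k a - l a); rewrite -sumrB; apply: eq_bigr => a _.
by rewrite mulrzBr.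
Qed.

Lemma latticeMn v n : L v -> L (v *+ n).
Proof.
move=> Lv; have LN w : L w -> L (- w) by rewrite -[- w]sub0r; apply: latticeB; exact: lattice0.
elim: n => [|n IH]; first by rewrite mulr0n; exact: lattice0.
by rewrite mulrS -[_ *+ n]opprK; apply: latticeB => //; exact: LN.
Qed.

(* [triv_inv] recovers small vectors from their image in the torus. *)
Lemma lattice_discrete : exists2 rho : R, 0 < rho &
  forall z : V, nm z <= rho -> L (frame u z) -> z = 0.
Proof.
have [s [_ sp]] := triv_inv triv 0 Uu.
have nz : \forall z \near (0 : V), s (texp (frame u z)) = z.
  have [[A B] [nA nB] AB] := sp; apply: filterS nB => z Bz.
  by apply: (AB (u, z)); split=> //; exact: nbhs_singleton nA.
have /nbhs_nm[rho rho0 rhoP] := nz.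
exists rho => // z zr Lz; rewrite -(rhoP z); last by rewrite subr0.
rewrite Lz -[X in texp X](linear0 (frame u)); apply: rhoP.
by rewrite subr0 nm0 ltW.
Qed.

Variables (f : Defs.total G -> Defs.total G) (g : {additive cov G u -> cov G u}).
Hypothesis f_hol : forall (phi : {linear V -> cov G u}) z,
  diff_into (fun z => f (texp (phi z))) z.
Hypothesis f_lift : forall x, f (texp x) = texp (g x).
Hypothesis g_pol : forall x y, lat x -> lat y -> pol (g x) (g y) = pol x y.

Lemma tproj_texp (x : cov G u) : tproj (texp x) = u.
Proof. by have : fiber (F := G) u (texp x) by rewrite -texp_onto; exists x. Qed.

Lemma lift_germ : exists2 delta : V -> V, differentiable delta 0 &
  \forall z \near (0 : V), L (frame u (delta z) - g (frame u z)).
Proof.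
have [s [sx _]] := triv_inv triv 0 Uu.
pose h z := f (texp (frame u z)).
have h0 : h 0 = texp (frame u 0) by rewrite /h f_lift !linear0 raddf0.
have [hc hd] := f_hol (frame u) 0.
rewrite -/(h 0) h0 in hd; rewrite /prop_for /continuous_at -/(h 0) h0 in hc.
exists (s \o h).
  have [d [ad dx]] : exists d, chart_at (texp (frame u 0)) d.
    by have [d ad dx] := atlas_cover (texp (frame u 0)); exists d.
  have [_ /(_ d (conj ad dx)) sd] := nbhs_singleton sx.
  have dh : differentiable (cfun d \o h) 0 by apply: hd.
  have sd' : differentiable (s \o cinv d) ((cfun d \o h) 0) by rewrite /= h0.
  have E : \forall z \near (0 : V), ((s \o cinv d) \o (cfun d \o h)) z = (s \o h) z.
    have : \forall z \near (0 : V), cdom d (h z) by apply: hc; exact: cdom_near.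
    by apply: filterS => z dz; rewrite /= cfunK.
  by have [] := is_diff_near E (is_diff_comp (differentiableP dh) (differentiableP sd')).
have : \forall z \near (0 : V), texp (frame (tproj (h z)) (s (h z))) = h z.
  have sx1 : \forall x \near texp (frame u 0), texp (frame (tproj x) (s x)) = x.
    by apply: filterS sx => x [].
  exact: (hc _ sx1).
apply: filterS => z; have hu : tproj (h z) = u by rewrite /h f_lift tproj_texp.
by rewrite hu => hz; apply: (texp_eq _ _).1; rewrite /= hz /h f_lift.
Qed.

Lemma lift_linear : exists D : 'M[C]_r, forall z, g (frame u z) = frame u (z *m D).
Proof.
have [k kK Kk] := triv_frame triv Uu.
have [rho rho0 disc] := lattice_discrete.
have [delta dd /nbhs_nm[c1 c10 c1P]] := lift_germ.
have dc := differentiable_continuous dd.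
have small0 : L (frame u (delta 0)).
  by have := c1P 0; rewrite subrr nm0 ltW// linear0 raddf0 subr0 => /(_ isT).
have frameB (z w : V) : frame u (z - w) = frame u z - frame u w by rewrite linearB.
have frameD (z w : V) : frame u (z + w) = frame u z + frame u w by rewrite linearD.
(* [e z] differs from [k (g (frame u z))] by lattice vectors, is small near 0, hence is additive there. *)
pose e (z : V) : V := delta z - delta 0.
have eL (z : V) : nm z <= c1 -> L (frame u (e z) - g (frame u z)).
  by move=> zc; rewrite frameB addrAC; apply: latticeB => //; apply: c1P; rewrite subr0.
have rho3 : 0 < rho / 3 by rewrite divr_gt0.
have [c2 c20 c2P] := (continuous_nm delta 0).1 dc _ rho3.
have eS (z : V) : nm z <= c2 -> nm (e z) <= rho / 3.
  by move=> zc; apply: c2P; rewrite subr0.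
pose c := Num.min c1 c2 / 2.
have c0 : 0 < c by rewrite divr_gt0// lt_min c10.
have cc (x y : V) : nm x <= c -> nm y <= c -> [/\ nm (x + y) <= c1 & nm (x + y) <= c2].
  move=> xc yc; have : nm (x + y) <= Num.min c1 c2.
    apply: le_trans (nmD _ _) _; apply: le_trans (lerD xc yc) _; rewrite /c; lra.
  by rewrite le_min => /andP.
have cc1 (x : V) : nm x <= c -> [/\ nm x <= c1 & nm x <= c2].
  by move=> xc; have := cc x 0 xc; rewrite addr0; apply; rewrite nm0 ltW.
have eD (x y : V) : nm x <= c -> nm y <= c -> e (x + y) = e x + e y.
  move=> xc yc; have [xy1 xy2] := cc x y xc yc.
  have [x1 x2] := cc1 x xc; have [y1 y2] := cc1 y yc.
  apply/eqP; rewrite -subr_eq0; apply/eqP; apply: disc.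
    have := nmB (e (x + y)) (e x + e y); have := nmD (e x) (e y).
    have := eS _ xy2; have := eS _ x2; have := eS _ y2.
    move: (nm _) (nm _) (nm _) (nm _) (nm _) => *; lra.
  have -> : frame u (e (x + y) - (e x + e y)) = (frame u (e (x + y)) - g (frame u (x + y)))
      - (frame u (e x) - g (frame u x)) - (frame u (e y) - g (frame u y)).
    by rewrite frameB (frameD (e x) (e y)) (frameD x y) (raddfD g); exact: defect_sum.
  by apply: latticeB (eL _ y1); apply: latticeB (eL _ x1); exact: eL.
have de : is_diff 0 e ('d delta 0).
  have H := is_diffB (differentiableP dd) (is_diff_cst (delta 0) (0 : V)).
  apply: (is_diff_congr H) => //; by apply/funext => z; rewrite /= subr0.
have eE := additive_germ_linear c0 eD de.
pose D := lin1_mx ('d delta 0).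
have DE z : 'd delta 0 z = z *m D by rewrite mul_rV_lin1.
exists D => z.
have qL (w : V) : nm w <= c -> L (g (frame u w) - frame u (w *m D)).
  move=> wc; rewrite -DE -(eE _ wc) -opprB -[- _]sub0r; apply: latticeB.
    exact: lattice0.
  by apply: eL; have [] := cc1 w wc.
have [n nP] := shrink z c0.
have qM m : g (frame u z) - frame u (z *m D) =
    (g (frame u (m.+1%:R^-1 *: z)) - frame u ((m.+1%:R^-1 *: z) *m D)) *+ m.+1.
  have mD (w : V) k' : (w *m D) *+ k' = (w *+ k') *m D.
    by rewrite -[RHS]/(mulmxr D _) raddfMn.
  have fM (w : V) k' : frame u (w *+ k') = frame u w *+ k' by rewrite raddfMn.
  by rewrite mulrnBl -(raddfMn g) -!fM mD scale_nat.
have qLz : L (g (frame u z) - frame u (z *m D)).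
  by rewrite (qM n); apply: latticeMn; apply: qL; exact: nP.
apply/eqP; rewrite -subr_eq0; apply/eqP; apply: (lattice_divisible0 (triv_lattice triv Uu) qLz) => m.
pose N := (n.+1 * m.+1).-1; have NE : N.+1 = (n.+1 * m.+1)%N by [].
exists ((g (frame u (N.+1%:R^-1 *: z)) - frame u ((N.+1%:R^-1 *: z) *m D)) *+ n.+1).
  by apply: latticeMn; apply: qL; apply: nP; rewrite /N mulnS /= leq_addr.
by rewrite -mulrnA -NE; exact: qM.
Qed.

Lemma lattice_matrix : exists N : 'M[int]_(r + r), forall a,
  g (frame u (row a (per u))) = frame u (\sum_b row b (per u) *~ N a b).
Proof.
have gL x : L x -> L (g x).
  by rewrite /lat /= => xL; rewrite -f_lift xL f_lift raddf0.
have H a : exists k : 'I_(r + r) -> int, g (frame u (row a (per u))) =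
    frame u (\sum_b row b (per u) *~ k b).
  by apply: lattice_combination; apply: gL; exact: period_in_lattice.
have [k kP] := choice H; exists (\matrix_(a, b) k a b) => a; rewrite kP.
by congr (frame u _); apply: eq_bigr => b _; rewrite mxE.
Qed.

Lemma pol_mulz x y n : L x -> L y -> L (x *~ n) -> L (y *~ n) ->
  pol (x *~ n) (y *~ n) = n * n * pol x y.
Proof.
have [_ [_ [H [Hlin [Hconj [_ HJ]]]]]] := pol_polarization G u.
have H0 z : H z 0 = 0.
  have := Hlin z 1 0 0; rewrite scaler0 addr0 mul1r => /eqP.
  by rewrite -subr_eq subrr => /eqP.
have HZ z k w : H z (w *~ k) = k%:~R * H z w.
  by rewrite -scaler_int -[_ *: w]addr0 Hlin H0 addr0.
have HZl z k w : H (z *~ k) w = k%:~R * H z w.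
  by rewrite (Hconj w (z *~ k)) HZ (Hconj w z) rmorphM rmorph_int.
move=> Lx Ly Lnx Lny.
suff : (pol (x *~ n) (y *~ n))%:~R = (n * n * pol x y)%:~R :> R.
  by move=> /eqP; rewrite eqr_int => /eqP.
rewrite -(HJ _ _ Lnx Lny) HZ HZl mulrA -intrM [RHS]intrM -(HJ _ _ Lx Ly).
rewrite -(rmorph_int (real_complex R)).
by rewrite imM /= mul0r addr0.
Qed.

Lemma scalar_lift (N : 'M[int]_(r + r)) n (a0 : 'I_(r + r)) : N = n%:M ->
  (forall a, g (frame u (row a (per u))) = frame u (\sum_b row b (per u) *~ N a b)) ->
  n = 1 \/ n = -1.
Proof.
move=> -> gN; have gP a : g (frame u (row a (per u))) = frame u (row a (per u)) *~ n.
  rewrite gN (bigD1 a)//= mxE eqxx mulr1n big1 ?addr0 ?raddfMz// => b /negPf ba.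
  by rewrite mxE eq_sym ba mulr0n mulr0z.
have gx x : L x -> g x = x *~ n.
  move=> /lattice_combination[k ->]; rewrite !raddf_sum /= mulrz_suml.
  by apply: eq_bigr => a _; rewrite !raddfMz gP mulrzAC.
have gL x : L x -> L (g x).
  by rewrite /lat /= => xL; rewrite -f_lift xL f_lift raddf0.
have nn y : L y -> (n * n - 1) * pol (frame u (row a0 (per u))) y = 0.
  move=> Ly; have La := period_in_lattice a0; apply/eqP; rewrite mulrBl mul1r subr_eq0.
  by rewrite -pol_mulz -?gx ?g_pol//; apply: gL.
have [n1|n1] := eqVneq (n * n - 1) 0.
  have : (n - 1) * (n + 1) = 0 by rewrite -subr_sqr expr1n expr2.
  by move=> /eqP; rewrite mulf_eq0 subr_eq0 addr_eq0 => /orP[/eqP|/eqP]; [left|right].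
have : frame u (row a0 (per u)) = 0.
  have [_ [nd _]] := pol_polarization G u.
  apply: nd => [|y /nn /eqP]; first exact: period_in_lattice.
  by rewrite mulf_eq0 (negPf n1) => /eqP.
have [indep _] := triv_lattice triv Uu.
move=> b0; pose x (a : 'I_(r + r)) : R := (a == a0)%:R.
have /indep/(_ a0) : \sum_a (real_complex R (x a) : C) *: frame u (row a (per u)) = 0.
  apply: big1 => a _; rewrite /x.
  by have [->|aa] := eqVneq a a0; rewrite ?b0 ?scaler0// rmorph0 scale0r.
by rewrite /x eqxx => /eqP; rewrite oner_eq0.
Qed.

Lemma automorphism_matrix : (0 < r)%N ->
  exists (N : 'M[int]_(r + r)) (D : 'M[C]_r),
    map_mx intr N *m per u = per u *m D /\
    forall n, N = n%:M -> (forall v : cov G u, f (texp v) = texp v) \/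
                          (forall v : cov G u, f (texp v) = texp (- v)).
Proof.
move=> r0; have [D gD] := lift_linear; have [N gN] := lattice_matrix.
have [k kK Kk] := triv_frame triv Uu.
have PD a : row a (per u) *m D = \sum_b row b (per u) *~ N a b.
  by apply: (can_inj kK); rewrite -gD gN.
have E : map_mx intr N *m per u = per u *m D.
  apply/row_matrixP => a; rewrite !row_mul PD mulmx_sum_row.
  by apply: eq_bigr => b _; rewrite !mxE scaler_int.
exists N, D; split=> // n Nn.
have a0 : 'I_(r + r) by apply: (@Ordinal _ 0); rewrite addn_gt0 r0.
have [K KP] := period_left_inverse (triv_period_matrix triv Uu).
have Dn : D = n%:~R%:M.
  rewrite -[D]mul1mx -KP -mulmxA -E Nn map_scalar_mx mul_scalar_mx -scalemxAr KP.
  by rewrite scalemx1.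
have gv v : g v = v *~ n.
  rewrite -(Kk v) gD Dn mul_mx_scalar scaler_int.
  by rewrite raddfMz.
have [n1|n1] := scalar_lift a0 Nn gN; [left|right] => v; by rewrite f_lift gv n1 ?mulr1z ?mulrN1z.
Qed.

End AutomorphismMatrix.

Lemma enhanced_matrix (R : realType) r (M : cmanifold R r) (G : sk_geometry M)
    (U : set M) (frame : forall u, {linear 'rV[Cplx R]_r -> cov G u})
    (per : M -> 'M[Cplx R]_(r + r, r)) u :
  (0 < r)%N -> local_triv U frame per -> U u -> enhanced_aut G u ->
  exists N : 'M[int]_(r + r), (forall n, N <> n%:M) /\
    exists D, map_mx intr N *m per u = per u *m D.
Proof.
move=> r0 triv Uu [f [[_ [f_hol [g [f_lift g_pol]]]] [nid nop]]].
have [N [D [ND Nn]]] := automorphism_matrix triv Uu f_hol f_lift g_pol r0.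
by exists N; split=> [n /Nn[]//|]; exists D.
Qed.

(** * Flatness of the period matrix *)

Lemma baire_countable (R : realType) n (T : countType) (O : set 'rV[Cplx R]_n.+1)
    (Q : T -> set 'rV[Cplx R]_n.+1) : open O -> O !=set0 ->
  (forall N y, O y -> ~ Q N y -> \forall z \near y, ~ Q N z) ->
  (forall y, O y -> exists N, Q N y) ->
  exists N y, O y /\ \forall z \near y, Q N z.
Proof.
move=> Oo O0 Qc Qcov.
pose F i : set 'rV[Cplx R]_n.+1 := if unpickle i is Some N then Q N else set0.
have [||i [y [Oy]]] := @baire_complex R n O F Oo O0.
- move=> i y Oy; rewrite /F; case: (unpickle i) => [N|]; first exact: Qc.
  by move=> _; near=> z.
- by move=> y /Qcov[N QN]; exists (pickle N); rewrite /F pickleK.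
rewrite /F; case: (unpickle i) => [N|] Fy; first by exists N, y.
by have := nbhs_singleton Fy.
Unshelve. all: by end_near.
Qed.

Lemma chart_preimage_open (R : realType) n (M : cmanifold R n) (c : chart R M n)
    (B : set 'rV[Cplx R]_n) : open B -> open [set x | cdom c x /\ B (cfun c x)].
Proof.
move=> Bo; rewrite openE => x [cx Bx].
have nB : \forall w \near x, B (cfun c w).
  by apply: (cfun_continuous cx); apply: open_nbhs_nbhs; split.
by apply: filterI => //; exact: cdom_near.
Qed.

Lemma chart_dense (R : realType) n (M : cmanifold R n) (c : chart R M n) (D : set M)
    (Q : set 'rV[Cplx R]_n) y : open D -> dense D -> ccod c y ->
  (\forall z \near y, Q z) ->
  exists O : set 'rV[Cplx R]_n, [/\ open O, O !=set0 & forall z, O z -> Q z /\ D (cinv c z)].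
Proof.
move=> Do Dd cy nQ; pose B := interior [set z | ccod c z /\ Q z].
have Bo : open B by exact: open_interior.
have By : B y by apply: filterS2 (ccod_near cy) nQ => z; split.
have BQ z : B z -> ccod c z /\ Q z by exact: interior_subset.
have [x [[cx Bx] Dx]] : ([set x | cdom c x /\ B (cfun c x)] `&` D) !=set0.
  apply: Dd; first by exists (cinv c y); split; [exact: cinv_dom cy|rewrite cinvK].
  exact: chart_preimage_open.
exists (B `&` cinv c @^-1` D); split.
- rewrite openE => z [Bz Dz].
  have nD : \forall w \near z, D (cinv c w).
    by apply: (cinv_continuous (BQ z Bz).1); exact: open_nbhs_nbhs.
  by apply: filterI => //; exact: open_nbhs_nbhs.
- by exists (cfun c x); split=> //=; rewrite cfunK.
- by move=> z [/BQ[]].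
Qed.

Section Curvature.
Variable R : realType.
Local Notation C := (Cplx R).

Lemma scale_special_coordinates r (M : cmanifold R r) (G : sk_geometry M)
    (c : chart R M r) U (frame : forall u, {linear 'rV[C]_r -> cov G u}) per :
  scale_invariant G -> atlas c -> local_triv U frame per ->
  exists (a : 'rV[C]_r -> 'cV[C]_r) (A : 'rV[C]_r -> 'M[C]_r),
  forall y, base_dom c U y -> [/\ differentiable a y,
    forall e, 'd (fun y => chart_period c per y *m a y) y e =
              chart_period c per y *m A y *m e^T &
    A y \in unitmx].
Proof.
move=> [D [act [actX [_ [_ [action [_ [_ scaling]]]]]]]] ac triv.
have /choice[ch chP] : forall x : Defs.total G, exists d : chart R (Defs.total G) (r + r), chart_at x d.
  by move=> x; have [d ad dx] := atlas_cover x; exists d.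
apply: (special_coordinates ac triv (@sform_fiber _ _ _ G)
  (th := liouville_form (sform G) actX) _ _ _ chP).
- by move=> d y ad dy; have [] := liouville_form_is_diff (sform G) action ad dy.
- by move=> d e x w dx ex; exact: (liouville_form_transition (sform G) action).
- by move=> d y v w ad dy; exact: (d_liouville_form action scaling).
Qed.

Variables (M : cmanifold R 2) (G : sk_geometry M) (c : chart R M 2) (U : set M)
  (frame : forall u, {linear 'rV[C]_2 -> cov G u}) (per : M -> 'M[C]_(2 + 2, 2)).
Hypothesis c_atlas : atlas c.
Hypothesis triv : local_triv U frame per.
Hypothesis G_scale : scale_invariant G.
Local Notation P := (chart_period c per).
Local Notation dom := (base_dom c U).

Lemma intertwined_closed (O : set 'rV[C]_2) (N : 'M[C]_(2 + 2)) y : open O -> O `<=` dom ->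
  O y -> ~ (exists D, N *m P y = P y *m D) ->
  \forall z \near y, ~ exists D, N *m P z = P z *m D.
Proof.
move=> Oo Odom Oy NP.
have dP z : O z -> differentiable P z.
  by move=> /Odom; exact: (period_differentiable c_atlas triv).
have perP z : O z -> period_matrix (P z) by move=> /Odom; exact: (chart_period_matrix triv).
have [pr [K nK]] := period_projector Oo dP perP Oy.
have [_ dpr _ _ [_ prE]] := nbhs_singleton nK.
pose S z := pr z *m N *m P z.
have dS : is_diff y S (fun h => 'd pr y h *m N *m P y + pr y *m N *m 'd P y h).
  exact: (is_diff_mulmx (is_diff_mulmxr N (differentiableP dpr)) (differentiableP (dP y Oy))).
have [i [j Sij]] : exists i j, S y i j != 0.
  apply: contrapT => H; apply: NP; exists (invmx (K *m P y) *m K *m N *m P y).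
  have : S y = 0.
    by apply/matrixP => i j; rewrite [RHS]mxE; apply: contrapT => /eqP ?; apply: H; exists i, j.
  rewrite /S prE !mulmxBl mul1mx => /eqP; rewrite subr_eq0 => /eqP ->.
  by rewrite !mulmxA.
have Sc : {for y, continuous (fun z => S z i j)} by exact: is_diff_cont (is_diff_coord i j dS).
have nS : \forall z \near y, S z i j != 0.
  have s0 : 0 < nm (S y i j) / 2 by rewrite divr_gt0// nm_gt0.
  apply: (Sc [set x | x != 0]); apply/nbhs_nm; exists (nm (S y i j) / 2) => // x /= xS.
  apply: contraTneq xS => ->; rewrite sub0r nmN -ltNge; lra.
apply: filterS2 nS nK => z Sz [_ _ prP _ _] [D ND].
by move: Sz; rewrite /S -mulmxA ND mulmxA prP mul0mx mxE eqxx.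
Qed.

Lemma periods_differentiable z : dom z -> differentiable P z.
Proof. exact: (period_differentiable c_atlas triv). Qed.

Lemma P_period z : dom z -> period_matrix (P z).
Proof. exact: (chart_period_matrix triv). Qed.

Lemma curved_generic_open (D : set M) y1 : open D -> dense D -> dom y1 -> curved P y1 ->
  exists O : set 'rV[C]_2, [/\ open O, O !=set0 &
    forall y, O y -> (dom y /\ curved P y) /\ D (cinv c y)].
Proof.
move=> Do Dd Yy1 cy1; have Yo := dom_open triv (c := c).
have nB := curved_near Yo periods_differentiable P_period Yy1 cy1.
exact: (chart_dense Do Dd Yy1.1 nB).
Qed.

Lemma generic_automorphism (O : set 'rV[C]_2) : open O -> O !=set0 -> O `<=` dom ->
  (forall y, O y -> enhanced_aut G (cinv c y)) ->
  exists (N : 'M[int]_(2 + 2)) y, [/\ O y, forall n, N <> n%:M &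
    \forall z \near y, exists D, map_mx intr N *m P z = P z *m D].
Proof.
move=> Oo O0 Odom OG.
pose Q (N : 'M[int]_(2 + 2)) : set 'rV[C]_2 := [set z | (forall n : int, N <> n%:M) /\
  exists D, map_mx intr N *m P z = P z *m D].
have [N [y [Oy Qy]]] : exists N y, O y /\ \forall z \near y, Q N z.
  apply: baire_countable => //.
    move=> N z Oz NQ.
    have [Nn|Nn] := pselect (forall n : int, N <> n%:M); last by near=> w => -[].
    have nF : ~ (exists D0, map_mx intr N *m P z = P z *m D0) by move=> ?; apply: NQ.
    by apply: filterS (intertwined_closed Oo Odom Oz nF) => w nw [_].
  move=> z Oz; have [_ Uz] := Odom z Oz.
  by have [N [Nn ND]] := enhanced_matrix (r := 2) isT triv Uz (OG z Oz); exists N.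
have [Nn _] := nbhs_singleton Qy.
by exists N, y; split=> //; apply: filterS Qy => z [].
Unshelve. all: by end_near.
Qed.

Lemma intr_mx_real m (N : 'M[int]_m) : conjCmx (map_mx intr N : 'M[C]_m) = map_mx intr N.
Proof.
apply/matrixP => k l; rewrite !mxE -(rmorph_int (real_complex R)).
by apply: Cplx_eq; rewrite //= oppr0.
Qed.

Lemma intr_mx_scalar m (N : 'M[int]_m.+1) (nu : C) : map_mx intr N = nu%:M -> N = (N 0 0)%:M.
Proof.
move=> Nnu; apply/matrixP => k l; apply: (@intr_inj C).
have /matrixP H := Nnu; have N0 := H 0 0; have Nkl := H k l.
rewrite !mxE eqxx mulr1n in N0; rewrite !mxE in Nkl.
rewrite [X in _ = X%:~R]mxE Nkl -N0.
by case: (k == l); rewrite ?mulr1n ?mulr0n.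
Qed.

Lemma generic_not_curved (D : set M) : open D -> dense D ->
  (forall u, D u -> enhanced_aut G u) -> forall y, dom y -> ~ curved P y.
Proof.
move=> Do Dd DG y1 Yy1 cy1.
have [W [Oo O0 OP]] := curved_generic_open Do Dd Yy1 cy1.
have Odom : W `<=` dom by move=> y /OP[[]].
have OG y : W y -> enhanced_aut G (cinv c y) by move=> /OP[_]; exact: DG.
have [N [y [Oy Nn NP]]] := generic_automorphism Oo O0 Odom OG.
pose O3 := W `&` interior [set z | exists D, map_mx intr N *m P z = P z *m D].
have O3o : open O3 by apply: openI => //; exact: open_interior.
have O3y : O3 y by split.
have O3dom z : O3 z -> dom z by move=> [/Odom].
have [a [A aA]] := scale_special_coordinates G_scale c_atlas triv.
have da z : O3 z -> differentiable a z by move=> /O3dom/aA[].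
have dZ z : O3 z -> forall e, 'd (fun y => P y *m a y) z e = P z *m A z *m e^T by move=> /O3dom/aA[].
have Au z : O3 z -> A z \in unitmx by move=> /O3dom/aA[].
have NP' z : O3 z -> exists D, map_mx intr N *m P z = P z *m D by move=> [_ /interior_subset].
have Ns (nu : C) : map_mx intr N <> nu%:M by move=> /intr_mx_scalar/Nn.
have dP z : O3 z -> differentiable P z by move=> /O3dom; exact: periods_differentiable.
have perP z : O3 z -> period_matrix (P z) by move=> /O3dom; exact: P_period.
have cy : curved P y by have [[]] := OP y Oy.
by have := automorphism_not_curved O3o dP da dZ Au perP NP' (intr_mx_real N) Ns O3y cy.
Qed.

End Curvature.

(** * The modulus *)

Section Isotropic.
Variables (R : realType) (V : vectType (Cplx R)).
Local Notation C := (Cplx R).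
Local Notation re := (@complex.Re R).
Local Notation im := (@complex.Im R).
Variables (L : set V) (J : V -> V -> int) (r : nat) (d : 'I_r -> nat) (b : 'I_(r + r) -> V).
Hypothesis Jpol : polarization L J.
Hypothesis b_symp : symplectic_basis L J d b.

Lemma real_alpha_independent (x : 'I_r -> R) :
  \sum_i (real_complex R (x i) : C) *: b (lshift r i) = 0 -> forall i, x i = 0.
Proof.
move=> x0 i; have [[indep _] _] := b_symp.
pose y (j : 'I_(r + r)) : R := match fintype.split j with inl i => x i | inr _ => 0 end.
have ys j : y (lshift r j) = x j.
  by rewrite /y -[lshift r j]/(unsplit (inl j)) unsplitK.
rewrite -ys; apply: indep; rewrite big_split_ord /= [X in _ + X]big1 ?addr0.
  by apply: etrans x0; apply: eq_bigr => j _; rewrite ys.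
by move=> j _; rewrite /y -[rshift r j]/(unsplit (inr j)) unsplitK rmorph0 scale0r.
Qed.

(* H is real on the real span of the alpha's, so x + i y = 0 there forces H x x = - i H x y to be both real and imaginary. *)
Lemma alpha_independent (v : 'I_r -> C) :
  \sum_i v i *: b (lshift r i) = 0 -> forall i, v i = 0.
Proof.
have [_ [_ [H [Hlin [Hconj [Hpos HJ]]]]]] := Jpol.
pose al i := b (lshift r i).
have H0 z : H z 0 = 0.
  have := Hlin z 1 0 0; rewrite scaler0 addr0 mul1r => /eqP.
  by rewrite -subr_eq subrr => /eqP.
have Hsum z (x : 'I_r -> C) : H z (\sum_i x i *: al i) = \sum_i x i * H z (al i).
  elim: (index_enum _) => [|j s IH]; first by rewrite !big_nil H0.
  by rewrite !big_cons Hlin IH.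
have imsum (F : 'I_r -> C) : (forall i, im (F i) = 0) -> im (\sum_i F i) = 0.
  by move=> F0; elim/big_ind: _ => // x y x0 y0; rewrite imD x0 y0 addr0.
have rsum (F : 'I_r -> C) (x : 'I_r -> R) : (forall i, im (F i) = 0) ->
    im (\sum_i (real_complex R (x i) : C) * F i) = 0.
  by move=> F0; apply: imsum => i; rewrite imM /= F0 mulr0 mul0r addr0.
have alJ i j : im (H (al i) (al j)) = 0.
  have Lal k : L (al k) by have [Lb _] := b_symp; exact: lattice_basis_mem Lb.
  rewrite HJ//.
  by have [_ [_ [_ /(_ i j)[-> _ _ _]]]] := b_symp; rewrite mulr0z.
pose comb (x : 'I_r -> R) := \sum_i (real_complex R (x i) : C) *: al i.
have imconj z w : im (H z w) = 0 -> im (H w z) = 0.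
  by move=> h; rewrite (Hconj z w); case: (H z w) h => a1 a2 /= ->; rewrite oppr0.
have Hcomb x y : im (H (comb x) (comb y)) = 0.
  rewrite /comb Hsum; apply: (rsum) => j; apply: imconj.
  by rewrite Hsum; apply: (rsum) => i.
have comb0 x y (a : C) : re a = 0 -> comb x = a *: comb y -> comb x = 0.
  move=> a0 xy; apply: contrapT => /eqP/Hpos.
  rewrite [X in H _ X]xy -[X in H _ X]addr0 Hlin H0 addr0 ltcE => /andP[_].
  by rewrite reM a0 Hcomb mul0r mulr0 subr0 ltxx.
move=> v0; pose x i := re (v i); pose y i := im (v i).
have vE : comb x + 'i%C *: comb y = 0.
  apply: etrans v0; rewrite scaler_sumr -big_split; apply: eq_bigr => i _ /=.
  rewrite scalerA -scalerDl; congr (_ *: _).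
  by apply: Cplx_eq; rewrite ?reD ?imD ?reM ?imM /=; ring.
have xE : comb x = - 'i%C *: comb y by apply/eqP; rewrite scaleNr -addr_eq0 vE.
have x0 : comb x = 0 by apply: comb0 xE; rewrite /= oppr0.
have y0 : comb y = 0.
  have /eqP : 'i%C *: comb y = 0 by rewrite -vE x0 add0r.
  rewrite scaler_eq0 => /orP[/eqP i0|/eqP //].
  by have := congr1 im i0; rewrite /= => /eqP; rewrite oner_eq0.
move=> i; apply: Cplx_eq; rewrite /=.
  exact: (real_alpha_independent x0).
exact: (real_alpha_independent y0).
Qed.
End Isotropic.

Section Modulus.
Variables (R : realType) (r : nat).
Local Notation C := (Cplx R).

Lemma is_modulusE (W : vectType C) (d : 'I_r -> nat) (b : 'I_(r + r) -> W)
    (phi : {linear 'rV[C]_r -> W}) (B : 'M[C]_(r + r, r)) tau :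
  bijective phi -> (forall i, b i = phi (row i B)) -> usubmx B \in unitmx ->
  is_modulus d b tau <->
  tau = dsubmx B *m invmx (usubmx B) *m diag_mx (\row_i (d i)%:R).
Proof.
move=> [k kK Kk] bE Bu; set Delta := diag_mx _.
have DeltaE i j : Delta i j = (if i == j then d i else 0%N)%:R.
  by rewrite !mxE; case: eqP => _; rewrite ?mulr1n ?mulr0n.
have bl i : b (lshift r i) = phi (row i (usubmx B)).
  by rewrite bE; congr (phi _); apply/rowP => j; rewrite !mxE.
have br i : b (rshift r i) = phi (row i (dsubmx B)).
  by rewrite bE; congr (phi _); apply/rowP => j; rewrite !mxE.
split=> [[theta [thl thr]]|->].
  pose Th : 'M[C]_r := \matrix_(i, j) theta j (phi (delta_mx 0 i)).
  have thE j z : theta j (phi z) = (z *m Th) 0 j.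
    rewrite {1}[z]row_sum_delta !linear_sum mxE; apply: eq_bigr => i _.
    by rewrite !linearZ mxE.
  have Dl : usubmx B *m Th = Delta.
    by apply/matrixP => i j; rewrite DeltaE -thl bl thE -row_mul [RHS]mxE.
  have Dr : tau = dsubmx B *m Th.
    by apply/matrixP => i j; rewrite thr br thE -row_mul [LHS]mxE.
  by rewrite Dr -Dl -!mulmxA mulKmx.
pose Th := invmx (usubmx B) *m Delta.
have thlin j : linear (fun v => (k v *m Th) 0 j : C).
  move=> a x y; have -> : k (a *: x + y) = a *: k x + k y.
    by apply: (can_inj kK); rewrite linearP !Kk.
  by rewrite mulmxDl -scalemxAl [LHS]mxE [X in X + _]mxE.
pose theta j : {linear W -> C} :=
  HB.pack (fun v => (k v *m Th) 0 j : C) (GRing.isLinear.Build C W C *:%R _ (thlin j)).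
have thE j z : theta j (phi z) = (z *m Th) 0 j by rewrite /= kK.
exists theta; split=> i j.
  by rewrite bl thE -row_mul mulmxA mulmxV// mul1mx mxE DeltaE.
by rewrite br thE -row_mul mulmxA [RHS]mxE.
Qed.

End Modulus.

Section ModulusConstant.
Variable R : realType.
Local Notation C := (Cplx R).

Lemma period_quotient_constant m r (P : 'rV[C]_r -> 'M[C]_(m, r)) (Ku Kd : 'M[C]_(r, m)) y0 :
  (\forall y \near y0, [/\ differentiable P y, Ku *m P y \in unitmx &
     forall (k : 'rV[C]_m) e, k *m P y = 0 -> k *m 'd P y e = 0]) ->
  \forall y \near y0, Kd *m P y *m invmx (Ku *m P y) = Kd *m P y0 *m invmx (Ku *m P y0).
Proof.
move=> nP; pose Q y := Kd *m P y *m invmx (Ku *m P y).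
have dQ : \forall y \near y0, is_diff y Q (fun=> 0).
  apply: filterS nP => y [/differentiableP dP uP flat].
  have H := is_diff_mulmx (is_diff_mulmxl Kd dP) (inv_is_diff (is_diff_mulmxl Ku dP) uP).
  apply: (is_diff_congr H erefl); apply/funext => h.
  have fl : (Kd - Q y *m Ku) *m 'd P y h = 0.
    apply/row_matrixP => i; rewrite row0 row_mul; apply: flat.
    by rewrite -row_mul mulmxBl -mulmxA mulmxKV// subrr row0.
  rewrite mulmxN; apply/eqP; rewrite subr_eq0; apply/eqP.
  move/eqP: fl; rewrite mulmxBl subr_eq0 => /eqP ->.
  by rewrite /Q !mulmxA.
have nQ i j : \forall y \near y0, Q y i j = Q y0 i j.
  apply: locally_constant0; apply: filterS dQ => y H.
  have H2 := is_diff_coord i j H; apply: (is_diff_congr H2 erefl).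
  by apply/funext => h; rewrite mxE.
have nQQ := @filter_forall _ _ (fun (ij : 'I_r * 'I_r) y => Q y ij.1 ij.2 = Q y0 ij.1 ij.2)
  (nbhs y0) (nbhs_filter y0) (fun ij => nQ ij.1 ij.2).
by apply: filterS nQQ => y H; apply/matrixP => i j; exact: (H (i, j)).
Qed.

Variables (r : nat) (M : cmanifold R r) (G : sk_geometry M).
Variables (U : set M) (frame : forall u, {linear 'rV[C]_r -> cov G u})
  (per : M -> 'M[C]_(r + r, r)).
Hypothesis triv : local_triv U frame per.

Lemma section_matrix (A : set M) (b : 'I_(r + r) -> forall u, cov G u) u0 :
  (forall a, locally_constant A (b a)) -> A u0 -> U u0 ->
  exists K : 'M[int]_(r + r), \forall u \near u0, forall a,
    b a u = frame u (row a (map_mx intr K *m per u)).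
Proof.
move=> blc Au Uu.
have H a : exists k : 'I_(r + r) -> int,
    \forall u \near u0, b a u = \sum_e frame u (row e (per u)) *~ k e.
  by apply: (blc a _ _ _ triv).
have [k kP] := choice H; exists (\matrix_(a, e) k a e).
have nb := @filter_forall _ _ (fun a u => b a u = \sum_e frame u (row e (per u)) *~ k a e) (nbhs u0) (nbhs_filter u0) kP.
apply: filterS nb => u bu a; rewrite bu row_mul mulmx_sum_row linear_sum.
by apply: eq_bigr => e _; rewrite linearZ /= !mxE scaler_int.
Qed.

Lemma alpha_periods_unit u (d : 'I_r -> nat) (b : 'I_(r + r) -> cov G u) (B : 'M[C]_(r + r, r)) :
  symplectic_basis (@lat _ _ _ G u) (@pol _ _ _ G u) d b ->
  (forall a, b a = frame u (row a B)) -> usubmx B \in unitmx.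
Proof.
move=> bs bE; rewrite -row_free_unit; apply: inj_row_free => v vB.
apply/rowP => i; rewrite mxE.
apply: (alpha_independent (pol_polarization G u) bs (v := fun i => v 0 i)).
have : frame u (v *m usubmx B) = 0 by rewrite vB linear0.
rewrite mulmx_sum_row linear_sum => H; apply: etrans _ H; apply: eq_bigr => j _.
rewrite linearZ /= bE; congr (_ *: frame u _).
by apply/rowP => k; rewrite !mxE.
Qed.

End ModulusConstant.

Lemma chart_near (R : realType) n (M : cmanifold R n) (c : chart R M n) x
    (Q : set 'rV[Cplx R]_n) : cdom c x ->
  (\forall y \near cfun c x, Q y) -> \forall u \near x, Q (cfun c u).
Proof. by move=> cx nQ; apply: (cfun_continuous cx). Qed.

Lemma chart_near_inv (R : realType) n (M : cmanifold R n) (c : chart R M n) x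
    (Q : set M) : cdom c x ->
  (\forall u \near x, Q u) -> \forall y \near cfun c x, Q (cinv c y).
Proof.
move=> cx nQ; have cont := cinv_continuous (cfun_cod cx).
by apply: cont; rewrite cfunK.
Qed.

Section LocallyConstantModulus.
Variables (R : realType) (r : nat) (M : cmanifold R r) (G : sk_geometry M).
Local Notation C := (Cplx R).
Hypothesis flat : forall (c : chart R M r) (U : set M)
  (frame : forall u, {linear 'rV[C]_r -> cov G u}) (per : M -> 'M[C]_(r + r, r)),
  atlas c -> local_triv U frame per -> forall y, base_dom c U y ->
  forall (k : 'rV[C]_(r + r)) e, k *m chart_period c per y = 0 ->
    k *m 'd (chart_period c per) y e = 0.
Variables (A : set M) (d : 'I_r -> nat) (b : 'I_(r + r) -> forall u, cov G u).
Hypothesis A_open : open A.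
Hypothesis b_constant : forall a, locally_constant A (b a).
Hypothesis b_symplectic : forall u, A u ->
  symplectic_basis (@lat _ _ _ G u) (@pol _ _ _ G u) d (fun a => b a u).

Lemma modulus_locally_constant u0 : A u0 ->
  (exists tau, is_modulus d (b ^~ u0) tau) /\
  \forall u \near u0, forall tau, is_modulus d (b ^~ u) tau <-> is_modulus d (b ^~ u0) tau.
Proof.
move=> Au0; have [U [frame [per [triv Uu0]]]] := triv_cover G u0.
have [c ac cu0] := atlas_cover u0.
have [K KP] := section_matrix triv b_constant Au0 Uu0.
set k : 'M[C]_(r + r) := map_mx intr K in KP.
pose good u := [/\ A u, U u & forall a, b a u = frame u (row a (k *m per u))].
have ngood : \forall u \near u0, good u.
  have nA : \forall u \near u0, A u by exact: open_nbhs_nbhs.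
  have nU : \forall u \near u0, U u by apply: open_nbhs_nbhs; split=> //; exact: triv_open triv.
  by apply: filterS3 nA nU KP => u.
have gunit u : good u -> usubmx (k *m per u) \in unitmx.
  by move=> [Au Uu bu]; exact: (alpha_periods_unit (b_symplectic Au) bu).
have modE u tau : good u -> is_modulus d (b ^~ u) tau <->
    tau = dsubmx k *m per u *m invmx (usubmx k *m per u) *m diag_mx (\row_i (d i)%:R).
  move=> gu; have [_ Uu bu] := gu.
  have := is_modulusE d tau (triv_frame triv Uu) bu (gunit u gu).
  by rewrite -!mul_dsub_mx -!mul_usub_mx.
have g0 := nbhs_singleton ngood.
split; first by eexists; apply/(modE _ _ g0).
have nP : \forall y \near cfun c u0, [/\ differentiable (chart_period c per) y,
    usubmx k *m chart_period c per y \in unitmx &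
    forall (l : 'rV[C]_(r + r)) e, l *m chart_period c per y = 0 ->
      l *m 'd (chart_period c per) y e = 0].
  apply: filterS2 (chart_near_inv cu0 ngood) (ccod_near (cfun_cod cu0)) => y gy cy.
  have Yy : base_dom c U y by split=> //; have [] := gy.
  split; [exact: (period_differentiable ac triv)|by rewrite mul_usub_mx; exact: gunit|].
  exact: (flat ac triv).
have nT := chart_near cu0 (period_quotient_constant (dsubmx k) nP).
have nc := cdom_near cu0.
near=> u => tau.
have gu : good u by near: u.
have cu : cdom c u by near: u.
have : dsubmx k *m chart_period c per (cfun c u) *m invmx (usubmx k *m chart_period c per (cfun c u)) =
    dsubmx k *m chart_period c per (cfun c u0) *m invmx (usubmx k *m chart_period c per (cfun c u0)).
  by near: u.
rewrite /chart_period (cfunK cu) (cfunK cu0) => Tu.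
by apply: (iff_trans (modE u tau gu)); apply: iff_sym; rewrite Tu; exact: modE.
Unshelve. all: by end_near.
Qed.

End LocallyConstantModulus.

Lemma contractible_locally_constant (R : realType) (M : topologicalType) (A : set M)
    (T : Type) (Q : M -> T -> Prop) :
  contractible R A -> (forall u, A u -> exists t, Q u t) ->
  (forall u, A u -> \forall v \near u, forall t, Q v t <-> Q u t) ->
  exists t, forall u, A u -> Q u t.
Proof.
move=> [x0 [H [Ax0 [Hc [HA [H0 H1]]]]]] Qex Qloc.
have [t0 Qt0] := Qex x0 Ax0; exists t0 => u Au.
pose I : set R := `[0, 1]%classic.
have path_near s : I s -> \forall s' \near s, I s' -> forall t, Q (H (s', u)) t <-> Q (H (s, u)) t.
  move=> Is; have := Qloc _ (HA s u Is Au).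
  have /subspace_continuousP/(_ (s, u) (conj Is Au)) := Hc.
  move=> Hcs /Hcs[[B1 B2] [nB1 nB2] /= BB].
  apply: filterS nB1 => s' Bs' Is'; apply: (BB (s', u)); first by split=> //; exact: nbhs_singleton.
  by split.
pose B s := I s /\ Q (H (s, u)) t0.
have I0 : I 0 by rewrite /I /= in_itv /= lexx ler01.
have I1 : I 1 by rewrite /I /= in_itv /= lexx ler01.
suff BI : [set s | B s] = I.
  have : [set s | B s] 0 by rewrite BI.
  by move=> [_]; rewrite H0.
have conn : connected I by exact: segment_connected.
apply: conn.
- by exists 1; split=> //; rewrite H1.
- exists (interior [set s | I s -> B s]); first exact: open_interior.
  apply/seteqP; split=> s; last by move=> [Is /interior_subset]; apply.
  move=> [Is Qs]; split=> //; apply: filterS (path_near s Is) => s' E Is'.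
  by split=> //; apply/(E Is').
- exists (~` interior [set s | I s -> ~ B s]); first exact/open_closedC/open_interior.
  apply/seteqP; split=> s.
    by move=> [Is Qs]; split=> // /interior_subset; apply.
  move=> [Is nint]; apply: contrapT => nB; apply: nint.
  apply: filterS (path_near s Is) => s' E Is' [_ Qs']; apply: nB.
  by split=> //; apply/(E Is').
Qed.

Theorem mainTheorem4 (R : realType) (M : cmanifold R 2) (G : sk_geometry M)
  (M_connected : connected [set: M])
  (G_scale : scale_invariant G)
  (G_generic : exists D : set M,
     open D /\ dense D /\ forall u, D u -> enhanced_aut G u) :
  isotrivial G.
Proof.
have [D [Do [Dd DG]]] := G_generic.
have flat (c : chart R M 2) U (frame : forall u, {linear 'rV[Cplx R]_2 -> cov G u}) per :
    atlas c -> local_triv U frame per -> forall y, base_dom c U y ->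
    forall (k : 'rV[Cplx R]_(2 + 2)) e, k *m chart_period c per y = 0 ->
      k *m 'd (chart_period c per) y e = 0.
  move=> ac triv y Yy k e kP; apply: contrapT => ke.
  apply: (generic_not_curved ac triv G_scale Do Dd DG Yy).
  by exists k, e; split=> //; apply/eqP.
move=> A d b Ao Ac blc bs.
apply: (contractible_locally_constant Ac) => u Au.
  by have [] := modulus_locally_constant flat Ao blc bs Au.
by have [] := modulus_locally_constant flat Ao blc bs Au.
Qed.
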